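(* There exist universal constants $c,C>0$ such that the following holds. For any function $\varrho:[1,\infty)\to[1,\infty)$ with $\varrho(1)=1$ such that $\frac{\varrho(x)}{\sqrt x}$ and $\frac{x}{\varrho(x)}$ are non-decreasing, there exist a finitely generated group $\Delta$ (with a finite generating set) and a symmetric probability measure $q$ of finite support on $\Delta$ such that for all integers $n\ge1$ $$c\,\varrho(n)\le\mathbf E|W_n|_\Delta\le C\varrho(n)\qquad\text{and}\qquad c\,\varrho(n)\le H(W_n)\le C\varrho(n).$$ Moreover, the group $\Delta$ can be chosen $4$-step solvable.
   Context: $W_n=X_1\cdots X_n$ with $X_i$ i.i.d. of law $q$; $|\cdot|_\Delta$ is the word length with respect to the finite generating set; $H(W_n)=-\sum_x q^{\ast n}(x)\log q^{\ast n}(x)$ is the Shannon entropy of the law $q^{\ast n}$ of $W_n$. $4$-step solvable means the fourth derived subgroup is trivial. *)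

(* Defs.v *)
From mathcomp Require Export all_boot all_order all_algebra.
From mathcomp Require Export all_classical all_reals all_analysis.
Set Implicit Arguments.
Unset Strict Implicit.
Unset Printing Implicit Defensive.
Import Order.TTheory GRing.Theory Num.Theory.

Local Open Scope classical_set_scope.
Local Open Scope group_scope.

Section Groups.
Variable G : groupType.
Implicit Types (S A B : set G) (x : G).

Definition is_subgroup A : Prop := group_closed (mem A).

Definition subgroup_gen S : set G := smallest is_subgroup S.

Definition derived_subgroup A : set G :=
  subgroup_gen [set z | exists x y, [/\ A x, A y & z = [~ x, y]]].

Definition step_solvable (k : nat) : Prop :=
  iter k derived_subgroup [set: G] = [set 1].

Definition is_finite_generating_set S : Prop :=
  finite_set S /\ subgroup_gen S = [set: G].

Definition word_of_length S x (n : nat) : Prop :=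
  exists w : n.-tuple G,
    (forall i, S (tnth w i) \/ S (tnth w i)^-1) /\
    x = \prod_(i < n) tnth w i.

(* The value 0 is a default that is only taken when [x] is not in the subgroup
   generated by [S]. *)
Definition word_length S x : nat :=
  match pselect (exists n, `[< word_of_length S x n >]) with
  | left e => ex_minn e
  | right _ => 0%N
  end.

End Groups.

Local Open Scope ring_scope.

Section RandomWalk.
Variables (R : realType) (G : groupType).
Implicit Type q : G -> R.

(* Probability measures of finite support are given by their mass functions.
   All sums over [G] below are finite-support sums [\sum_(x \in _) _], which
   range over finitely many nonzero terms when [q] has finite support. *)
Definition is_finite_prob q : Prop :=
  [/\ forall x, 0 <= q x,
      finite_set [set x | q x != 0] &
      \sum_(x \in [set: G]) q x = 1].

Definition is_symmetric q : Prop := forall x, q (x^-1)%g = q x.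

(* Expectation of a function of n independent increments [X_1, ..., X_n] of
   law [q], realised as the coordinates of the product measure on [G ^ n]. *)
Definition iid_expectation q (n : nat) (f : n.-tuple G -> R) : R :=
  \sum_(X \in [set: n.-tuple G]) (\prod_(i < n) q (tnth X i)) * f X.

Definition walk (n : nat) (X : n.-tuple G) : G := (\prod_(i < n) tnth X i)%g.

Definition expected_length (S : set G) q (n : nat) : R :=
  iid_expectation q (fun X : n.-tuple G => (word_length S (walk X))%:R).

Definition convolution (p q : G -> R) (x : G) : R :=
  \sum_(y \in [set: G]) p y * q (y^-1 * x)%g.

Definition conv_power q (n : nat) : G -> R :=
  iter n (convolution q) (fun x => (x == 1%g)%:R).

(* [ln 0 = 0] in the library; in any case the factor [p x] makes the term
   vanish, which is the usual convention [0 log 0 = 0]. *)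
Definition shannon_entropy (p : G -> R) : R :=
  - \sum_(x \in [set: G]) p x * ln (p x).

Definition walk_entropy q (n : nat) : R := shannon_entropy (conv_power q n).

End RandomWalk.

(* Main.v *)
(* The group acts, scale by scale, on bundles of fibres over Z.  A walker on Z
   carries lamps of three kinds [a], [b], [c].  At scale [j] the fibre over [z]
   is a torus [(Z/M_j)^4] (possibly [Z^4]) together with one bit per point; the
   walker applies the reflections [e_i -> - e_i] when it stands at [z], the
   reflections [e_i -> u - e_i] when it stands at [z - k_j], and flips the bit of
   the origin of the torus when it stands at [z - 2 k_j], where [k_j = 4 * 8^j].
   A torus step thus costs a journey of length [k_j], and since the reflections
   generate a metabelian group the whole group is 4-step solvable.

   Entropy from below: given everything but the [c] lamps, the position after [n]
   steps is uniform on [2^r] elements, [r] being the size of the inverted orbit of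
   the origin.  By a renewal argument [E r] is at least [n / G_n], with [G_n] the
   Green function, and [G_n <= C (k_j + sqrt n / M_j^4)] because a lazy walk on a
   4-dimensional torus is transient up to the volume of the torus.

   Length from above: at a scale [J] replace the walk by a word remembering only
   the net effect between successive displacements by [8^J]; it has expected
   length [O(n / 8^J + 8^J)] and agrees with the walk on all scales [j >= J].  The
   scales [j < J] are then repaired one by one, touring the torus simultaneously
   over blocks of [8^j] neighbouring fibres, at a cost [O(sqrt n * M_j^4)] each.

   Both bounds are of order [rho n] if [8^J <= n / rho n < 8^(J+1)] and [M_j^4] is
   the value of [rho x / sqrt x] where [x / rho x] reaches [8^(j+1)] (scales at which
   this value has not grown by a constant factor are made trivial).  Gibbs'
   inequality bounds entropy by length and yields the two remaining bounds. *)

From HB Require Import structures.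
Require Import Defs.
From mathcomp Require Import zify ring lra.
Set Implicit Arguments.
Unset Strict Implicit.
Unset Printing Implicit Defensive.
Import Order.TTheory GRing.Theory Num.Theory.
Local Open Scope classical_set_scope.
Local Open Scope ring_scope.

(** * The group *)

(* The switched lamps of the kinds [a], [b] (one bit per torus coordinate) and
   [c]; addition in [bool] is exclusive or. *)
Definition lamp : Type := {ffun 'I_4 -> bool} * {ffun 'I_4 -> bool} * bool.
HB.instance Definition _ := Finite.on lamp.
HB.instance Definition _ := GRing.Zmodule.on lamp.

Definition letter : Type := bool + lamp.
HB.instance Definition _ := Finite.on letter.

(** Only one coordinate is stored: the fibre at scale [j] is the fourth power of [fsort j], and
    [funit] is the [u] of the reflections [x -> u - x]. *)
Record fibres := Fibres { fsort :> nat -> zmodType; funit : forall j, fsort j }.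

Definition width (j : nat) : nat := (8 ^ j)%N.
(** The factor 4 makes a window of radius [width j] shorter than the gap at scale [j]; the ratio 8
    between scales keeps any two gaps at least either width apart ([gap_sep]). *)
Definition gap (j : nat) : int := ((4 * width j)%N)%:Z.

Lemma width_gt0 j : (0 < width j)%N.
Proof. by rewrite /width expn_gt0. Qed.

Lemma gap_gt0 j : 0 < gap j.
Proof. by rewrite /gap; have := width_gt0 j; lia. Qed.

Section Fibre.
Variables (F : zmodType) (u : F).
Notation E := {ffun 'I_4 -> F}.

Definition reflA (v : bool) (x : F) : F := if v then - x else x.
Definition reflB (v : bool) (x : F) : F := if v then u - x else x.
Definition actA (v : {ffun 'I_4 -> bool}) (e : E) : E := [ffun i => reflA (v i) (e i)].
Definition actB (v : {ffun 'I_4 -> bool}) (e : E) : E := [ffun i => reflB (v i) (e i)].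

Lemma reflAD v w x : reflA v (reflA w x) = reflA (v + w) x.
Proof. by case: v; case: w => //=; rewrite /reflA opprK. Qed.

Lemma reflBD v w x : reflB v (reflB w x) = reflB (v + w) x.
Proof. by case: v; case: w => //=; rewrite /reflB subKr. Qed.

Lemma actAD v w e : actA v (actA w e) = actA (v + w) e.
Proof. by apply/ffunP => i; rewrite !ffunE reflAD. Qed.

Lemma actBD v w e : actB v (actB w e) = actB (v + w) e.
Proof. by apply/ffunP => i; rewrite !ffunE reflBD. Qed.

Lemma actA0 e : actA 0 e = e.
Proof. by apply/ffunP => i; rewrite !ffunE. Qed.

Lemma actB0 e : actB 0 e = e.
Proof. by apply/ffunP => i; rewrite !ffunE. Qed.

Definition stA v (s : E * bool) : E * bool := (actA v s.1, s.2).
Definition stB v (s : E * bool) : E * bool := (actB v s.1, s.2).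
(** The bit changes only over the origin, so the maps generated have the form
    [(e, b) -> (g e, b + f e)]: elements of a permutational wreath product, encoded without
    configurations of bits. *)
Definition stC (v : bool) (s : E * bool) : E * bool := (s.1, s.2 + (v && (s.1 == 0))).

Lemma stAD v w s : stA v (stA w s) = stA (v + w) s.
Proof. by rewrite /stA actAD. Qed.
Lemma stBD v w s : stB v (stB w s) = stB (v + w) s.
Proof. by rewrite /stB actBD. Qed.
Lemma stCD v w s : stC v (stC w s) = stC (v + w) s.
Proof.
by rewrite /stC /= -addrA; congr (_, _ + _); case: (s.1 == 0); rewrite ?andbT ?andbF // addrC.
Qed.
Lemma stA0 s : stA 0 s = s. Proof. by case: s => e b; rewrite /stA actA0. Qed.
Lemma stB0 s : stB 0 s = s. Proof. by case: s => e b; rewrite /stB actB0. Qed.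
Lemma stC0 s : stC 0 s = s. Proof. by case: s => e b; rewrite /stC /= addr0. Qed.

(* [r] is the position of the fibre relative to the walker. *)
Definition stlamp (k r : int) (l : lamp) (s : E * bool) : E * bool :=
  if r == 0 then stA l.1.1 s else if r == k then stB l.1.2 s
  else if r == k *+ 2 then stC l.2 s else s.

Lemma stlampD k r l l' s : stlamp k r l (stlamp k r l' s) = stlamp k r (l + l') s.
Proof.
rewrite /stlamp; case: (r == 0); first exact: stAD.
case: (r == k); first exact: stBD.
by case: (r == _) => //; exact: stCD.
Qed.

Lemma stlamp0 k r s : stlamp k r 0 s = s.
Proof. by rewrite /stlamp; do !case: ifP => _; rewrite ?stA0 ?stB0 ?stC0. Qed.

End Fibre.

Lemma lampDD (l : lamp) : l + l = 0.
Proof.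
case: l => [[a b] c]; congr ((_, _), _); last by case: c.
- by apply/ffunP => i; rewrite !ffunE; case: (a i).
- by apply/ffunP => i; rewrite !ffunE; case: (b i).
Qed.

Definition dir_sign (b : bool) : int := if b then 1 else -1.
Lemma dir_signN b : dir_sign (~~ b) = - dir_sign b.
Proof. by case: b. Qed.

Section Delta.
Variable P : fibres.
Notation E j := {ffun 'I_4 -> P j}.
Definition state (j : nat) : Type := int * (E j * bool).

(** The fibres are seen from the walker: a step to the right lowers all relative positions by
    one. *)
Definition step j (l : letter) (w : state j) : state j :=
  match l with
  | inl b => (w.1 - dir_sign b, w.2)
  | inr x => (w.1, stlamp (funit P j) (gap j) w.1 x w.2)
  end.

Definition run (w : seq letter) : forall j, state j -> state j :=
  fun j s => foldl (fun s l => step l s) s w.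

Lemma run_cat w w' j s : run (w ++ w') (j := j) s = run w' (run w s).
Proof. by rewrite /run foldl_cat. Qed.

Definition linv (l : letter) : letter :=
  match l with inl b => inl (~~ b) | inr x => inr x end.
Definition winv (w : seq letter) := rev (map linv w).

Lemma linvK l : linv (linv l) = l.
Proof. by case: l => //= b; rewrite negbK. Qed.
Lemma winvK w : winv (winv w) = w.
Proof. by rewrite /winv map_rev revK -map_comp map_id_in // => x _ /=; rewrite linvK. Qed.

Lemma step_inv l j (s : state j) : step (linv l) (step l s) = s.
Proof.
case: s => r [e b]; case: l => [v|x] /=; first by rewrite dir_signN opprK subrK.
by rewrite stlampD lampDD stlamp0.
Qed.

Lemma run_winv w j (s : state j) : run (winv w) (run w s) = s.
Proof.
elim: w s => [|l w IH] s //=.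
rewrite /winv map_cons rev_cons -cats1 run_cat /= -/(winv w).
by rewrite IH step_inv.
Qed.

Lemma run_winvr w j (s : state j) : run w (run (winv w) s) = s.
Proof. by rewrite -{1}(winvK w) run_winv. Qed.

(* The action is on the right: [f * g] applies [f] first. *)
Definition delta : Type := {f : forall j, state j -> state j | exists w, f = run w}.

HB.instance Definition _ := gen_eqMixin delta.
HB.instance Definition _ := gen_choiceMixin delta.

Definition ev (w : seq letter) : delta := exist _ (run w) (ex_intro _ w erefl).

Lemma delta_eq (f g : delta) : (forall j s, sval f j s = sval g j s) -> f = g.
Proof.
case: f => f pf; case: g => g pg /= e.
have {}e : f = g by apply: functional_extensionality_dep => j; apply: funext => s.
by subst g; congr exist; exact: Prop_irrelevance.
Qed.

Lemma ev_eq w w' : (forall j s, run w (j := j) s = run w' s) -> ev w = ev w'.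
Proof. by move=> e; apply: delta_eq. Qed.

Lemma evP (f : delta) : exists w, f = ev w.
Proof. by case: f => f [w e]; exists w; apply: delta_eq => j s /=; rewrite e. Qed.

Definition word_of (f : delta) : seq letter := sval (cid (evP f)).
Lemma word_ofK f : ev (word_of f) = f.
Proof. by rewrite /word_of; case: cid. Qed.

Lemma run_word_of f : run (word_of f) = sval f.
Proof. exact: (congr1 sval (word_ofK f)). Qed.

Definition dmul (f g : delta) : delta := ev (word_of f ++ word_of g).
Definition dinv (f : delta) : delta := ev (winv (word_of f)).

(** Products are formed from chosen words; this identity frees them from the choice and reduces the
    group axioms to composition of maps. *)
Lemma dmulE f g j s : sval (dmul f g) j s = sval g j (sval f j s).
Proof.
by rewrite /dmul /= run_cat !run_word_of.
Qed.

Lemma dmulA : associative dmul.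
Proof. by move=> f g h; apply: delta_eq => j s; rewrite !dmulE. Qed.
Lemma dmul1 : left_id (ev [::]) dmul.
Proof. by move=> f; apply: delta_eq => j s; rewrite dmulE. Qed.
Lemma dmulr1 : right_id (ev [::]) dmul.
Proof. by move=> f; apply: delta_eq => j s; rewrite dmulE. Qed.
Lemma dmulV : left_inverse (ev [::]) dinv dmul.
Proof.
move=> f; apply: delta_eq => j s; rewrite dmulE /dinv /=.
by rewrite -run_word_of run_winvr.
Qed.
Lemma dmulrV : right_inverse (ev [::]) dinv dmul.
Proof.
move=> f; apply: delta_eq => j s; rewrite dmulE /dinv /=.
by rewrite -run_word_of run_winv.
Qed.

HB.instance Definition _ :=
  isGroup.Build delta dmulA dmul1 dmulr1 dmulV dmulrV.

Lemma ev_cat w w' : ev (w ++ w') = (ev w * ev w')%g.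
Proof. by apply: delta_eq => j s; rewrite dmulE /= run_cat. Qed.
Lemma ev_winv w : ev (winv w) = (ev w)^-1%g.
Proof.
apply: (mulIg (ev w)); rewrite mulVg -ev_cat.
by apply: delta_eq => j s; rewrite /= run_cat run_winvr.
Qed.
Lemma ev_cons l w : ev (l :: w) = (ev [:: l] * ev w)%g.
Proof. by rewrite -ev_cat. Qed.

Lemma mul_val (f g : delta) j s : sval (f * g)%g j s = sval g j (sval f j s).
Proof. exact: dmulE. Qed.
Lemma one_val j s : sval (1%g : delta) j s = s.
Proof. by []. Qed.
Lemma inv_valK (f : delta) j s : sval (f^-1)%g j (sval f j s) = s.
Proof. by rewrite -mul_val mulgV. Qed.
Lemma inv_valVK (f : delta) j s : sval f j (sval (f^-1)%g j s) = s.
Proof. by rewrite -mul_val mulVg. Qed.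

End Delta.

(** * Generators and word length *)

Lemma is_subgroupP (G : groupType) (A : set G) :
  is_subgroup A <-> A 1%g /\ (forall x y, A x -> A y -> A (x * y^-1)%g).
Proof.
split=> [[h1 hM]|[h1 hM]].
  split=> [|x y Ax Ay]; first by move: h1; rewrite inE.
  by have := hM x y; rewrite !inE; apply.
by split=> [|x y]; rewrite !inE //; exact: hM.
Qed.

Lemma subgroup_gen_sub (G : groupType) (S B : set G) :
  is_subgroup B -> S `<=` B -> subgroup_gen S `<=` B.
Proof. by move=> hB hS x; apply. Qed.

Section Delta.
Variable P : fibres.
Notation delta := (delta P).

Definition gens : set delta :=
  [set f | f = ev P [:: inl true] \/ exists x, f = ev P [:: inr x]].

Lemma ev_inlN b : ev P [:: inl (~~ b)] = (ev P [:: inl b])^-1%g.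
Proof. by rewrite -ev_winv. Qed.
Lemma ev_inrV x : (ev P [:: inr x])^-1%g = ev P [:: inr x].
Proof. by rewrite -ev_winv. Qed.

Lemma gens_finite : is_finite_generating_set gens.
Proof.
split.
  apply: (@sub_finite_set _ _ ([set ev P [:: l] | l in [set: letter]])).
    by move=> f [->|[x ->]] /=; [exists (inl true)|exists (inr x)].
  apply: finite_image; exact: finite_finset.
apply/seteqP; split=> // f _ B [/is_subgroupP[B1 BM] SB].
have BV x : B x -> B x^-1%g by move=> Bx; rewrite -[x^-1%g]mul1g; apply: BM.
have [w ->] := evP f; elim: w => [//|l w IH].
rewrite ev_cons -[ev P w]invgK; apply: BM; last exact: BV.
case: l => [[]|x]; [by apply: SB; left| |by apply: SB; right; exists x].
by rewrite -[false]/(~~ true) ev_inlN; apply: BV; apply: SB; left.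
Qed.

Lemma gens_letter (f : delta) : gens f \/ gens f^-1%g <-> exists l, f = ev P [:: l].
Proof.
split=> [[[->|[x ->]]|[e|[x e]]]|[[[]|x] ->]].
- by exists (inl true).
- by exists (inr x).
- by exists (inl false); rewrite -[false]/(~~ true) ev_inlN -e invgK.
- by exists (inr x); rewrite -ev_inrV -e invgK.
- by left; left.
- by right; left; rewrite -ev_inlN.
- by left; right; exists x.
Qed.

Lemma prod_ev (n : nat) (t : n.-tuple letter) :
  (\prod_(i < n) ev P [:: tnth t i])%g = ev P t.
Proof.
case: t => /= s; elim: s n => [|l s IH] n hs.
  by case: n hs => // hs; rewrite big_ord0.
case: n hs => // n hs; rewrite big_ord_recl [RHS]ev_cons; congr (_ * _)%g.
rewrite -(IH n) //; apply: eq_bigr => i _; congr (ev P [:: _]).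
by rewrite !(tnth_nth l).
Qed.

(** The generators and their inverses are exactly the one-letter elements, so word length is the
    least length of a representing word in letters. *)
Lemma word_of_lengthP (f : delta) n :
  word_of_length gens f n <-> exists2 w, f = ev P w & size w = n.
Proof.
split=> [[w [hw ->]]|[w -> <-]].
  have {}hw i := (gens_letter _).1 (hw i).
  have [g hg] := choice hw.
  exists (map g (enum 'I_n)); last by rewrite size_map size_enum_ord.
  rewrite (eq_bigr (fun i => ev P [:: tnth [tuple g i | i < n] i])).
    by rewrite prod_ev.
  by move=> i _; rewrite tnth_mktuple -hg.
exists [tuple ev P [:: tnth (in_tuple w) i] | i < size w]; split.
  by move=> i; rewrite tnth_mktuple; apply/gens_letter; eexists.
rewrite (eq_bigr (fun i => ev P [:: tnth (in_tuple w) i])); first by rewrite prod_ev.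
by move=> i _; rewrite tnth_mktuple.
Qed.

Lemma word_length_le w : (word_length gens (ev P w) <= size w)%N.
Proof.
rewrite /word_length; case: pselect => // e.
case: ex_minnP => m _; apply; apply/asboolP/word_of_lengthP; by exists w.
Qed.

Lemma word_lengthP (f : delta) : exists2 w, f = ev P w & size w = word_length gens f.
Proof.
rewrite /word_length; case: pselect => [e|[]].
  by case: ex_minnP => m /asboolP/word_of_lengthP.
have [w ->] := evP f; exists (size w); apply/asboolP/word_of_lengthP; by exists w.
Qed.

End Delta.

(** * Solvability *)

Section Solvable.
Variable P : fibres.
Notation delta := (delta P).
Notation E j := {ffun 'I_4 -> P j}.
Implicit Types f g x y : delta.

(** The order of the quantifiers carries the content: the sign change [sg] and the translation [c]
    depend on the fibre alone, the flip [b0] on the point but not on its bit. *)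
Lemma run_shape w j r : exists p (sg : {ffun 'I_4 -> bool}) (c : E j),
  forall e, exists b0, forall b,
    run w (r, (e, b)) = (r - p, (actA sg e + c, b + b0)) :> state P j.
Proof.
elim: w r => [|l w IH] r.
  by exists 0, 0, 0 => e; exists 0 => b; rewrite /= subr0 actA0 !addr0.
case: l => [v|x] /=.
  have [p [sg [c H]]] := IH (r - dir_sign v).
  exists (p + dir_sign v), sg, c => e; have [b0 {}H] := H e.
  by exists b0 => b; rewrite H; congr (_, _); rewrite opprD addrA addrAC.
have [p [sg [c H]]] := IH r.
rewrite /stlamp; case: (r == 0).
  exists p, (sg + x.1.1), c => e; have [b0 {}H] := H (actA x.1.1 e).
  by exists b0 => b; rewrite -actAD -H.
case: (r == _).
  exists p, (sg + x.1.2), (actA sg [ffun i => if x.1.2 i then funit P j else 0] + c) => e.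
  have [b0 {}H] := H (actB (funit P j) x.1.2 e).
  exists b0 => b; rewrite [LHS]H; congr (_, (_, _)).
  rewrite addrA; congr (_ + c); apply/ffunP => i; rewrite !ffunE.
  rewrite /reflA /reflB; case: (sg i); case: (x.1.2 i) => //=;
    by rewrite ?addr0 ?oppr0 ?addr0 ?opprK // ?opprB addrC.
case: (r == _).
  exists p, sg, c => e; have [b0 {}H] := H e.
  by exists (b0 + (x.2 && (e == 0))) => b; rewrite [LHS]H /= addrAC addrA.
by exists p, sg, c.
Qed.

Lemma run_pos w : exists p, forall j (s : state P j), (run w s).1 = s.1 - p.
Proof.
elim: w => [|[v|x] w [p H]]; first by exists 0 => j s; rewrite subr0.
- by exists (p + dir_sign v) => j s; rewrite /= H /= opprD addrA addrAC.
- by exists p => j s; rewrite /= H /=.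
Qed.

Lemma val_shape f j r : exists p (sg : {ffun 'I_4 -> bool}) (c : E j),
  forall e, exists b0, forall b, sval f j (r, (e, b)) = (r - p, (actA sg e + c, b + b0)).
Proof. by have [w ->] := evP f; exact: run_shape. Qed.

(** These three conditions mark the successive layers of the group: displacements, signs,
    translations and bit flips each commute once the coarser layers are trivial. *)
Definition fixes_base f := forall j (s : state P j), (sval f j s).1 = s.1.
Definition translates f := forall j r, exists c : E j,
  forall e, exists b0, forall b, sval f j (r, (e, b)) = (r, (e + c, b + b0)).
Definition fixes_fibre f := forall j r (e : E j),
  exists b0, forall b, sval f j (r, (e, b)) = (r, (e, b + b0)).

Lemma fixes_base_shape f j r : fixes_base f ->
  exists (sg : {ffun 'I_4 -> bool}) (c : E j),
  forall e, exists b0, forall b, sval f j (r, (e, b)) = (r, (actA sg e + c, b + b0)).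
Proof.
move=> hf; have [p [sg [c H]]] := val_shape f j r.
exists sg, c => e; have [b0 {}H] := H e; exists b0 => b.
by have := H b; have /= := hf j (r, (e, b)) => /[swap] ->; rewrite /= => ->.
Qed.

Lemma fixes_base_sub : is_subgroup fixes_base.
Proof.
apply/is_subgroupP; split=> // f g hf hg j s.
by rewrite mul_val -[in LHS](hg j) inv_valVK.
Qed.

Lemma translates_sub : is_subgroup translates.
Proof.
apply/is_subgroupP; split=> [|f g tf tg].
  by move=> j r; exists 0 => e; exists 0 => b; rewrite !addr0.
move=> j r; have [c hc] := tf j r; have [d hd] := tg j r.
exists (c - d) => e; have [b0 {}hc] := hc e; have [b1 {}hd] := hd (e + c - d).
exists (b0 - b1) => b; rewrite mul_val hc addrA.
by rewrite -[RHS](inv_valK g) hd addrA !subrK.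
Qed.

Lemma fixes_fibre_sub : is_subgroup fixes_fibre.
Proof.
apply/is_subgroupP; split=> [|f g tf tg].
  by move=> j r e; exists 0 => b; rewrite !addr0.
move=> j r e; have [b0 hc] := tf j r e; have [b1 hd] := tg j r e.
exists (b0 - b1) => b; rewrite mul_val hc addrA.
by rewrite -[RHS](inv_valK g) hd !subrK.
Qed.

Lemma trivial_sub : is_subgroup [set 1%g : delta].
Proof. by apply/is_subgroupP; split=> // x y -> ->; rewrite mulgV. Qed.

(** The commutator is evaluated at a point written as an image under [g] and then [f], which avoids
    computing inverses. *)
Lemma commg_val f g j s :
  sval [~ f, g]%g j (sval f j (sval g j s)) = sval g j (sval f j s).
Proof. by rewrite -(mul_val f g) -(mul_val g f) -mul_val -commgC. Qed.

Lemma xor_cancel (b b3 b4 : bool) : b + (b3 + b4) + b3 + b4 = b.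
Proof. by case: b; case: b3; case: b4. Qed.

Lemma commg_fixes_base f g : fixes_base [~ f, g]%g.
Proof.
move=> j s; rewrite -[s](inv_valVK (g * f)%g).
move: (sval (g * f)^-1 _ _)%g => {}s; rewrite [sval (g * f)%g _ _]mul_val commg_val.
have [w ->] := evP f; have [w' ->] := evP g.
have [p hp] := run_pos w; have [p' hp'] := run_pos w'.
by rewrite /= !(hp, hp') addrAC.
Qed.

Lemma actA_add (F : zmodType) sg (e e' : {ffun 'I_4 -> F}) :
  actA sg (e + e') = actA sg e + actA sg e'.
Proof. by apply/ffunP => i; rewrite !ffunE /reflA; case: (sg i); rewrite ?opprD. Qed.

Lemma commg_translates f g :
  fixes_base f -> fixes_base g -> translates [~ f, g]%g.
Proof.
move=> hf hg j r.
have [sg [c H]] := fixes_base_shape j r hf.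
have [sg' [c' H']] := fixes_base_shape j r hg.
exists (actA sg' c + c' - (actA sg c' + c)) => e.
(* [e0] is the point that [g] followed by [f] carries to [e]; sign changes are their own
   inverses. *)
pose e0 := actA (sg' + sg) (e - (actA sg c' + c)).
have [b1 H1] := H e0; have [b2 H2] := H' (actA sg e0 + c).
have [b3 H3] := H' e0; have [b4 H4] := H (actA sg' e0 + c').
exists (b3 + b4 + b1 + b2) => b.
have Ee : actA sg (actA sg' e0) + (actA sg c' + c) = e.
  rewrite /e0 !actAD -[RHS](subrK (actA sg c' + c)); congr (_ + _).
  rewrite -[RHS]actA0; congr (actA _ _); apply/ffunP => i; rewrite !ffunE.
  by case: (sg i); case: (sg' i).
clearbody e0; have := commg_val f g (r, (e0, b + (b3 + b4))).
rewrite H3 H4 H1 H2 xor_cancel !actA_add -[_ + _ + c]addrA Ee.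
move=> ->; congr (_, (_, _)); last by rewrite !addrA.
have -> : actA sg' (actA sg e0) = e - (actA sg c' + c).
  by rewrite -Ee addrK !actAD [sg + sg']addrC.
by rewrite -!addrA; congr (_ + _); rewrite [LHS]addrC -addrA.
Qed.

Lemma commg_fixes_fibre f g : translates f -> translates g -> fixes_fibre [~ f, g]%g.
Proof.
move=> hf hg j r e.
have [c H] := hf j r; have [c' H'] := hg j r.
pose e0 := e - (c' + c).
have [b1 H1] := H e0; have [b2 H2] := H' (e0 + c).
have [b3 H3] := H' e0; have [b4 H4] := H (e0 + c').
exists (b3 + b4 + b1 + b2) => b.
have := commg_val f g (r, (e0, b + (b3 + b4))).
rewrite H3 H4 H1 H2 xor_cancel -[e0 + c' + c]addrA -[e0 + c + c']addrA [c + c']addrC subrK.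
by move=> ->; congr (_, (_, _)); rewrite !addrA.
Qed.

Lemma commg_trivial f g : fixes_fibre f -> fixes_fibre g -> [~ f, g]%g = 1%g.
Proof.
move=> hf hg; apply: delta_eq => j [r [e b]]; rewrite one_val.
have [b1 H1] := hf j r e; have [b2 H2] := hg j r e.
have := commg_val f g (r, (e, b + (b2 + b1))).
rewrite !(H1, H2) xor_cancel => ->; congr (_, (_, _)).
by case: b; case: b1 {H1}; case: b2 {H2}.
Qed.

Lemma derived_sub (A B : set delta) :
  is_subgroup B -> (forall f g, A f -> A g -> B [~ f, g]%g) ->
  derived_subgroup A `<=` B.
Proof.
by move=> hB hAB; apply: subgroup_gen_sub => // _ [f [g [Af Ag ->]]]; exact: hAB.
Qed.

Lemma delta_solvable : step_solvable delta 4.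
Proof.
rewrite /step_solvable /=.
set D1 := derived_subgroup setT; set D2 := derived_subgroup D1.
set D3 := derived_subgroup D2.
have h1 : D1 `<=` fixes_base.
  by apply: derived_sub => [|f g _ _]; [exact: fixes_base_sub|exact: commg_fixes_base].
have h2 : D2 `<=` translates.
  apply: derived_sub => [|f g /h1 hf /h1 hg]; first exact: translates_sub.
  exact: commg_translates.
have h3 : D3 `<=` fixes_fibre.
  apply: derived_sub => [|f g /h2 hf /h2 hg]; first exact: fixes_fibre_sub.
  exact: commg_fixes_fibre.
apply/seteqP; split=> [|_ -> B [/is_subgroupP[]] //].
apply: derived_sub => [|f g /h3 hf /h3 hg]; first exact: trivial_sub.
exact: commg_trivial.
Qed.

End Solvable.

(** * Averages over words *)

Section Average.
Variables (R : realType).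
Implicit Types T : finType.

Definition avg T (f : T -> R) : R := #|T|%:R^-1 * \sum_x f x.

Lemma avgD T (f g : T -> R) : avg (fun x => f x + g x) = avg f + avg g.
Proof. by rewrite /avg big_split mulrDr. Qed.
Lemma avgZ T c (f : T -> R) : avg (fun x => c * f x) = c * avg f.
Proof. by rewrite /avg -mulr_sumr mulrCA. Qed.
Lemma le_avg T (f g : T -> R) : (forall x, f x <= g x) -> avg f <= avg g.
Proof.
by move=> fg; rewrite /avg ler_wpM2l ?invr_ge0 // ler_sum.
Qed.
Lemma eq_avg T (f g : T -> R) : (forall x, f x = g x) -> avg f = avg g.
Proof. by move=> fg; rewrite /avg (eq_bigr _ (fun x _ => fg x)). Qed.
Lemma avg_const T c : (0 < #|T|)%N -> avg (fun _ : T => c) = c.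
Proof.
move=> T0; rewrite /avg sumr_const -[c *+ _]mulr_natl mulrA mulVf ?mul1r //.
by rewrite pnatr_eq0 -lt0n.
Qed.
Lemma exchange_avg T T' (f : T -> T' -> R) :
  avg (fun x => avg (f x)) = avg (fun y => avg (fun x => f x y)).
Proof.
rewrite /avg -2!mulr_sumr exchange_big /= !mulrA; congr (_ * _).
by rewrite mulrC.
Qed.
Lemma avg_prod T T' (f : T * T' -> R) :
  avg f = avg (fun x => avg (fun y => f (x, y))).
Proof.
rewrite /avg card_prod natrM invfM -mulr_sumr mulrA; congr (_ * _).
by rewrite pair_bigA /=; apply: eq_bigr => -[].
Qed.
Lemma avg_bool (f : bool -> R) : avg f = (f true + f false) / 2.
Proof. by rewrite /avg card_bool big_bool /= mulrC. Qed.

(** All random variables below are functions of independent uniform letters of a finite type, so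
    expectation is an iterated average; the recursion on the first letter plays the role of the
    Markov property. *)
Fixpoint Ex T n (f : seq T -> R) : R :=
  if n is n'.+1 then avg (fun x => Ex n' (fun s => f (x :: s))) else f [::].

Lemma le_Ex T n (f g : seq T -> R) :
  (forall s, size s = n -> f s <= g s) -> Ex n f <= Ex n g.
Proof.
elim: n f g => [|n IH] f g fg /=; first exact: fg.
by apply: le_avg => x; apply: IH => s hs; apply: fg; rewrite /= hs.
Qed.
Lemma eq_Ex T n (f g : seq T -> R) :
  (forall s, size s = n -> f s = g s) -> Ex n f = Ex n g.
Proof.
by move=> fg; apply/le_anti/andP; split; apply: le_Ex => s /fg ->.
Qed.
Lemma ExD T n (f g : seq T -> R) : Ex n (fun s => f s + g s) = Ex n f + Ex n g.
Proof.
elim: n f g => [|n IH] f g //=.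
by rewrite -avgD; apply: eq_avg => x; rewrite -IH.
Qed.
Lemma ExZ T n c (f : seq T -> R) : Ex n (fun s => c * f s) = c * Ex n f.
Proof.
elim: n f => [|n IH] f //=.
by rewrite -avgZ; apply: eq_avg => x; rewrite -IH.
Qed.
Lemma Ex_const T n c : (0 < #|T|)%N -> Ex n (fun _ : seq T => c) = c.
Proof.
move=> T0; elim: n => [|n IH] //=.
by rewrite IH avg_const.
Qed.
Lemma Ex_ge0 T n (f : seq T -> R) :
  (0 < #|T|)%N -> (forall s, size s = n -> 0 <= f s) -> 0 <= Ex n f.
Proof. by move=> T0 f0; rewrite -(Ex_const n 0 T0); exact: le_Ex. Qed.

Lemma exchange_avg_Ex T T' n (f : T -> seq T' -> R) :
  avg (fun x => Ex n (f x)) = Ex n (fun s => avg (fun x => f x s)).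
Proof.
elim: n f => [|n IH] f //=.
by rewrite exchange_avg; apply: eq_avg => y; rewrite IH.
Qed.

Lemma exchange_Ex T T' m n (f : seq T -> seq T' -> R) :
  Ex m (fun x => Ex n (f x)) = Ex n (fun s => Ex m (fun x => f x s)).
Proof.
elim: m f => [|m IH] f //=.
by rewrite -exchange_avg_Ex; apply: eq_avg => y; rewrite IH.
Qed.

Lemma Ex_prod T T' n (f : seq (T * T') -> R) :
  Ex n f = Ex n (fun s => Ex n (fun s' => f (zip s s'))).
Proof.
elim: n f => [|n IH] f //=.
rewrite avg_prod; apply: eq_avg => x.
rewrite -exchange_avg_Ex; apply: eq_avg => y; exact: IH.
Qed.

Lemma avg_ffun (I T : finType) (f : I -> T -> R) :
  avg (fun g : {ffun I -> T} => \prod_i f i (g i)) = \prod_i avg (f i).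
Proof.
rewrite /avg card_ffun -(bigA_distr_bigA f) natrX.
by rewrite [RHS]big_split /= prodr_const exprVn.
Qed.

(** Independence of the coordinates of independent uniform functions; it will separate the four
    coordinates of the torus. *)
Lemma Ex_ffun (I T : finType) n (f : I -> seq T -> R) :
  Ex n (fun s : seq {ffun I -> T} => \prod_i f i (map (fun g : {ffun I -> T} => g i) s)) =
  \prod_i Ex n (f i).
Proof.
elim: n f => [|n IH] f //=.
by rewrite -avg_ffun; apply: eq_avg => x; rewrite -IH.
Qed.

Lemma Ex_tuple T n (f : seq T -> R) :
  Ex n f = (#|T| ^ n)%:R^-1 * \sum_(t : n.-tuple T) f t.
Proof.
elim: n f => [|n IH] f /=.
  rewrite expn0 invr1 mul1r (big_pred1 [tuple]) // => t.
  by apply/esym/eqP/val_inj; rewrite /= [val t](size0nil (size_tuple t)).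
rewrite (eq_avg (fun x => IH _)) avgZ /avg mulrA; congr (_ * _).
  by rewrite expnSr natrM invfM.
rewrite pair_bigA /= (reindex (fun t : n.+1.-tuple T => (thead t, [tuple of behead t]))) /=.
  by apply: eq_bigr => t _; rewrite [in RHS](tuple_eta t).
exists (fun p : T * n.-tuple T => [tuple of p.1 :: p.2]).
  by move=> t _; rewrite /= -tuple_eta.
by move=> [x t] _ /=; congr (_, _); apply: val_inj.
Qed.

(** Change of variables from a finite-support sum over a possibly infinite type to a finite sum: the
    weight is carried by the image of [g]. *)
Lemma sum_pushforward (T : finType) (D : choiceType) (g : T -> D) (w : T -> R)
    (phi : D -> R) :
  \sum_(x \in [set: D]) (\sum_t (g t == x)%:R * w t) * phi x
  = \sum_t w t * phi (g t).
Proof.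
pose A := [set g t | t in [set: T]].
have Af : finite_set A by apply: finite_image; exact: finite_finset.
rewrite -(@fsbig_widen _ _ _ _ A) //; last first.
  move=> x [_ nA] /=; rewrite big1 ?mul0r // => t _.
  by case: eqP => [e|]; rewrite ?mul0r //; case: nA; exists t.
rewrite fsbig_finite //=.
rewrite (eq_bigr (fun x => \sum_t (g t == x)%:R * w t * phi x)); last first.
  by move=> x _; rewrite mulr_suml.
rewrite exchange_big /=; apply: eq_bigr => t _.
rewrite (bigD1_seq (g t)) //=; last first.
  by rewrite in_fset_set // inE; exists t.
rewrite eqxx mul1r big1 ?addr0 // => x /negbTE.
by rewrite eq_sym => ->; rewrite !mul0r.
Qed.

End Average.

(** * Laws of random walks *)

Section Pushforward.
Variables (R : realType) (G : groupType) (K : finType) (gen : K -> G).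
Hypothesis K0 : (0 < #|K|)%N.

Definition law (x : G) : R := avg (fun k => (gen k == x)%:R).
Definition walk_prod (s : seq K) : G := (\prod_(k <- s) gen k)%g.

Lemma lawE x : law x = \sum_k (gen k == x)%:R * #|K|%:R^-1.
Proof. by rewrite /law /avg mulrC mulr_suml. Qed.

Lemma law_finite_prob : is_finite_prob law.
Proof.
split=> [x||].
- by rewrite /law -(avg_const (0 : R) K0); apply: le_avg => k; rewrite ler0n.
- apply: (@sub_finite_set _ _ [set gen k | k in [set: K]]).
    move=> x /= /eqP qx; apply: contrapT => nx; apply: qx.
    rewrite lawE big1 // => k _.
    by case: eqP => [e|]; rewrite ?mul0r //; case: nx; exists k.
  by apply: finite_image; exact: finite_finset.
- transitivity (\sum_(x \in [set: G]) (\sum_k (gen k == x)%:R * #|K|%:R^-1) * (1 : R)).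
    by apply: eq_fsbigr => x _; rewrite mulr1 lawE.
  rewrite sum_pushforward (eq_bigr (fun=> #|K|%:R^-1)) => [|k _]; last by rewrite mulr1.
  by rewrite -[RHS](avg_const (1 : R) K0) /avg !sumr_const mulr_natr.
Qed.

Lemma law_symmetric : (exists2 i : K -> K, involutive i &
  forall k, gen (i k) = (gen k)^-1%g) -> is_symmetric law.
Proof.
move=> [i iK gi] x; rewrite /law /avg (reindex_inj (inv_inj iK)) /=.
by congr (_ * _); apply: eq_bigr => k _; rewrite gi eqg_inv.
Qed.

Lemma conv_powerE n x : conv_power law n x = Ex n (fun s => (walk_prod s == x)%:R).
Proof.
elim: n x => [|n IH] x /=; first by rewrite /walk_prod big_nil eq_sym.
rewrite /convolution.
transitivity (\sum_(y \in [set: G]) (\sum_k (gen k == y)%:R * #|K|%:R^-1) *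
   conv_power law n (y^-1 * x)%g).
  by apply: eq_fsbigr => y _; rewrite lawE.
rewrite sum_pushforward /avg mulr_sumr; apply: eq_bigr => k _; congr (_ * _).
rewrite IH; apply: eq_Ex => s _; congr ((_ : bool)%:R).
rewrite /walk_prod big_cons; apply/eqP/eqP => [->|<-]; first by rewrite mulVKg.
by rewrite mulKg.
Qed.

Lemma Ex_tuple_sum n (f : n.-tuple K -> R) (g : seq K -> R) :
  (forall t : n.-tuple K, g t = f t) ->
  Ex n g = \sum_(t : n.-tuple K) (#|K| ^ n)%:R^-1 * f t.
Proof.
move=> gf; rewrite Ex_tuple mulr_sumr; apply: eq_bigr => t _; by rewrite gf.
Qed.

Lemma iid_expectationE n (f : G -> R) :
  iid_expectation law (fun X : n.-tuple G => f (walk X)) = Ex n (fun s => f (walk_prod s)).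
Proof.
rewrite /iid_expectation.
have hq (X : n.-tuple G) : \prod_(i < n) law (tnth X i) =
    \sum_(t : n.-tuple K) (map_tuple gen t == X)%:R * (#|K| ^ n)%:R^-1.
  rewrite (eq_bigr (fun i => \sum_k (gen k == tnth X i)%:R * #|K|%:R^-1)); last first.
    by move=> i _; rewrite lawE.
  rewrite (bigA_distr_bigA (fun i k => (gen k == tnth X i)%:R * #|K|%:R^-1)).
  rewrite (reindex (fun t : n.-tuple K => [ffun i => tnth t i])) /=; last first.
    exists (fun g : {ffun 'I_n -> K} => [tuple g i | i < n]).
      by move=> t _; apply: eq_from_tnth => i; rewrite tnth_mktuple ffunE.
    by move=> g _; apply/ffunP => i; rewrite ffunE tnth_mktuple.
  apply: eq_bigr => t _; rewrite big_split /= prodr_const card_ord natrX exprVn.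
  congr (_ * _).
  have [e|ne] := eqVneq (map_tuple gen t) X.
    by rewrite big1 // => i _; rewrite ffunE -e tnth_map eqxx.
  have [i hi] : exists i, gen (tnth t i) != tnth X i.
    apply/existsP; apply: contraR ne => /existsPn h; apply/eqP.
    by apply: eq_from_tnth => i; rewrite tnth_map; apply/eqP; move: (h i); rewrite negbK.
  by apply/eqP/prodf_eq0; exists i => //; rewrite ffunE (negbTE hi).
transitivity (\sum_(X \in [set: n.-tuple G])
  (\sum_(t : n.-tuple K) (map_tuple gen t == X)%:R * (#|K| ^ n)%:R^-1) * f (walk X)).
  by apply: eq_fsbigr => X _; rewrite hq.
rewrite sum_pushforward (Ex_tuple_sum (f := fun t => f (walk (map_tuple gen t)))) //.
move=> t; congr f; rewrite /walk_prod /walk.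
rewrite (eq_bigr (fun i => gen (tnth t i))); last by move=> i _; rewrite tnth_map.
by rewrite big_tuple.
Qed.

(** Entropy is the mean of the information [- ln p(W_n)], hence an average over words. *)
Lemma walk_entropyE n :
  walk_entropy law n = Ex n (fun s => - ln (conv_power law n (walk_prod s))).
Proof.
rewrite /walk_entropy /shannon_entropy.
transitivity (- \sum_(x \in [set: G])
   (\sum_(t : n.-tuple K) (walk_prod t == x)%:R * (#|K| ^ n)%:R^-1) * ln (conv_power law n x)).
  congr (- _); apply: eq_fsbigr => x _; congr (_ * _).
  rewrite conv_powerE (Ex_tuple_sum (f := fun t => (walk_prod t == x)%:R)) //.
  by apply: eq_bigr => t _; rewrite mulrC.
rewrite sum_pushforward -sumrN.
rewrite (Ex_tuple_sum (f := fun t => - ln (conv_power law n (walk_prod t)))) //.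
by apply: eq_bigr => t _; rewrite mulrN.
Qed.

End Pushforward.

(** * Entropy is bounded by length *)

Section Gibbs.
Variable R : realType.

Lemma ln_le_subr1 (x : R) : 0 < x -> ln x <= x - 1.
Proof. by move=> x0; rewrite -[in ln x](subrK 1 x) addrC le_ln1Dx //; lra. Qed.

Lemma sum_fibres (T : finType) (D : eqType) (g : T -> D) (w : T -> R) (phi : D -> R) :
  \sum_t w t * phi (g t) =
  \sum_(x <- undup (codom g)) (\sum_t (g t == x)%:R * w t) * phi x.
Proof.
rewrite [RHS](eq_bigr (fun x => \sum_t (g t == x)%:R * w t * phi x)); last first.
  by move=> x _; rewrite mulr_suml.
rewrite exchange_big /=; apply: eq_bigr => t _.
rewrite (bigD1_seq (g t)) ?undup_uniq ?mem_undup ?codom_f //=.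
rewrite eqxx mul1r big1 ?addr0 // => x /negbTE.
by rewrite eq_sym => ->; rewrite !mul0r.
Qed.

Lemma sum_geometric_le2 N : \sum_(m < N) 2^-1 ^+ m <= 2 :> R.
Proof.
have -> : \sum_(m < N) 2^-1 ^+ m = 2 - 2 * 2^-1 ^+ N :> R.
  elim: N => [|N IH]; first by rewrite big_ord0 expr0 mulr1 subrr.
  rewrite big_ord_recr /= IH exprS; lra.
by have : 0 <= 2^-1 ^+ N :> R by [rewrite exprn_ge0 // invr_ge0]; lra.
Qed.

(** Kraft type inequality: at most [c ^ m] elements of length [m], each of weight [(2 c) ^- m],
    contribute at most [2 ^- m]. *)
Lemma sum_length_le2 (D : eqType) (len : D -> nat) (c : nat) (X : seq D) :
  (0 < c)%N -> uniq X ->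
  (forall m (Y : seq D), uniq Y -> all (fun x => len x == m) Y -> (size Y <= c ^ m)%N) ->
  \sum_(x <- X) ((2 * c)%:R ^- len x) <= 2 :> R.
Proof.
move=> c0 uX hY; pose N := (\sum_(x <- X) (len x).+1)%N.
have hN x : x \in X -> (len x < N)%N.
  by move=> xX; rewrite /N (bigD1_seq x) //= leq_addr.
apply: le_trans (sum_geometric_le2 N).
rewrite big_seq (eq_bigr (fun x => \sum_(m < N) (len x == m)%:R * (2 * c)%:R ^- m)).
  rewrite -big_seq exchange_big /=; apply: ler_sum => m _.
  rewrite -mulr_suml -natr_sum.
  have h : (\sum_(x <- X) (len x == m) <= c ^ m)%N.
    have := hY m [seq x <- X | len x == m]; rewrite filter_uniq // filter_all.
    by rewrite size_filter -sum1_count big_mkcond /=; apply.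
  apply: (@le_trans _ _ ((c ^ m)%:R * (2 * c)%:R ^- m)).
    by rewrite ler_wpM2r ?invr_ge0 ?exprn_ge0 // ler_nat.
  rewrite natrX natrM exprMn invfM exprVn mulrCA mulfV ?mulr1 //.
  by rewrite expf_neq0 // pnatr_eq0 -lt0n.
move=> x xX; rewrite (bigD1 (Ordinal (hN x xX))) //= eqxx mul1r big1 ?addr0 // => m.
by rewrite -val_eqE /= eq_sym => /negbTE ->; rewrite mul0r.
Qed.

Section Walk.
Variables (G : groupType) (K : finType) (gen : K -> G).
Hypothesis K0 : (0 < #|K|)%N.

(** Gibbs' inequality against the weights [(2 c) ^- len x], of total mass at most 2: the length term
    is the cross entropy and [ln 2] the price of the mass. *)
Lemma gibbs_upper (len : G -> nat) (c n : nat) : (0 < c)%N ->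
  (forall m (Y : seq G), uniq Y -> all (fun x => len x == m) Y -> (size Y <= c ^ m)%N) ->
  walk_entropy (law R gen) n <=
  ln (2 * c)%:R * Ex n (fun s => (len (walk_prod gen s))%:R) + ln 2.
Proof.
move=> c0 hY; rewrite walk_entropyE //.
set p := conv_power _ n.
have Kn : (0 : R) < (#|K| ^ n)%:R^-1 by rewrite invr_gt0 ltr0n expn_gt0 K0.
have pE x : p x = \sum_(t : n.-tuple K) (walk_prod gen t == x)%:R * (#|K| ^ n)%:R^-1.
  rewrite /p conv_powerE // (Ex_tuple_sum (f := fun t => (walk_prod gen t == x)%:R)) //.
  by apply: eq_bigr => t _; rewrite mulrC.
have ppos (t : n.-tuple K) : 0 < p (walk_prod gen t).
  by rewrite pE (bigD1 t) //= eqxx mul1r ltr_pwDl // sumr_ge0.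
pose v x : R := (2 * c)%:R ^- len x.
have vpos x : 0 < v x.
  by rewrite /v invr_gt0 exprn_gt0 // ltr0n muln_gt0.
have sumv : Ex n (fun s => v (walk_prod gen s) / p (walk_prod gen s)) <= 2.
  rewrite (Ex_tuple_sum (f := fun t => v (walk_prod gen t) / p (walk_prod gen t))) //.
  rewrite (sum_fibres _ _ (fun x => v x / p x)).
  apply: le_trans (sum_length_le2 c0 (undup_uniq (codom (fun t : n.-tuple K => walk_prod gen t))) hY).
  rewrite big_seq [leRHS]big_seq; apply: ler_sum => x.
  rewrite mem_undup => /codomP[t0 ->]; rewrite -pE mulrCA mulfV ?mulr1 //.
  by rewrite gt_eqF.
have bound : Ex n (fun s => - ln (p (walk_prod gen s))) <=
    Ex n (fun s => ln (2 * c)%:R * (len (walk_prod gen s))%:R +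
      ((ln 2 - 1) + 2^-1 * (v (walk_prod gen s) / p (walk_prod gen s)))).
  apply: le_Ex => s hs; have [t es] : exists t : n.-tuple K, s = t.
    by exists (Tuple (introT eqP hs)).
  rewrite es; move: (ppos t) (vpos (walk_prod gen t)); move: (walk_prod gen t) => x px vx.
  (* [ln y <= y - 1] at [y = v x / (2 p x)], whose mean is at most 1, so that the linear terms
     disappear on averaging. *)
  have : ln (2^-1 * (v x / p x)) <= 2^-1 * (v x / p x) - 1.
    by apply: ln_le_subr1; rewrite mulr_gt0 ?invr_gt0 // divr_gt0.
  rewrite lnM ?posrE ?invr_gt0 ?divr_gt0 // lnV ?posrE // ln_div ?posrE //.
  have -> : ln (v x) = - (ln (2 * c)%:R * (len x)%:R).
    rewrite /v lnV ?posrE ?exprn_gt0 ?ltr0n ?muln_gt0 // lnXn ?ltr0n ?muln_gt0 //.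
    by rewrite mulr_natr.
  by move=> h; lra.
apply: (le_trans bound).
by rewrite ExD ExD !ExZ Ex_const //; move: sumv; lra.
Qed.

End Walk.

Lemma length_count (P : fibres) m (Y : seq (delta P)) :
  uniq Y -> all (fun x => word_length (@gens P) x == m) Y -> (size Y <= #|{: letter}| ^ m)%N.
Proof.
move=> uY /allP hY.
have [w hw] := choice (fun x : delta P =>
  let: ex_intro2 w e1 e2 := word_lengthP x in ex_intro (fun w => x = ev P w /\ size w = word_length (@gens P) x) w (conj e1 e2)).
rewrite -card_tuple -(size_map w) cardE -(size_map val).
apply: uniq_leq_size.
  by rewrite map_inj_uniq // => x y e; rewrite (hw x).1 (hw y).1 e.
move=> s /mapP[x xY ->]; have hs : size (w x) == m by rewrite (hw x).2 hY.
by apply/mapP; exists (Tuple hs); rewrite ?mem_enum.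
Qed.

End Gibbs.

(** * Entropy is bounded below by the range of an orbit *)

(** For one torus coordinate, the [a] and [b] bits of the first lamp and of the second. Grouping the
    bits by coordinate makes the four coordinates independent given the path. *)
Definition quad : Type := (bool * bool) * (bool * bool).
HB.instance Definition _ := Finite.on quad.
Definition rest : Type := bool * {ffun 'I_4 -> quad} * bool.
HB.instance Definition _ := Finite.on rest.
(* An increment is lamp, step, lamp; the [c] bit of its first lamp is singled
   out, the [rest] being conditioned upon in the entropy bound. *)
Definition incr : Type := bool * rest.
HB.instance Definition _ := Finite.on incr.

Definition lamp1 (c : bool) (q : {ffun 'I_4 -> quad}) : lamp :=
  ([ffun i => (q i).1.1], [ffun i => (q i).1.2], c).
Definition lamp2 (c : bool) (q : {ffun 'I_4 -> quad}) : lamp :=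
  ([ffun i => (q i).2.1], [ffun i => (q i).2.2], c).
Definition iword (x : incr) : seq letter :=
  [:: inr (lamp1 x.1 x.2.1.2); inl x.2.1.1; inr (lamp2 x.2.2 x.2.1.2)].

Lemma incr_gt0 : (0 < #|{: incr}|)%N.
Proof. by apply/card_gt0P; exists (true, (true, [ffun=> ((true, true), (true, true))], true)). Qed.
Lemma rest_gt0 : (0 < #|{: rest}|)%N.
Proof. by apply/card_gt0P; exists (true, [ffun=> ((true, true), (true, true))], true). Qed.

(** Lamps are involutions, so inverting an increment exchanges its two lamps and reverses the step;
    this bijection makes the law symmetric. *)
Definition iinv (x : incr) : incr :=
  (x.2.2, (~~ x.2.1.1, [ffun i => ((x.2.1.2 i).2, (x.2.1.2 i).1)], x.1)).

Lemma iinvK : involutive iinv.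
Proof.
move=> [c [[b q] c']]; rewrite /iinv /= negbK; congr (_, (_, _, _)).
by apply/ffunP => i; rewrite !ffunE /=; case: (q i).
Qed.

Lemma iword_inv x : iword (iinv x) = winv (iword x).
Proof.
case: x => c [[b q] c']; rewrite /iword /winv /iinv /=.
congr [:: inr (_, _, _); _; inr (_, _, _)]; by apply/ffunP => i; rewrite !ffunE.
Qed.

Section Walk.
Variables (R : realType) (P : fibres).
Notation E j := {ffun 'I_4 -> P j}.

Definition igen (x : incr) : delta P := ev P (iword x).

Lemma walk_prod_igen s : walk_prod igen s = ev P (flatten (map iword s)).
Proof.
rewrite /walk_prod; elim: s => [|x s IH]; first by rewrite big_nil.
by rewrite big_cons /= -[_ :: _ :: _ :: _]/(iword x ++ _) ev_cat IH.
Qed.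

Lemma igen_symmetric : is_symmetric (law R igen).
Proof.
apply: law_symmetric; exists iinv; first exact: iinvK.
by move=> x; rewrite /igen iword_inv ev_winv.
Qed.

Section Scale.
Variable j : nat.

(** The one point, relative to the walker, over which a [c] lamp flips the bit. *)
Definition base : int * E j := (gap j *+ 2, 0).

Definition ystep (z : rest) (y : int * E j) : int * E j :=
  let r := y.1 - dir_sign z.1.1 in
  (r, (stlamp (funit P j) (gap j) r (lamp2 false z.1.2)
        ((stlamp (funit P j) (gap j) y.1 (lamp1 false z.1.2) (y.2, false)).1, false)).1).

Lemma stlamp_c (F : zmodType) (u : F) (k r : int) a b c (e : {ffun 'I_4 -> F}) eps : 0 < k ->
  stlamp u k r (a, b, c) (e, eps) =
  ((stlamp u k r (a, b, false) (e, false)).1, eps + (c && ((r, e) == (k *+ 2, 0)))).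
Proof.
move=> k0; rewrite /stlamp xpair_eqE.
have [->|r0] := eqVneq r 0.
  by rewrite (_ : (0 == k *+ 2) = false) ?andbF ?addr0 //; apply/eqP; lia.
have [->|rk] := eqVneq r k.
  by rewrite (_ : (k == k *+ 2) = false) ?andbF ?addr0 //; apply/eqP; lia.
by case: (r == _); rewrite ?andbF ?addr0.
Qed.

Lemma stlamp_base (F : zmodType) (u : F) (k r : int) a b c (e : {ffun 'I_4 -> F}) eps : 0 < k ->
  ((r, (stlamp u k r (a, b, c) (e, eps)).1) == (k *+ 2, 0)) = ((r, e) == (k *+ 2, 0)).
Proof.
move=> k0; rewrite !xpair_eqE; have [->|] //= := eqVneq r (k *+ 2).
have h0 : (k *+ 2 == 0) = false by apply/eqP; lia.
have h1 : (k *+ 2 == k) = false by apply/eqP; lia.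
by rewrite /stlamp h0 h1 eqxx.
Qed.

(** The point moves as the [rest] dictates, while the singled out bit enters linearly, and only if
    the point stands at [base] when the increment begins. *)
Lemma run_iword x (y : int * E j) eps :
  run (iword x) (y.1, (y.2, eps)) =
  ((ystep x.2 y).1, ((ystep x.2 y).2,
    eps + ((x.1 && (y == base)) + (x.2.2 && (ystep x.2 y == base))))).
Proof.
case: x => c [[b q] c']; case: y => r e; rewrite /= /ystep /=.
rewrite /lamp1 /lamp2 /base (@stlamp_c _ _ _ _ _ _ c) ?gap_gt0 //.
rewrite (@stlamp_c _ _ _ _ _ _ c') ?gap_gt0 //.
by rewrite stlamp_base ?gap_gt0 // addrA.
Qed.

Fixpoint yrun (s : seq rest) (y : int * E j) :=
  if s is z :: s' then yrun s' (ystep z y) else y.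

(** Only times at which an increment begins count; the final position is ignored because no first
    lamp is switched there. *)
Fixpoint hit (y : int * E j) (s : seq rest) : bool :=
  if s is z :: s' then (y == base) || hit (ystep z y) s' else false.

Definition esc (s : seq rest) : bool :=
  if s is z :: s' then ~~ hit (ystep z base) s' else true.

(* The number of times [t] such that the orbit started at [base] at time [t] does
   not return: this is the size of the inverted orbit of [base]. *)
Fixpoint fresh (s : seq rest) : nat :=
  if s is z :: s' then (esc s + fresh s')%N else 0%N.

Lemma not_hit_run s y : ~~ hit y s -> exists d, forall cs eps, size cs = size s ->
  (run (flatten (map iword (zip cs s))) (y.1, (y.2, eps))).2.2 = eps + d.
Proof.
elim: s y => [|z s IH] y /=.
  by move=> _; exists 0 => -[|//] eps _; rewrite addr0.
rewrite negb_or => /andP[/negbTE yb /IH[d hd]].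
exists ((z.2 && (ystep z y == base)) + d) => -[//|c cs] eps [hs].
rewrite [zip _ _]/= [flatten _]/= -[_ :: _ :: _ :: _]/(iword (c, z) ++ _) run_cat.
by rewrite run_iword hd // yb andbF add0r addrA.
Qed.

(** If the orbit that starts at [base] does not return, the later singled out bits cannot affect the
    bit over it, so [x] determines the first of them, which saves a factor 2; induction gives the
    bound conditionally on the [rest]. *)
Lemma count_bits s (x : delta P) :
  Ex (size s) (fun cs => 2 ^+ fresh s * (walk_prod igen (zip cs s) == x)%:R) <= 1 :> R.
Proof.
elim: s x => [|z s IH] x.
  by rewrite /= expr0 mul1r lern1; case: (_ == _).
have le1 c : Ex (size s) (fun cs => 2 ^+ fresh s * (walk_prod igen (zip (c :: cs) (z :: s)) == x)%:R)
    <= 1 :> R.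
  apply: le_trans (IH ((igen (c, z))^-1 * x)%g); apply: le_Ex => cs _.
  rewrite /walk_prod big_cons -/(walk_prod igen _) (_ : (_ == x) = (walk_prod igen (zip cs s) == (igen (c, z))^-1 * x)%g) //.
  by apply/eqP/eqP => [<-|->]; rewrite ?mulKg ?mulVKg.
rewrite [size _]/= [Ex _.+1 _]/= -/(fresh (z :: s)) [fresh _]/= -/(esc (z :: s)).
case: (boolP (esc (z :: s))) => [|_]; last first.
  rewrite (eq_avg (g := fun c => Ex (size s) (fun cs =>
    2 ^+ fresh s * (walk_prod igen (zip (c :: cs) (z :: s)) == x)%:R))) //.
  by rewrite -[leRHS](avg_const 1 (T := bool)) ?card_bool //; apply: le_avg.
move=> /not_hit_run[d hd].
(* [c0] is the first bit as read off from the action of [x] on [base], after removing the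
   contributions of the [rest]. *)
pose c0 := (sval x j (base.1, (base.2, false))).2.2 + (z.2 && (ystep z base == base)) + d.
have zero c : c != c0 ->
   Ex (size s) (fun cs => 2 ^+ fresh s * (walk_prod igen (zip (c :: cs) (z :: s)) == x)%:R) = 0 :> R.
  move=> cc; rewrite -(Ex_const (T := bool) (size s) 0) ?card_bool //; apply: eq_Ex => cs hs.
  case: eqP => [e|]; rewrite ?mulr0 //; case/eqP: cc; rewrite /c0 -e walk_prod_igen.
  have -> : flatten (map iword (zip (c :: cs) (z :: s))) =
    iword (c, z) ++ flatten (map iword (zip cs s)) by [].
  rewrite -[sval _ _ _]/(run _ _) run_cat.
  rewrite (run_iword (c, z)) hd // eqxx andbT [(c, z).2]/=.
  by case: (_ && _); case: d {hd c0 e}; case: c.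
have dbl c : Ex (size s) (fun cs => 2 ^+ (1 + fresh s)%N * (walk_prod igen (zip (c :: cs) (z :: s)) == x)%:R) =
   2 * Ex (size s) (fun cs => 2 ^+ fresh s * (walk_prod igen (zip (c :: cs) (z :: s)) == x)%:R) :> R.
  by rewrite -ExZ; apply: eq_Ex => cs _; rewrite mulrA -exprS.
rewrite (eq_avg dbl) avgZ avg_bool mulrC divfK ?pnatr_eq0 //.
case: (boolP (true == c0)) => h.
  by rewrite [X in _ + X]zero ?addr0 // -(eqP h).
by rewrite zero ?add0r.
Qed.

Lemma conv_power_gt0 n s : size s = n -> 0 < conv_power (law R igen) n (walk_prod igen s).
Proof.
move=> hs; rewrite conv_powerE ?incr_gt0 //.
rewrite (Ex_tuple_sum (f := fun t => (walk_prod igen t == walk_prod igen s)%:R)) //.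
have Kn : (0 : R) < (#|{: incr}| ^ n)%:R^-1 by rewrite invr_gt0 ltr0n expn_gt0 incr_gt0.
by rewrite (bigD1 (Tuple (introT eqP hs))) //= eqxx mulr1 ltr_pwDl // sumr_ge0.
Qed.

Lemma Ex_split n (f : seq incr -> R) :
  Ex n f = Ex n (fun zs => Ex n (fun cs => f (zip cs zs))).
Proof. by rewrite (@Ex_prod R bool rest) exchange_Ex. Qed.

Lemma prob_le n (x : delta P) :
  conv_power (law R igen) n x <= Ex n (fun zs => 2 ^- fresh zs).
Proof.
rewrite conv_powerE ?incr_gt0 // Ex_split; apply: le_Ex => zs hs.
rewrite -[leRHS]mulr1; have := count_bits zs x; rewrite hs ExZ => h.
by rewrite ler_pdivlMl ?exprn_gt0.
Qed.

(** [- ln y >= 1 - y] at [y = 2 ^ fresh * p(W)]. The mean of [y] over the singled out bits is at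
    most 1, by [count_bits] once [p] is written as an average over an independent copy of the
    walk. *)
Lemma entropy_lower n :
  ln 2 * Ex n (fun zs => (fresh zs)%:R) <= walk_entropy (law R igen) n.
Proof.
rewrite walk_entropyE ?incr_gt0 // Ex_split.
set p := conv_power _ n.
rewrite -ExZ.
have h1 zs : size zs = n ->
    Ex n (fun cs => 2 ^+ fresh zs * p (walk_prod igen (zip cs zs))) <= 1.
  move=> hs.
  rewrite (eq_Ex (g := fun cs => Ex n (fun s' => 2 ^+ fresh zs * (walk_prod igen (zip cs zs) == walk_prod igen s')%:R))).
    rewrite exchange_Ex -[leRHS](Ex_const n 1 incr_gt0); apply: le_Ex => s' _.
    by rewrite -hs; exact: count_bits.
  move=> cs _; rewrite /p conv_powerE ?incr_gt0 // ExZ; congr (_ * _).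
  by apply: eq_Ex => s' _; rewrite eq_sym.
apply: le_Ex => zs hs.
apply: (@le_trans _ _ (Ex n (fun cs => ln 2 * (fresh zs)%:R + (1 + -1 * (2 ^+ fresh zs * p (walk_prod igen (zip cs zs))))))).
  rewrite ExD ExD Ex_const ?card_bool // Ex_const ?card_bool // ExZ.
  by rewrite lerDl mulN1r subr_ge0 h1.
apply: le_Ex => cs hc; have := @conv_power_gt0 n (zip cs zs).
rewrite size_zip hc hs minnn -/p => /(_ erefl) p0.
have := @ln_le_subr1 R (2 ^+ fresh zs * p (walk_prod igen (zip cs zs))).
rewrite mulr_gt0 ?exprn_gt0 // lnM ?posrE ?exprn_gt0 // lnXn // -[ln 2 *+ _]mulr_natr.
move=> /(_ isT); move: (ln (p _)) (_ ^+ _ * p _) (ln 2 * _) => a b d h.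
by clear -h; lra.
Qed.

Definition return_prob t (y : int * E j) : R := Ex t (fun zs => (yrun zs y == base)%:R).
Definition escape_prob m : R := Ex m (fun zs => (esc zs)%:R).

(** A visit to [base] contributes only if no later one follows, so the total is the indicator of
    [hit], decomposed by the time of the last visit. *)
Fixpoint last_visits (y : int * E j) (s : seq rest) : nat :=
  if s is z :: s' then ((y == base) && esc s + last_visits (ystep z y) s')%N else 0%N.

Lemma hit_last_visits s y : (hit y s <= last_visits y s)%N.
Proof.
elim: s y => [|z s IH] y //=.
have [->|_] /= := eqVneq y base; last exact: IH.
by have := IH (ystep z base); case: (hit _ _) => //= h; apply: leq_trans h _; lia.
Qed.

Lemma Ex_last_visits n y :
  Ex n (fun zs => (last_visits y zs)%:R) = \sum_(t < n) return_prob t y * escape_prob (n - t).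
Proof.
elim: n y => [|n IH] y; first by rewrite big_ord0.
rewrite big_ord_recl subn0 {1}/return_prob /= -/(escape_prob n.+1).
rewrite (eq_avg (g := fun z => Ex n (fun s => ((y == base)%:R * (esc (z :: s))%:R)) +
   Ex n (fun zs => (last_visits (ystep z y) zs)%:R))); last first.
  move=> z; rewrite -ExD; apply: eq_Ex => s _; rewrite natrD; congr (_ + _).
  by rewrite -natrM mulnb.
rewrite avgD; congr (_ + _).
  by rewrite /escape_prob /= -avgZ; apply: eq_avg => z; rewrite ExZ.
rewrite (eq_avg (fun z => IH _)) /avg exchange_big /= mulr_sumr; apply: eq_bigr => t _.
by rewrite -mulr_suml mulrA.
Qed.

Lemma Ex_fresh n : Ex n (fun zs => (fresh zs)%:R) = \sum_(m < n) escape_prob m.+1.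
Proof.
elim: n => [|n IH]; first by rewrite big_ord0.
rewrite big_ord_recr /= -IH addrC.
rewrite (eq_avg (g := fun z => Ex n (fun s => (esc (z :: s))%:R) +
   Ex n (fun zs => (fresh zs)%:R))); last first.
  by move=> z; rewrite -ExD; apply: eq_Ex => s _; rewrite natrD.
by rewrite avgD avg_const ?rest_gt0.
Qed.

Lemma escape_prob_ge0 m : 0 <= escape_prob m.
Proof. by apply: Ex_ge0 => [|s _]; rewrite ?rest_gt0 ?ler0n. Qed.
Lemma return_prob_ge0 m y : 0 <= return_prob m y.
Proof. by apply: Ex_ge0 => [|s _]; rewrite ?rest_gt0 ?ler0n. Qed.

Lemma sum_shift_le (e : nat -> R) n t : (forall m, 0 <= e m) ->
  \sum_(N < n | (t <= N)%N) e (N - t)%N <= \sum_(m < n) e m.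
Proof.
move=> e0; have [nt|tn] := leqP n t.
  by rewrite big1 ?sumr_ge0 // => i /= ti; have := ltn_ord i; lia.
rewrite -[n in leRHS](subnK (ltnW tn)) big_split_ord /=.
apply: (@le_trans _ _ (\sum_(i < n - t) e i)); last by rewrite lerDl sumr_ge0.
rewrite -(big_mkord (fun N => t <= N)%N (fun N => e (N - t)%N)).
rewrite (big_cat_nat (n := t)) ?(ltnW tn) //= big_nat_cond big1 ?add0r; last first.
  by move=> i; lia.
rewrite -{1}[t]add0n big_addn big_mkord [leLHS](eq_bigl xpredT) => [|i]; last by rewrite leq_addl.
by apply: ler_sum => i _; rewrite addnK.
Qed.

(** Started at [base], the orbit has a last visit, so the products of return and escape
    probabilities sum to at least 1 for each horizon [N + 1]. Summing over [N < n], the convolution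
    is bounded by the product of the two sums. *)
Lemma renewal n :
  n%:R <= (\sum_(t < n) return_prob t base) * Ex n (fun zs => (fresh zs)%:R).
Proof.
have one N : 1 <= \sum_(t < N.+1) return_prob t base * escape_prob (N.+1 - t).
  rewrite -Ex_last_visits -[leLHS](Ex_const (T := rest) N.+1 1) ?rest_gt0 //; apply: le_Ex => -[//|z s] _.
  by rewrite ler1n; apply: leq_trans (hit_last_visits _ _); rewrite /= eqxx.
have -> : n%:R = \sum_(N < n) (1 : R) by rewrite sumr_const card_ord.
apply: (le_trans (ler_sum _ (fun (N : 'I_n) _ => one N))).
rewrite Ex_fresh mulr_suml.
rewrite (eq_bigr (fun N : 'I_n => \sum_(t < n | (t <= N)%N) return_prob t base * escape_prob (N - t).+1)).
  rewrite (exchange_big_dep xpredT) //=; apply: ler_sum => t _.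
  rewrite -mulr_sumr ler_wpM2l ?return_prob_ge0 //.
  by apply: (sum_shift_le (e := fun m => escape_prob m.+1)) => m; exact: escape_prob_ge0.
move=> N _; rewrite (big_ord_widen_cond n xpredT (fun t => return_prob t base * escape_prob (N.+1 - t))) //=.
by apply: eq_big => [i|i /=]; rewrite ltnS // => iN; rewrite subSn.
Qed.

Lemma fresh_gt0 s : (0 < size s)%N -> (0 < fresh s)%N.
Proof.
elim: s => [|z s IH] //= _; case: s IH => [|z' s] IH //.
by rewrite addn_gt0 IH ?orbT.
Qed.

End Scale.
End Walk.

(** * Binomial anti-concentration *)

Section Binomial.
Local Open Scope nat_scope.

Lemma bin_falling N l : N <= l.*2.+1 -> 'C(N, l.+1) <= 'C(N, l).
Proof.
move=> h; have := mul_bin_left N l.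
case: (leqP N l) => [nl|ln] e; first by rewrite bin_small.
by rewrite -(leq_pmul2l (ltn0Sn l)) e leq_mul2r; apply/orP; right; lia.
Qed.

Lemma bin_rising N l : l.*2.+1 <= N -> 'C(N, l) <= 'C(N, l.+1).
Proof.
move=> h; have := mul_bin_left N l => e.
by rewrite -(leq_pmul2l (ltn0Sn l)) e leq_mul2r; apply/orP; right; lia.
Qed.

(** Induction from [2 J] to [2 J + 1] to [2 J + 2] by the exact ratios of the central coefficients;
    the two steps reduce to [(2J+1)(2J+2) <= 4 (J+1)^2] and [(2J+1)(2J+3) <= 4 (J+1)^2]. *)
Lemma central_bin_sq N : 'C(N, N./2) ^ 2 * N.+1 <= 4 ^ N.
Proof.
suff h J : 'C(J.*2, J) ^ 2 * J.*2.+1 <= 4 ^ J.*2 /\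
           'C(J.*2.+1, J) ^ 2 * J.*2.+2 <= 4 ^ J.*2.+1.
  have [h1 h2] := h N./2; rewrite -{1 3 4}(odd_double_half N).
  by case: (odd N); rewrite /= ?add0n ?add1n ?uphalf_double ?doubleK.
have odd_le J0 : 'C(J0.*2, J0) ^ 2 * J0.*2.+1 <= 4 ^ J0.*2 ->
    'C(J0.*2.+1, J0) ^ 2 * J0.*2.+2 <= 4 ^ J0.*2.+1 /\
    'C(J0.+1.*2, J0.+1) ^ 2 * J0.+1.*2.+1 <= 4 ^ J0.+1.*2.
  set x := 'C(J0.*2, J0); move: x (erefl : x = 'C(J0.*2, J0)) => x ex.
  set p := 4 ^ J0.*2; move: p (erefl : p = 4 ^ J0.*2) => p ep hx.
  have e1 : J0.+1 * 'C(J0.*2.+1, J0.+1) = J0.*2.+1 * x by rewrite ex mul_bin_diag.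
  have e2 : 'C(J0.*2.+1, J0.+1) = 'C(J0.*2.+1, J0).
    have JJ : J0 <= J0.*2.+1 by lia.
    by rewrite -(bin_sub JJ); congr 'C(_, _); lia.
  have e3 : 'C(J0.+1.*2, J0.+1) = 2 * 'C(J0.*2.+1, J0).
    by rewrite doubleS binS e2 mul2n addnn.
  rewrite e3 doubleS !(expnS 4) -ep; move: e1; rewrite e2; set y := 'C(_, J0) => e1.
  have e4 : J0.+1 ^ 2 * y ^ 2 = J0.*2.+1 ^ 2 * x ^ 2 by rewrite -!expnMn e1.
  have J2 : 0 < J0.+1 ^ 2 by rewrite expn_gt0.
  split.
    rewrite -(leq_pmul2l J2) [leqLHS]mulnA e4.
    have -> : J0.*2.+1 ^ 2 * x ^ 2 * J0.*2.+2 = x ^ 2 * J0.*2.+1 * (J0.*2.+1 * J0.*2.+2) by ring.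
    apply: (leq_trans (leq_mul hx (leqnn _))).
    have -> : J0.+1 ^ 2 * (4 * p) = p * (4 * J0.+1 ^ 2) by ring.
    by rewrite leq_mul2l; apply/orP; right; lia.
  rewrite -(leq_pmul2l J2) expnMn.
  have -> : J0.+1 ^ 2 * (2 ^ 2 * y ^ 2 * J0.*2.+3) = (J0.+1 ^ 2 * y ^ 2) * (4 * J0.*2.+3) by ring.
  rewrite e4.
  have -> : J0.*2.+1 ^ 2 * x ^ 2 * (4 * J0.*2.+3) = x ^ 2 * J0.*2.+1 * (4 * J0.*2.+1 * J0.*2.+3) by ring.
  apply: (leq_trans (leq_mul hx (leqnn _))).
  have -> : J0.+1 ^ 2 * (4 * (4 * p)) = p * (16 * J0.+1 ^ 2) by ring.
  by rewrite leq_mul2l; apply/orP; right; lia.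
elim: J => [|J [IH1 IH2]]; first by rewrite /= !bin0.
have [_ h] := odd_le J IH1; split=> //.
by have [] := odd_le J.+1 h.
Qed.

(** Truncated subtraction keeps only the decreases of the row; they vanish before the centre and
    telescope after it. *)
Lemma bin_variation N L :
  \sum_(l < L) ('C(N, l) - 'C(N, l.+1)) <= 'C(N, N./2).
Proof.
have hdown m : \sum_(N./2 <= l < N./2 + m) ('C(N, l) - 'C(N, l.+1)) =
    'C(N, N./2) - 'C(N, N./2 + m) /\ 'C(N, N./2 + m) <= 'C(N, N./2).
  elim: m => [|m [IH1 IH2]]; first by rewrite addn0 big_geq // subnn.
  have f : 'C(N, (N./2 + m).+1) <= 'C(N, N./2 + m).
    by apply: bin_falling; have := odd_double_half N; lia.
  rewrite addnS big_nat_recr ?leq_addr //= IH1; split; lia.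
have hup m : m <= N./2 -> \sum_(0 <= l < m) ('C(N, l) - 'C(N, l.+1)) = 0.
  move=> hm; rewrite big_nat_cond big1 // => l /andP[/andP[_ lm] _].
  apply/eqP; rewrite subn_eq0; apply: bin_rising.
  by have := odd_double_half N; lia.
rewrite -(big_mkord xpredT (fun l => 'C(N, l) - 'C(N, l.+1))).
case: (leqP L N./2) => hL; first by rewrite hup.
rewrite (big_cat_nat (n := N./2)) ?(ltnW hL) //= hup // add0n.
rewrite -(subnKC (ltnW hL)); have [-> _] := hdown (L - N./2).
exact: leq_subr.
Qed.

Lemma bin_window N i m :
  'C(N, i) <= 'C(N, i + m) + \sum_(l < m) ('C(N, i + l) - 'C(N, (i + l).+1)).
Proof.
elim: m => [|m IH]; first by rewrite big_ord0 addn0 addn0.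
rewrite big_ord_recr /= addnS addnCA; apply: leq_trans IH _.
by rewrite [leqLHS]addnC leq_add2l -leq_subLR.
Qed.

(** Separation makes the windows of length [M] that start at the points of [Z] disjoint. *)
Lemma separated_sum_le (Z : pred nat) (f : nat -> nat) N M :
  (forall i i', Z i -> Z i' -> i < i' -> i + M <= i') ->
  \sum_(i < N | Z i) \sum_(m < M) f (i + m) <= \sum_(l < N + M) f l.
Proof.
move=> sep.
rewrite pair_big_dep /=.
have hlt (p : 'I_N * 'I_M) : p.1 + p.2 < N + M.
  by case: p => i m /=; have := ltn_ord i; have := ltn_ord m; lia.
pose h p := Ordinal (hlt p).
pose A := [pred p : 'I_N * 'I_M | Z p.1].
have inj : {in A &, injective h}.
  move=> [i m] [i' m']; rewrite !inE /= => zi zi' /(congr1 val) /= e.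
  have := ltn_ord m; have := ltn_ord m'.
  have ii : i = i' :> nat.
    case: (ltngtP i i') => // lt.
      by have := sep _ _ zi zi' lt; have := ltn_ord m; lia.
    by have := sep _ _ zi' zi lt; have := ltn_ord m'; lia.
  by move=> _ _; congr (_, _); apply/val_inj => //=; lia.
rewrite (eq_bigl (fun p => p \in A)); last first.
  by move=> p; rewrite inE andbT.
rewrite -(big_imset (fun l : 'I_(N + M) => f l) inj) /=.
by rewrite [leqRHS](bigID (mem (h @: A))) /= leq_addr.
Qed.

Lemma sum_bin N L : \sum_(l < L) 'C(N, l) <= 2 ^ N.
Proof.
have -> : 2 ^ N = \sum_(l < N.+1) 'C(N, l).
  by rewrite (expnDn 1 1); apply: eq_bigr => i _; rewrite !exp1n !muln1.
case: (leqP L N.+1) => h.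
  by rewrite -(subnKC h) big_split_ord /= leq_addr.
rewrite -(subnKC (ltnW h)) big_split_ord /= [X in _ + X]big1 ?addn0 // => i _.
by rewrite bin_small // leq_addr.
Qed.

(* On a window of length [M] to the right of [i], the coefficient ['C(N, i)]
   exceeds the average by at most the total decrease of the row on the window. *)
Lemma separated_bin (Z : pred nat) N M :
  (forall i i', Z i -> Z i' -> i < i' -> i + M <= i') ->
  M * \sum_(i < N.+1 | Z i) 'C(N, i) <= 2 ^ N + M * 'C(N, N./2).
Proof.
move=> sep.
have h i : M * 'C(N, i) <= \sum_(m < M) 'C(N, i + m) +
    M * \sum_(m < M) ('C(N, i + m) - 'C(N, (i + m).+1)).
  have cst c : M * c = \sum_(m < M) c by rewrite sum_nat_const card_ord.
  rewrite !cst -big_split /=.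
  apply: leq_sum => m _; apply: leq_trans (bin_window N i m) _.
  rewrite leq_add2l (big_ord_widen M (fun l => 'C(N, i + l) - 'C(N, (i + l).+1)) (ltnW (ltn_ord m))).
  by rewrite [leqRHS](bigID (fun l : 'I_M => l < m)) /= leq_addr.
rewrite big_distrr /=.
apply: (leq_trans (leq_sum _ (fun (i : 'I_N.+1) _ => h i))).
rewrite big_split /= -big_distrr /=; apply: leq_add.
  exact: leq_trans (separated_sum_le (fun l => 'C(N, l)) _ sep) (sum_bin _ _).
rewrite leq_mul2l; apply/orP; right.
exact: leq_trans (separated_sum_le (fun l => 'C(N, l) - 'C(N, l.+1)) _ sep) (bin_variation _ _).
Qed.

End Binomial.

(** * The law of one torus coordinate under alternating reflections *)

Definition order_ge (F : zmodType) (u : F) (M : nat) : Prop :=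
  forall m, (0 < m < M)%N -> u *+ m != 0.

Section OneDim.
Variables (R : realType) (F : zmodType) (u : F).
Implicit Types (psi : F -> R) (N : nat) (c : int).

Definition binsum N c psi : R :=
  \sum_(i < N.+1) 'C(N, i)%:R * psi (u *~ (i%:Z - c)).

Lemma binsum_pascal N c psi :
  binsum N.+1 c psi = binsum N c psi + binsum N (c - 1) psi.
Proof.
rewrite /binsum big_ord_recl /= bin0.
under eq_bigr => i _ do rewrite /bump leq0n add1n binS natrD mulrDl.
rewrite big_split /= addrA; congr (_ + _).
  rewrite big_ord_recr /= (bin_small (leqnn _)) mul0r addr0.
  rewrite [RHS]big_ord_recl /= bin0; congr (_ + _).
apply: eq_bigr => i _; congr (_ * psi (u *~ _)); lia.
Qed.

Lemma binsum_rev N c psi :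
  binsum N c psi = \sum_(i < N.+1) 'C(N, i)%:R * psi (u *~ (N%:Z - i%:Z - c)).
Proof.
rewrite /binsum (reindex_inj rev_ord_inj) /=; apply: eq_bigr => i _.
rewrite subSS bin_sub -1?ltnS //; congr (_ * psi (u *~ _)).
by have := ltn_ord i; lia.
Qed.

Lemma binsum_reflA N c psi :
  binsum N c (fun x => psi (- x)) = binsum N (N%:Z - c) psi.
Proof.
rewrite [RHS]binsum_rev; apply: eq_bigr => i _; congr (_ * psi _).
by rewrite -mulrNz; congr (_ *~ _); lia.
Qed.

Lemma binsum_reflB N c psi :
  binsum N c (fun x => psi (u - x)) = binsum N (N%:Z - 1 - c) psi.
Proof.
rewrite [RHS]binsum_rev; apply: eq_bigr => i _; congr (_ * psi _).
by rewrite -[X in X - _]mulr1z -mulrzBr; congr (_ *~ _); lia.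
Qed.

Lemma half_pow N (x : R) : 2 ^- N * (x / 2) = 2 ^- N.+1 * x.
Proof. by rewrite exprS invfM [2^-1 * _]mulrC -mulrA [2^-1 * x]mulrC. Qed.

(* Expectation of [psi] after [N] alternating uniform reflections of [0]: a
   shifted binomial multiple of [u]. *)
Definition blaw N psi : R := 2 ^- N * binsum N N./2 psi.

(** For even [N] the multiples [i - N/2] are symmetric about 0, so [x -> - x] preserves the law; for
    odd [N] they are symmetric about 1/2, so [x -> u - x] does. The reflection of the other kind
    shifts the law by one, and averaging with the unreflected law is then Pascal's rule for
    [N + 1]. *)
Lemma blaw_reflA_even N psi : ~~ odd N ->
  blaw N (fun x => avg (fun v => psi (reflA v x))) = blaw N psi.
Proof.
move=> eN; rewrite /blaw; congr (_ * _).
have -> : binsum N N./2 (fun x => avg (fun v => psi (reflA v x))) =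
    (binsum N N./2 (fun x => psi (- x)) + binsum N N./2 psi) / 2.
  rewrite /binsum -big_split /= mulr_suml; apply: eq_bigr => i _.
  by rewrite avg_bool /= -mulrDr mulrA.
rewrite binsum_reflA; have -> : N%:Z - N./2%:Z = N./2%:Z.
  by have := odd_double_half N; rewrite (negbTE eN); lia.
by rewrite -mulr2n -[_ *+ 2]mulr_natr mulfK // pnatr_eq0.
Qed.

Lemma blaw_reflA_odd N psi : odd N ->
  blaw N (fun x => avg (fun v => psi (reflA v x))) = blaw N.+1 psi.
Proof.
move=> oN; rewrite /blaw.
have -> : binsum N N./2 (fun x => avg (fun v => psi (reflA v x))) =
    (binsum N N./2 (fun x => psi (- x)) + binsum N N./2 psi) / 2.
  rewrite /binsum -big_split /= mulr_suml; apply: eq_bigr => i _.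
  by rewrite avg_bool /= -mulrDr mulrA.
rewrite binsum_reflA binsum_pascal half_pow.
have -> : N%:Z - N./2%:Z = N.+1./2%:Z by have := odd_double_half N; rewrite oN; lia.
have -> : (N.+1./2%:Z - 1) = N./2%:Z by have := odd_double_half N; rewrite oN; lia.
by [].
Qed.

Lemma blaw_reflB_odd N psi : odd N ->
  blaw N (fun x => avg (fun v => psi (reflB u v x))) = blaw N psi.
Proof.
move=> oN; rewrite /blaw; congr (_ * _).
have -> : binsum N N./2 (fun x => avg (fun v => psi (reflB u v x))) =
    (binsum N N./2 (fun x => psi (u - x)) + binsum N N./2 psi) / 2.
  rewrite /binsum -big_split /= mulr_suml; apply: eq_bigr => i _.
  by rewrite avg_bool /= -mulrDr mulrA.
rewrite binsum_reflB; have -> : N%:Z - 1 - N./2%:Z = N./2%:Z.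
  by have := odd_double_half N; rewrite oN; lia.
by rewrite -mulr2n -[_ *+ 2]mulr_natr mulfK // pnatr_eq0.
Qed.

Lemma blaw_reflB_even N psi : ~~ odd N ->
  blaw N (fun x => avg (fun v => psi (reflB u v x))) = blaw N.+1 psi.
Proof.
move=> eN; rewrite /blaw.
have -> : binsum N N./2 (fun x => avg (fun v => psi (reflB u v x))) =
    (binsum N N./2 (fun x => psi (u - x)) + binsum N N./2 psi) / 2.
  rewrite /binsum -big_split /= mulr_suml; apply: eq_bigr => i _.
  by rewrite avg_bool /= -mulrDr mulrA.
rewrite binsum_reflB binsum_pascal half_pow.
have -> : N%:Z - 1 - N./2%:Z = N./2%:Z - 1.
  by have := odd_double_half N; rewrite (negbTE eN); lia.
have -> : N.+1./2 = N./2 by have := odd_double_half N; rewrite (negbTE eN); lia.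
by rewrite [_ + binsum _ _ _]addrC.
Qed.

Definition bsup M N : R := M%:R^-1 + 'C(N, N./2)%:R / 2 ^+ N.

(** The indices [i] with [(i - N/2) u = 0] are at least [M] apart, so binomial anti-concentration
    applies. *)
Lemma blaw_point M N : (0 < M)%N -> order_ge u M ->
  blaw N (fun x => (x == 0)%:R) <= bsup M N.
Proof.
move=> M0 hu; pose Z i := u *~ (i%:Z - N./2%:Z) == 0.
have sep i i' : Z i -> Z i' -> (i < i')%N -> (i + M <= i')%N.
  move=> /eqP zi /eqP zi' lt; rewrite leqNgt; apply/negP => h.
  have /negP[] := hu (i' - i)%N ltac:(lia).
  rewrite pmulrn (_ : (i' - i)%N%:Z = (i'%:Z - N./2%:Z) - (i%:Z - N./2%:Z)); last by lia.
  by rewrite mulrzBr zi zi' subrr.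
have := separated_bin N sep.
rewrite -(ler_nat R) natrD !natrM natrX natr_sum => h.
have -> : blaw N (fun x => (x == 0)%:R) = 2 ^- N * \sum_(i < N.+1 | Z i) 'C(N, i)%:R.
  rewrite /blaw /binsum [in RHS]big_mkcond /=; congr (_ * _); apply: eq_bigr => i _.
  by rewrite /Z; case: (_ == 0); rewrite ?mulr1 ?mulr0.
have p0 : (0 : R) < 2 ^+ N by rewrite exprn_gt0.
have m0 : (0 : R) < M%:R by rewrite ltr0n.
rewrite ler_pdivrMl // /bsup mulrDr mulrCA mulfV ?gt_eqF // mulr1.
by rewrite -(ler_pM2l m0) mulrDr mulrCA mulfV ?gt_eqF // mulr1.
Qed.

(** The fourth power comes from the four coordinates: it turns a decay of order [N ^ (-1/2)] into
    [(N + 1) ^- 2], summable over alternations. The factor 8 is convexity,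
    [(x + y)^4 <= 8 (x^4 + y^4)]. *)
Lemma bsup_pow4 M N : bsup M N ^+ 4 <= 8 * (M%:R ^- 4 + (N.+1%:R ^- 2)).
Proof.
set x := M%:R^-1 : R; set y := 'C(N, N./2)%:R / 2 ^+ N : R.
have hy : y ^+ 2 <= N.+1%:R^-1.
  have := central_bin_sq N; rewrite -(ler_nat R) natrM !natrX => h.
  rewrite -div1r ler_pdivlMr ?ltr0n // /y exprMn exprVn mulrAC.
  by rewrite ler_pdivrMr ?exprn_gt0 // mul1r -exprM mulnC exprM (_ : 2 ^+ 2 = 4%:R) // -natrX.
have hxy : bsup M N ^+ 4 <= 8 * (x ^+ 4 + y ^+ 4).
  rewrite /bsup -/x -/y; have := sqr_ge0 (x - y); have := sqr_ge0 (x ^+ 2 - y ^+ 2).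
  have := sqr_ge0 (x ^+ 2 - y * x); have := sqr_ge0 (y ^+ 2 - y * x).
  have := sqr_ge0 (x ^+ 2 + y ^+ 2 - 2 * x * y); nra.
apply: le_trans hxy _; rewrite ler_wpM2l // /x exprVn lerD2l.
rewrite -exprVn -[4%N]/(2 * 2)%N exprM ler_sqr ?nnegrE ?sqr_ge0 ?invr_ge0 //.
Qed.

End OneDim.

(** * Green function of the orbit *)

Section Position.
Variables (R : realType) (k : int).
Hypothesis k0 : 0 < k.

Fixpoint prun (s : seq bool) (r : int) : int :=
  if s is b :: s' then prun s' (r - dir_sign b) else r.

(* [N] counts the effective alternations between the sites [0] (even [N] waits
   for [k]) and [k] (odd [N] waits for [0]). *)
Definition alternate (r : int) (N : nat) : nat :=
  if r == 0 then (N + odd N)%N else if r == k then (N + ~~ odd N)%N else N.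

Fixpoint nrun (s : seq bool) (r : int) (N : nat) : nat :=
  if s is b :: s' then nrun s' (r - dir_sign b) (alternate (r - dir_sign b) (alternate r N)) else N.

(** Equal to [1 / ((N + 1)(N + 2))], of the order of the return bound [(N + 1) ^- 2], in a form that
    telescopes. *)
Definition phi (N : nat) : R := N.+1%:R^-1 - N.+2%:R^-1.

Lemma phi_ge0 N : 0 <= phi N.
Proof. by rewrite /phi subr_ge0 lef_pV2 ?posrE ?ltr0n // ler_nat. Qed.

Definition dist_phase (r : int) (N : nat) : int :=
  if odd N then 2 * Num.min (Num.max r 0) (2 * k)
  else 2 * Num.min (Num.max (r - k) 0) k.

(* [dist_phase] is the expected number of visits to [2 k] before the next
   alternation, and the last term dominates the weights collected after it. *)
Definition lyap (r : int) (N : nat) : R :=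
  phi N * (dist_phase r N)%:~R + 2 * k%:~R / N.+2%:R.

Lemma lyap_ge0 r N : 0 <= lyap r N.
Proof.
rewrite /lyap addr_ge0 ?mulr_ge0 ?phi_ge0 ?invr_ge0 ?ler0z ?(ltW k0) //.
by rewrite /dist_phase; case: ifP => _; lia.
Qed.

(** The case that matters is an alternation at [k], where [dist_phase] rises from 0 to [2 k]: the
    last term pays exactly, as [phi (N + 1) * 2k + 2k / (N + 3) = 2k / (N + 2)]. *)
Lemma lyap_alternate r N : lyap r (alternate r N) <= lyap r N.
Proof.
rewrite /alternate; case: eqVneq => [->|r0].
  case: (boolP (odd N)) => oN /=; rewrite ?addn0 ?lexx // addn1 /lyap /dist_phase /= oN /=.
  rewrite (_ : 2 * Num.min (Num.max (0 - k) 0) k = 0); last by lia.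
  rewrite (_ : 2 * Num.min (Num.max 0 0) (2 * k) = 0); last by lia.
  rewrite !mulr0z !mulr0 !add0r ler_wpM2l ?mulr_ge0 ?ler0z ?(ltW k0) //.
  by rewrite lef_pV2 ?posrE ?ltr0n // ler_nat.
case: eqVneq => [->|_]; last exact: lexx.
case: (boolP (odd N)) => oN /=; rewrite ?addn0 ?lexx // addn1 /lyap /dist_phase /= (negbTE oN) /=.
rewrite (_ : 2 * Num.min (Num.max (k - k) 0) k = 0); last by lia.
rewrite (_ : 2 * Num.min (Num.max k 0) (2 * k) = 2 * k); last by lia.
rewrite mulr0z mulr0 add0r intrM mulrC -mulrDr /phi subrK.
by rewrite lexx.
Qed.

Lemma lyap_step r N :
  (r == 2 * k)%:R * phi N +
  avg (fun b => lyap (r - dir_sign b) (alternate (r - dir_sign b) (alternate r N))) <= lyap r N.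
Proof.
apply: (@le_trans _ _ ((r == 2 * k)%:R * phi N + avg (fun b => lyap (r - dir_sign b) (alternate r N)))).
  by rewrite lerD2l; apply: le_avg => b; exact: lyap_alternate.
apply: le_trans (lyap_alternate r N).
have -> : (r == 2 * k)%:R * phi N = (r == 2 * k)%:R * phi (alternate r N).
  rewrite /alternate; have [->|_] := eqVneq r (2 * k); last by rewrite !mul0r.
  rewrite (_ : (2 * k == 0) = false); last by apply/eqP; lia.
  by rewrite (_ : (2 * k == k) = false) //; apply/eqP; lia.
(* After [alternate] the phase no longer waits for the site [r], so the convex kink of [dist_phase]
   is never met and only the concave one at [2 k] remains. *)
have hn : (r = 0 -> ~~ odd (alternate r N)) /\ (r = k -> odd (alternate r N)).
  rewrite /alternate; split=> [->|->].
    by rewrite eqxx oddD; case: (odd N).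
  by rewrite gt_eqF // eqxx oddD; case: (odd N).
move: (alternate r N) hn => m [h1 h2].
rewrite avg_bool /lyap /dir_sign opprK.
have hd : 2 * (r == 2 * k)%:R + dist_phase (r - 1) m + dist_phase (r + 1) m <=
    2 * dist_phase r m :> int.
  by rewrite /dist_phase; case: ifP h1 h2 => om h1 h2; case: eqVneq => [e|ne] /=; lia.
have {}hd : 2 * (r == 2 * k)%:R + (dist_phase (r - 1) m)%:~R + (dist_phase (r + 1) m)%:~R <=
    2 * (dist_phase r m)%:~R :> R.
  move: hd; rewrite -(ler_int R) !rmorphD /= !rmorphM /=.
  by case: (r == 2 * k).
have p0 := phi_ge0 m.
have := ler_wpM2l p0 hd; move: (2 * _ / _) (phi m) => w p; clear; lra.
Qed.

Definition green n (w : nat -> R) r N : R :=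
  \sum_(t < n) Ex t (fun s => (prun s r == 2 * k)%:R * w (nrun s r N)).

Lemma greenS n w r N : green n.+1 w r N =
  (r == 2 * k)%:R * w N + avg (fun b => green n w (r - dir_sign b) (alternate (r - dir_sign b) (alternate r N))).
Proof.
rewrite /green big_ord_recl /=; congr (_ + _).
by rewrite /avg exchange_big /= mulr_sumr.
Qed.

Lemma green_phi n r N : green n phi r N <= lyap r N.
Proof.
elim: n r N => [|n IH] r N; first by rewrite /green big_ord0 lyap_ge0.
rewrite greenS; apply: le_trans (lyap_step r N).
by rewrite lerD2l; apply: le_avg.
Qed.

Lemma sqrt_mid (a b : R) : 0 <= a -> 0 <= b ->
  (Num.sqrt a + Num.sqrt b) / 2 <= Num.sqrt ((a + b) / 2).
Proof.
move=> a0 b0; have h0 : 0 <= (Num.sqrt a + Num.sqrt b) / 2.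
  by rewrite divr_ge0 ?addr_ge0 ?sqrtr_ge0.
rewrite -[leLHS](ger0_norm h0) -sqrtr_sqr ler_sqrt ?divr_ge0 ?addr_ge0 //.
rewrite -{2}(sqr_sqrtr a0) -{2}(sqr_sqrtr b0).
by have := sqr_ge0 (Num.sqrt a - Num.sqrt b); nra.
Qed.

(** Discrete Tanaka formula: the visits to [2 k] compensate the drift of [|r - 2 k|], and concavity
    of the square root ([sqrt_mid]) carries the other term through the induction on [n]. *)
Lemma green_const n r N :
  green n (fun=> 1) r N <= Num.sqrt ((r - 2 * k)%:~R ^+ 2 + n%:R) - `|r - 2 * k|%:~R.
Proof.
elim: n r N => [|n IH] r N.
  by rewrite /green big_ord0 addr0 sqrtr_sqr intr_norm subrr.
rewrite greenS mulr1.
apply: (le_trans (lerD (lexx _) (le_avg (fun b => IH _ _)))).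
rewrite avg_bool /dir_sign opprK.
set d := r - 2 * k.
have -> : r - 1 - 2 * k = d - 1 by rewrite /d; lia.
have -> : r + 1 - 2 * k = d + 1 by rewrite /d; lia.
have -> : (r == 2 * k)%:R = (d == 0)%:R :> R by congr ((_ : bool)%:R); rewrite /d; lia.
have hd : 2 * (d == 0)%:R - `|d - 1| - `|d + 1| = - (2 * `|d|) :> int.
  by case: eqVneq => [->|ne] //=; lia.
have {}hd : 2 * (d == 0)%:R - `|d - 1|%:~R - `|d + 1|%:~R = - (2 * `|d|%:~R) :> R.
  by have := congr1 (fun z : int => z%:~R : R) hd; case: (d == 0) => /=; rewrite !(rmorphB, rmorphN, rmorphM) /=.
have := @sqrt_mid ((d - 1)%:~R ^+ 2 + n%:R) ((d + 1)%:~R ^+ 2 + n%:R).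
rewrite !addr_ge0 ?sqr_ge0 ?ler0n // => /(_ isT isT).
have -> : ((d - 1)%:~R ^+ 2 + n%:R + ((d + 1)%:~R ^+ 2 + n%:R)) / 2 = d%:~R ^+ 2 + n.+1%:R :> R.
  by rewrite intrB intrD -[n.+1]addn1 natrD; move: (d%:~R) (n%:R) => x y; field.
move: (Num.sqrt _) (Num.sqrt _) (Num.sqrt _) hd => a b c hd h; lra.
Qed.

End Position.

Section OneDim.
Variables (R : realType) (F : zmodType) (u : F) (k : int).

Definition coord (r : int) (v : bool * bool) (x : F) : F :=
  if r == 0 then reflA v.1 x else if r == k then reflB u v.2 x else x.

Fixpoint crun (s : seq bool) (q : seq quad) (r : int) (x : F) : F :=
  match s, q with
  | b :: s', v :: q' => crun s' q' (r - dir_sign b) (coord (r - dir_sign b) v.2 (coord r v.1 x))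
  | _, _ => x
  end.

Definition pzero (s : seq bool) (r : int) (x : F) : R :=
  Ex (size s) (fun q => (crun s q r x == 0)%:R).

Lemma blaw_coord N r (psi : F -> R) :
  blaw u N (fun x => avg (fun v => psi (coord r v x))) = blaw u (alternate k r N) psi.
Proof.
have b0 : (0 < #|{: bool}|)%N by rewrite card_bool.
rewrite /coord /alternate; have [_|_] := eqVneq r 0.
  transitivity (blaw u N (fun x => avg (fun v => psi (reflA v x)))).
    congr (_ * _); apply: eq_bigr => i _; congr (_ * _); rewrite avg_prod.
    by apply: eq_avg => a; rewrite /= avg_const.
  case: (boolP (odd N)) => oN /=; rewrite ?addn1 ?addn0; first exact: blaw_reflA_odd.
  exact: blaw_reflA_even.
have [_|_] := eqVneq r k.
  transitivity (blaw u N (fun x => avg (fun v => psi (reflB u v x)))).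
    congr (_ * _); apply: eq_bigr => i _; congr (_ * _); rewrite avg_prod.
    by rewrite /= avg_const.
  case: (boolP (odd N)) => oN /=; rewrite ?addn1 ?addn0; first exact: blaw_reflB_odd.
  exact: blaw_reflB_even.
congr (_ * _); apply: eq_bigr => i _; congr (_ * _); rewrite avg_const //.
by rewrite card_prod card_bool.
Qed.

(** Given the path, only effective alternations matter: repeated reflections at one site leave the
    law unchanged, so its parameter follows [nrun]. *)
Lemma blaw_pzero s r N :
  blaw u N (pzero s r) = blaw u (nrun k s r N) (fun x => (x == 0)%:R).
Proof.
elim: s r N => [|b s IH] r N //=.
pose psi x := avg (fun v2 => pzero s (r - dir_sign b) (coord (r - dir_sign b) v2 x)).
transitivity (blaw u N (fun x => avg (fun v => psi (coord r v x)))).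
  by congr (_ * _); apply: eq_bigr => i _; congr (_ * _); exact: (@avg_prod R (bool * bool)%type (bool * bool)%type).
by rewrite blaw_coord blaw_coord IH.
Qed.

Lemma pzero_le s r M : (0 < M)%N -> order_ge u M ->
  pzero s r 0 <= bsup R M (nrun k s r 0).
Proof.
move=> M0 hu; have -> : pzero s r 0 = blaw u 0 (pzero s r).
  by rewrite /blaw /binsum expr0 invr1 big_ord1 bin0 !mul1r subr0 mulr0z.
by rewrite blaw_pzero; exact: blaw_point.
Qed.

End OneDim.

(** * Return probabilities of the base point *)

Section Return.
Variables (R : realType) (P : fibres) (j : nat).
Notation E := {ffun 'I_4 -> P j}.

Lemma stlamp_coord r (l : lamp) (s : E * bool) i :
  (stlamp (funit P j) (gap j) r l s).1 i =
  coord (funit P j) (gap j) r (l.1.1 i, l.1.2 i) (s.1 i).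
Proof.
rewrite /stlamp /coord; case: ifP => _; first by rewrite /= ffunE.
by case: ifP => _; [rewrite /= ffunE|case: ifP].
Qed.

Lemma ystep_coord z r (e : E) i :
  (ystep z (r, e)).2 i =
  coord (funit P j) (gap j) (r - dir_sign z.1.1) (z.1.2 i).2 (coord (funit P j) (gap j) r (z.1.2 i).1 (e i)).
Proof.
by rewrite /ystep /= !stlamp_coord /= !ffunE -!surjective_pairing.
Qed.

Lemma yrun_coord s r (e : E) :
  (yrun s (r, e)).1 = prun (map (fun z : rest => z.1.1) s) r /\
  forall i, (yrun s (r, e)).2 i =
    crun (funit P j) (gap j) (map (fun z : rest => z.1.1) s) (map (fun z : rest => z.1.2 i) s) r (e i).
Proof.
elim: s r e => [|z s IH] r e //=.
have [h1 h2] := IH (ystep z (r, e)).1 (ystep z (r, e)).2.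
split=> [|i]; first by rewrite -h1 -surjective_pairing.
by rewrite -ystep_coord -h2 -surjective_pairing.
Qed.

(** Given the path of the walker, the four coordinates use disjoint sets of bits, so they vanish
    independently. *)
Lemma return_prob_factor t r (e : E) :
  return_prob R t (r, e) = Ex t (fun s => (prun s r == 2 * gap j)%:R *
    \prod_i pzero R (funit P j) (gap j) s r (e i)).
Proof.
pose f (w : seq (bool * {ffun 'I_4 -> quad})) : R :=
  (prun (map fst w) r == 2 * gap j)%:R *
  \prod_i (crun (funit P j) (gap j) (map fst w) (map (fun z : bool * {ffun 'I_4 -> quad} => z.2 i) w) r (e i) == 0)%:R.
have b0 : (0 < #|{: bool}|)%N by rewrite card_bool.
transitivity (Ex t f).
  rewrite /return_prob (@Ex_prod R (bool * {ffun 'I_4 -> quad})%type bool) /=.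
  apply: eq_Ex => w hw; rewrite -[RHS](Ex_const t _ b0); apply: eq_Ex => c hc.
  have [h1 h2] := yrun_coord (zip w c) r e.
  have wc : map fst (zip w c) = w by rewrite -/unzip1 unzip1_zip // hw hc.
  have e1 : map (fun z : rest => z.1.1) (zip w c) = map fst w by rewrite -{2}wc -map_comp.
  have e2 i : map (fun z : rest => z.1.2 i) (zip w c) = map (fun z : bool * {ffun 'I_4 -> quad} => z.2 i) w.
    by rewrite -{2}wc -map_comp.
  rewrite /f -e1 -h1; rewrite (eq_bigr (fun i => ((yrun (zip w c) (r, e)).2 i == 0)%:R)); last first.
    by move=> i _; rewrite h2 e2 e1.
  rewrite [yrun _ _]surjective_pairing xpair_eqE mulr2n -mulr2n -[_ *+ 2]mulr_natl /=.
  move: (yrun _ _) => [r' e'] /=; case: (r' == _); rewrite ?mul0r ?mul1r //=.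
  have [->|ne] := eqVneq e' 0.
    by rewrite big1 // => i _; rewrite ffunE eqxx.
  have [i hi] : exists i, e' i != 0.
    apply/existsP; apply: contraR ne => /existsPn h; apply/eqP/ffunP => i.
    by rewrite ffunE; apply/eqP; move: (h i); rewrite negbK.
  by rewrite (bigD1 i) //= (negbTE hi) mul0r.
rewrite /f (@Ex_prod R bool {ffun 'I_4 -> quad}).
apply: eq_Ex => s hs.
rewrite (eq_Ex (g := fun q : seq {ffun 'I_4 -> quad} => (prun s r == 2 * gap j)%:R *
  \prod_i (fun i w => (crun (funit P j) (gap j) s w r (e i) == 0)%:R) i
     (map (fun g : {ffun 'I_4 -> quad} => g i) q))).
  rewrite ExZ (Ex_ffun _ (fun i w => (crun (funit P j) (gap j) s w r (e i) == 0)%:R)).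
  by congr (_ * _); apply: eq_bigr => i _; rewrite /pzero hs.
move=> q hq.
have e1 : map fst (zip s q) = s by rewrite -/unzip1 unzip1_zip // hs hq.
have e2 : map snd (zip s q) = q by rewrite -/unzip2 unzip2_zip // hs hq.
rewrite e1; congr (_ * _); apply: eq_bigr => i _.
by rewrite -{2}e2 -map_comp.
Qed.

(** The fourth power of the one-coordinate bound splits in two: the [phi] part is summed by the
    Lyapunov function, equal to [2 k] at the start, and the constant part [M ^- 4] by the expected
    number of visits of a walk on [Z], at most [sqrt n]. *)
Lemma green_bound n M : (0 < M)%N -> order_ge (funit P j) M ->
  \sum_(t < n) return_prob R t (base P j) <= 32 * (gap j)%:~R + 8 * (Num.sqrt n%:R / M%:R ^+ 4).
Proof.
move=> M0 hu; have k0 := gap_gt0 j.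
apply: (@le_trans _ _ (\sum_(t < n) Ex t (fun s => 16 * ((prun s (gap j *+ 2) == 2 * gap j)%:R *
    phi R (nrun (gap j) s (gap j *+ 2) 0)) + 8 * M%:R ^- 4 * ((prun s (gap j *+ 2) == 2 * gap j)%:R * 1)))).
  apply: ler_sum => t _; rewrite return_prob_factor; apply: le_Ex => s _.
  set b := (_ == _)%:R; set N := nrun _ _ _ _.
  have b0 : 0 <= b by rewrite /b ler0n.
  have -> : 16 * (b * phi R N) + 8 * M%:R ^- 4 * (b * 1) = b * (8 * (M%:R ^- 4 + 2 * phi R N)).
    by rewrite mulr1; ring.
  rewrite ler_wpM2l //.
  apply: (@le_trans _ _ (bsup R M N ^+ 4)).
    rewrite -[leRHS](_ : \prod_(i < 4) bsup R M N = _); last first.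
      by rewrite prodr_const card_ord.
    apply: ler_prod => i _; rewrite ffunE pzero_le // andbT.
    by apply: Ex_ge0 => [|w _]; rewrite ?ler0n ?card_prod ?card_bool.
  apply: le_trans (bsup_pow4 R M N) _.
  rewrite ler_wpM2l // lerD2l /phi.
  have e2 : N.+2%:R = N.+1%:R + 1 :> R by rewrite natr1.
  have -> : N.+1%:R^-1 - N.+2%:R^-1 = (N.+1%:R * N.+2%:R)^-1 :> R.
    rewrite e2; have : (0 : R) < N.+1%:R by rewrite ltr0n.
    by move: (N.+1%:R) => x x0; field; apply/andP; split; apply: lt0r_neq0; lra.
  rewrite -[2]invrK -invfM lef_pV2 ?posrE ?exprn_gt0 ?mulr_gt0 ?invr_gt0 ?ltr0n //.
  rewrite e2; have : (1 : R) <= N.+1%:R by rewrite ler1n.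
  by move: (N.+1%:R) => x x1; nra.
under eq_bigr => t _ do rewrite ExD ExZ (ExZ _ (8 * _)).
rewrite big_split /= -!mulr_sumr; apply: lerD.
  apply: (@le_trans _ _ (16 * lyap R (gap j) (gap j *+ 2) 0)).
    by rewrite ler_wpM2l //; exact: (@green_phi R (gap j) k0 n).
  rewrite /lyap /phi /dist_phase /= (_ : 2 * Num.min _ _ = 2 * gap j); last by lia.
  by rewrite intrM; move: (gap j)%:~R => x; lra.
have := @green_const R (gap j) k0 n (gap j *+ 2) 0.
rewrite /green (_ : gap j *+ 2 - 2 * gap j = 0) ?normr0 ?expr0n ?add0r ?subr0; last by lia.
move=> h; rewrite -mulrA ler_wpM2l // mulrC ler_wpM2r // invr_ge0 exprn_ge0 //.
Qed.

End Return.

(** * Coarse words *)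

Fixpoint hist (w : seq letter) (p : int) : seq (int * lamp) :=
  match w with
  | [::] => [::]
  | inl b :: w' => hist w' (p + dir_sign b)
  | inr x :: w' => (p, x) :: hist w' p
  end.

Fixpoint pos (w : seq letter) (p : int) : int :=
  match w with
  | [::] => p
  | inl b :: w' => pos w' (p + dir_sign b)
  | inr x :: w' => pos w' p
  end.

Definition net (H : seq (int * lamp)) (i : int) : lamp := \sum_(h <- H | h.1 == i) h.2.

Definition sites_in (lo hi : int) (H : seq (int * lamp)) : bool :=
  all (fun h => lo <= h.1 <= hi) H.

Lemma hist_cat w w' p : hist (w ++ w') p = hist w p ++ hist w' (pos w p).
Proof. by elim: w p => [|[b|x] w IH] p //=; rewrite IH. Qed.

Lemma pos_cat w w' p : pos (w ++ w') p = pos w' (pos w p).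
Proof. by elim: w p => [|[b|x] w IH] p //=; rewrite IH. Qed.

Lemma pos_shift w p q : pos w (p + q) = pos w p + q.
Proof. by elim: w p => [|[b|x] w IH] p //=; rewrite -IH addrAC. Qed.

Lemma hist_shift w p q : hist w (p + q) = map (fun h => (h.1 + q, h.2)) (hist w p).
Proof. by elim: w p => [|[b|x] w IH] p //=; rewrite -IH // addrAC. Qed.

Lemma net_cat H H' i : net (H ++ H') i = net H i + net H' i.
Proof. by rewrite /net big_cat. Qed.

Lemma net_out lo hi H i : sites_in lo hi H -> ~~ (lo <= i <= hi) -> net H i = 0.
Proof.
move=> /allP hH ni; rewrite /net big_seq_cond big1 // => h /andP[hin /eqP e].
by move: (hH h hin); rewrite e (negbTE ni).
Qed.

Lemma sites_in_cat lo hi H H' : sites_in lo hi (H ++ H') = sites_in lo hi H && sites_in lo hi H'.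
Proof. exact: all_cat. Qed.

Lemma sites_in_sub lo hi lo' hi' H :
  lo' <= lo -> hi <= hi' -> sites_in lo hi H -> sites_in lo' hi' H.
Proof. by move=> l h; apply: sub_all => x; lia. Qed.

Section Act.
Variables (P : fibres) (j : nat).
Notation E := {ffun 'I_4 -> P j}.

Definition hact (z : int) (H : seq (int * lamp)) (s : E * bool) : E * bool :=
  foldl (fun s h => stlamp (funit P j) (gap j) (z - h.1) h.2 s) s H.

Lemma hact_cat z H H' s : hact z (H ++ H') s = hact z H' (hact z H s).
Proof. exact: foldl_cat. Qed.

Lemma hact_shift z q H s :
  hact z (map (fun h => (h.1 + q, h.2)) H) s = hact (z - q) H s.
Proof.
elim: H s => [|h H IH] s //=; rewrite IH; congr (hact _ _ (stlamp _ _ _ _ _)).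
by rewrite opprD addrA addrAC.
Qed.

Lemma run_hist w p z s :
  run w (z - p, s) = (z - pos w p, hact z (hist w p) s) :> state P j.
Proof.
elim: w p s => [|[b|x] w IH] p s //=.
by rewrite -addrA -opprD IH.
Qed.

Definition touches (z i : int) : bool :=
  [|| z - i == 0, z - i == gap j | z - i == gap j *+ 2].

Lemma stlamp_far z i x s : ~~ touches z i -> stlamp (funit P j) (gap j) (z - i) x s = s.
Proof.
by rewrite /touches /stlamp !negb_or => /and3P[/negbTE-> /negbTE-> /negbTE->].
Qed.

Lemma hact_single z i0 H s :
  (forall h, h \in H -> touches z h.1 -> h.1 = i0) ->
  hact z H s = stlamp (funit P j) (gap j) (z - i0) (net H i0) s.
Proof.
elim: H s => [|[i x] H IH] s hH; first by rewrite /net big_nil stlamp0.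
rewrite /= IH => [|h hin]; last by apply: hH; rewrite inE hin orbT.
rewrite /net big_cons /=; case: eqVneq => [->|ne].
  by rewrite stlampD [x + _]addrC.
rewrite (@stlamp_far z i); first by [].
apply/negP => t; case/eqP: ne.
by apply: (hH (i, x)); rewrite ?inE ?eqxx.
Qed.

Lemma hact_untouched z H s : (forall h, h \in H -> ~~ touches z h.1) -> hact z H s = s.
Proof.
move=> hH; rewrite (hact_single (i0 := 0)).
  have [t|/stlamp_far //] := boolP (touches z 0).
  rewrite /net big_seq_cond big1 ?stlamp0 // => h /andP[hin /eqP e].
  by move: (hH h hin); rewrite e t.
by move=> h hin t; move: (hH h hin); rewrite t.
Qed.

Lemma touches_close z i i' : touches z i -> touches z i' -> `|i - i'| < gap j -> i = i'.
Proof. by have := gap_gt0 j; rewrite /touches; lia. Qed.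

(** The sites that touch a given fibre are [gap j] apart, so a shorter window contains at most one
    of them, and the lamps switched at one site add up. *)
Lemma hact_net z lo hi H H' s :
  hi - lo < gap j -> sites_in lo hi H -> sites_in lo hi H' -> net H =1 net H' ->
  hact z H s = hact z H' s.
Proof.
move=> hk /allP hH /allP hH' hn.
have close h h' : h \in H ++ H' -> h' \in H ++ H' -> touches z h.1 -> touches z h'.1 -> h.1 = h'.1.
  have b g : g \in H ++ H' -> lo <= g.1 <= hi.
    by rewrite mem_cat => /orP[/hH|/hH'].
  move=> /b bh /b bh' t t'; apply: (touches_close t t'); lia.
case: (boolP (has (fun h => touches z h.1) (H ++ H'))) => [/hasP[h0 in0 t0]|/hasPn no].
  rewrite (hact_single (i0 := h0.1)) => [|h hin t]; last first.
    by apply: close => //; rewrite mem_cat hin.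
  rewrite (hact_single (i0 := h0.1)) ?hn // => h hin t.
  by apply: close => //; rewrite mem_cat hin orbT.
rewrite !hact_untouched // => h hin; apply: no; by rewrite mem_cat hin ?orbT.
Qed.

End Act.

Lemma ev_hist P w w' : pos w 0 = pos w' 0 ->
  (forall j z s, @hact P j z (hist w 0) s = hact z (hist w' 0) s) -> ev P w = ev P w'.
Proof.
move=> hp width; apply: ev_eq => j [z s]; rewrite -[z]subr0.
by rewrite !run_hist hp width.
Qed.

Definition move_word (d : int) : seq letter := nseq `|d|%N (inl (0 <= d)).

Lemma pos_nseq n b p : pos (nseq n (inl b)) p = p + dir_sign b * n%:Z.
Proof. elim: n p => [|n IH] p /=; first by rewrite mulr0 addr0. rewrite IH; lia. Qed.
Lemma pos_move_word d p : pos (move_word d) p = p + d.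
Proof. by rewrite /move_word pos_nseq /dir_sign; case: ifP; lia. Qed.
Lemma hist_move_word d p : hist (move_word d) p = [::].
Proof. by rewrite /move_word; elim: `|d|%N p => //=. Qed.
Lemma size_move_word d : size (move_word d) = `|d|%N.
Proof. by rewrite size_nseq. Qed.

Fixpoint sweep (L : int -> lamp) (n : nat) (p : int) : seq letter :=
  if n is n'.+1 then inr (L p) :: inl true :: sweep L n' (p + 1) else [::].

Lemma size_sweep L n p : size (sweep L n p) = n.*2.
Proof. by elim: n p => [|n IH] p //=; rewrite IH. Qed.
Lemma pos_sweep L n p : pos (sweep L n p) p = p + n%:Z.
Proof. elim: n p => [|n IH] p /=; first by rewrite addr0. rewrite IH; lia. Qed.
Lemma hist_sweep L n p : hist (sweep L n p) p = [seq (p + i%:Z, L (p + i%:Z)) | i <- iota 0 n].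
Proof.
elim: n p => [|n IH] p //=; rewrite addr0 IH; congr cons.
rewrite (iotaDl 1 0) -map_comp; apply: eq_map => i /=.
by rewrite -addrA.
Qed.
Lemma sites_sweep L n p : sites_in p (p + n%:Z - 1) (hist (sweep L n p) p).
Proof.
rewrite hist_sweep; apply/allP => h /mapP[i]; rewrite mem_iota => hi -> /=; lia.
Qed.
Lemma net_sweep L n p i : net (hist (sweep L n p) p) i = if p <= i < p + n%:Z then L i else 0.
Proof.
rewrite hist_sweep /net big_map /= -[n in iota 0 n]subn0 -/(index_iota 0 n) big_mkord.
case: ifPn => [hi|hi].
  have lt : (`|i - p|%N < n)%N by lia.
  rewrite (big_pred1 (Ordinal lt)) => [|m]; first by congr L; rewrite /=; lia.
  rewrite /= -val_eqE /=; apply/eqP/eqP; lia.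
by rewrite big1 // => m /eqP e; have := ltn_ord m; lia.
Qed.

Lemma segment w p (h : nat) : (0 < h)%N ->
  sites_in (p - h%:Z) (p + h%:Z) (hist w p) -> `|pos w p - p| <= h%:Z ->
  exists w', [/\ pos w' p = pos w p, net (hist w' p) =1 net (hist w p),
    sites_in (p - h%:Z) (p + h%:Z) (hist w' p) & (size w' <= 10 * h)%N].
Proof.
move=> h0 hs hp; pose q := p - h%:Z.
pose S := sweep (net (hist w p)) h.*2.+1 q.
(* Walk to the left end, sweep the [2 h + 1] sites with the net lamps, walk to the final position:
   at most [7 h + 3 <= 10 h] letters. *)
exists (move_word (- h%:Z) ++ S ++ move_word (pos w p - (q + h.*2.+1%:Z))).
have E : hist (move_word (- h%:Z) ++ S ++ move_word (pos w p - (q + h.*2.+1%:Z))) p = hist S q.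
  by rewrite hist_cat hist_move_word pos_move_word hist_cat hist_move_word cats0.
rewrite E; split.
- by rewrite !pos_cat !pos_move_word -/q pos_sweep; lia.
- move=> i; rewrite net_sweep; case: ifPn => // hi.
  by rewrite (net_out hs) //; lia.
- by apply: sites_in_sub (sites_sweep _ _ _); rewrite /q; lia.
- by rewrite !size_cat !size_move_word size_sweep /q; lia.
Qed.

(** [d] is the displacement since the last cut; a cut is made when it reaches [h] in absolute
    value. *)
Fixpoint moves (h : nat) (w : seq letter) (d : int) : nat :=
  match w with
  | [::] => 0
  | inl b :: w' => if h%:Z <= `|d + dir_sign b| then (moves h w' 0).+1 else moves h w' (d + dir_sign b)
  | inr x :: w' => moves h w' d
  end.

Fixpoint within (lo hi : int) (w : seq letter) (p : int) : bool :=
  (lo <= p <= hi) &&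
  match w with
  | [::] => true
  | inl b :: w' => within lo hi w' (p + dir_sign b)
  | inr x :: w' => within lo hi w' p
  end.

Lemma within_sub lo hi lo' hi' w p :
  lo' <= lo -> hi <= hi' -> within lo hi w p -> within lo' hi' w p.
Proof.
move=> l h; elim: w p => [|[b|x] w IH] p /= /andP[hp hw]; apply/andP; split; rewrite ?IH //; lia.
Qed.

Lemma within_head lo hi w p : within lo hi w p -> lo <= p <= hi.
Proof. by case: w => [|[b|x] w] /= /andP[]. Qed.

Lemma within_sites lo hi w p : within lo hi w p -> sites_in lo hi (hist w p).
Proof. by elim: w p => [|[b|x] w IH] p //= /andP[hp hw]; rewrite ?hp /= IH. Qed.

Lemma moves_within h w a q : (0 < h)%N -> `|q - a| < h%:Z ->
  within (a - h%:Z * (moves h w (q - a)).+1%:Z) (a + h%:Z * (moves h w (q - a)).+1%:Z) w q.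
Proof.
move=> h0; elim: w a q => [|[b|x] w IH] a q hq /=.
- by rewrite andbT; lia.
- have -> : q - a + dir_sign b = (q + dir_sign b) - a by lia.
  case: ifPn => hc.
    apply/andP; split; first by nia.
    have := IH (q + dir_sign b) (q + dir_sign b); rewrite subrr normr0 => /(_ ltac:(lia)).
    apply: within_sub; move: (moves _ _ _) => N; rewrite /dir_sign in hc *; case: b hc; nia.
  apply/andP; split; first by move: (moves _ _ _) => N; nia.
  by apply: IH; lia.
- by apply/andP; split; [move: (moves _ _ _) => N; nia|exact: IH].
Qed.

Definition agree_above P (h : nat) (H H' : seq (int * lamp)) : Prop :=
  forall j, h.*2%:Z < gap j -> forall z s, @hact P j z H s = hact z H' s.

(* Between two consecutive displacements by [h] only the net effect of the
   letters matters to the scales [k_j > 2 h]. *)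
Lemma coarse P (h : nat) lo hi w w0 p : (0 < h)%N -> lo <= p <= hi ->
  sites_in (p - h%:Z) (p + h%:Z) (hist w0 p) -> `|pos w0 p - p| < h%:Z ->
  within lo hi w (pos w0 p) ->
  exists w', [/\ pos w' p = pos (w0 ++ w) p, net (hist w' p) =1 net (hist (w0 ++ w) p),
    agree_above P h (hist w' p) (hist (w0 ++ w) p),
    sites_in (lo - h%:Z) (hi + h%:Z) (hist w' p) &
    (size w' <= 10 * h * (moves h w (pos w0 p - p)).+1)%N].
Proof.
(* [w0] collects the letters since the last cut, all within [h] of [p]; at a cut it is replaced by a
   short sweep and the induction restarts with an empty [w0]. *)
move=> h0; elim: w w0 p => [|[b|x] w IH] w0 p hp hs hd hw.
- have [w' [e1 e2 e3 e4]] := segment h0 hs (ltW hd).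
  exists w'; rewrite cats0; split=> //; last by rewrite muln1.
    move=> j hj z s; apply: (hact_net _ _ _ e3 hs) => //; lia.
  by apply: sites_in_sub e3; lia.
- pose w1 := w0 ++ [:: inl b].
  have p1 : pos w1 p = pos w0 p + dir_sign b by rewrite pos_cat.
  have s1 : sites_in (p - h%:Z) (p + h%:Z) (hist w1 p) by rewrite hist_cat cats0.
  have cat1 : w0 ++ inl b :: w = w1 ++ w by rewrite -catA.
  move: hw => /= /andP[_ hw]; rewrite cat1.
  clearbody w1.
  have -> : pos w0 p - p + dir_sign b = pos w1 p - p by rewrite p1 addrAC.
  case: ifPn => hc; last by apply: IH => //; rewrite ?p1 //; lia.
  have le1 : `|pos w1 p - p| <= h%:Z by rewrite p1 /dir_sign; case: (b); lia.
  have [w' [e1 e2 e3 e4]] := segment h0 s1 le1.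
  have := IH [::] (pos w1 p); rewrite /= subrr normr0.
  move=> /(_ _ _ _ _)[|//|||w2 [f1 f2 f3 f4 f5]]; rewrite ?p1 //.
    exact: within_head hw.
  exists (w' ++ w2); split.
  + by rewrite !pos_cat e1 f1.
  + by move=> i; rewrite !hist_cat !net_cat e1 e2 f2.
  + move=> j hj z s; rewrite !hist_cat !hact_cat e1 f3 //; congr hact.
    by apply: (hact_net _ _ _ e3 s1) => //; lia.
  + rewrite hist_cat sites_in_cat e1 f4 andbT.
    by apply: sites_in_sub e3; lia.
  + by rewrite size_cat mulnS leq_add.
- have cat1 : w0 ++ inr x :: w = (w0 ++ [:: inr x]) ++ w by rewrite -catA.
  move: hw => /= /andP[_ hw]; rewrite cat1.
  have p1 : pos (w0 ++ [:: inr x]) p = pos w0 p by rewrite pos_cat.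
  rewrite -p1; apply: IH; rewrite ?p1 //.
  rewrite hist_cat sites_in_cat hs /= andbT; lia.
Qed.

Section Moves.
Variable R : realType.

Lemma avg_incr (f : bool -> R) : avg (fun x : incr => f x.2.1.1) = avg f.
Proof.
have b0 : (0 < #|{: bool}|)%N by rewrite card_bool.
have q0 : (0 < #|{: {ffun 'I_4 -> quad}}|)%N.
  by apply/card_gt0P; exists [ffun=> ((true, true), (true, true))].
rewrite (@avg_prod R bool rest) /= avg_const // (@avg_prod R (bool * {ffun 'I_4 -> quad})%type bool).
rewrite (@avg_prod R bool {ffun 'I_4 -> quad}); apply: eq_avg => b /=.
by rewrite avg_const // avg_const.
Qed.

Definition words (s : seq incr) : seq letter := flatten (map iword s).

Lemma moves_words h x s d : moves h (words (x :: s)) d =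
  if h%:Z <= `|d + dir_sign x.2.1.1| then (moves h (words s) 0).+1
  else moves h (words s) (d + dir_sign x.2.1.1).
Proof. by []. Qed.

(** The square of a simple random walk grows by 1 per step on average, and each counted move resets
    a square of at least [h ^ 2] to zero. *)
Lemma moves_expected h n (d : int) :
  h%:R ^+ 2 * Ex n (fun s => (moves h (words s) d)%:R) <= n%:R + d%:~R ^+ 2 :> R.
Proof.
elim: n d => [|n IH] d; first by rewrite mulr0 add0r sqr_ge0.
pose f b : R := if h%:Z <= `|d + dir_sign b| then 1 + Ex n (fun s => (moves h (words s) 0)%:R)
   else Ex n (fun s => (moves h (words s) (d + dir_sign b))%:R).
rewrite [Ex _ _]/= (eq_avg (g := fun x : incr => f x.2.1.1)); last first.
  move=> x; rewrite /f; case: ifPn => hc.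
    rewrite -[X in X + _](Ex_const n 1 incr_gt0) -ExD; apply: eq_Ex => s _.
    by transitivity ((moves h (words (x :: s)) d)%:R : R); rewrite // moves_words hc -natr1 addrC.
  by apply: eq_Ex => s _; transitivity ((moves h (words (x :: s)) d)%:R : R); rewrite // moves_words (negbTE hc).
rewrite avg_incr -avgZ.
apply: (@le_trans _ _ (avg (fun b => n%:R + (d + dir_sign b)%:~R ^+ 2))).
  apply: le_avg => b; rewrite /f; case: ifPn => hc; last exact: IH.
  rewrite mulrDr mulr1 addrC; apply: lerD.
    by apply: le_trans (IH 0) _; rewrite expr0n addr0.
  have : h%:R <= `|d + dir_sign b|%:~R :> R by rewrite -(ler_int R) in hc.
  rewrite intr_norm => h1; rewrite -[leRHS]real_normK ?num_real //.
  by rewrite lerXn2r // ?nnegrE ?ler0n ?normr_ge0.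
rewrite avg_bool /dir_sign !intrD mulrN1z -[n.+1]addn1 natrD.
by move: (n%:R) (d%:~R) => x y; rewrite le_eqVlt; apply/orP; left; apply/eqP; field.
Qed.

Lemma moves_scaled h n : (0 < h)%N ->
  h%:R * Ex n (fun s => (moves h (words s) 0).+1%:R) <= n%:R / h%:R + h%:R :> R.
Proof.
move=> h0; have hp : (0 : R) < h%:R by rewrite ltr0n.
rewrite (eq_Ex (g := fun s => (moves h (words s) 0)%:R + 1)); last first.
  by move=> s _; rewrite -natr1.
rewrite ExD Ex_const ?incr_gt0 // mulrDr mulr1 lerD2r ler_pdivlMr // mulrAC -expr2.
by have := moves_expected h n 0; rewrite expr0n addr0.
Qed.

End Moves.

(** * Words on one fibre *)

Definition lamp_sum (w : seq lamp) : lamp := \sum_(l <- w) l.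

Lemma lamp_sum_cat w w' : lamp_sum (w ++ w') = lamp_sum w + lamp_sum w'.
Proof. exact: big_cat. Qed.
Lemma lamp_sum_cons l w : lamp_sum (l :: w) = l + lamp_sum w.
Proof. exact: big_cons. Qed.
Lemma lamp_sum_nseq n l : lamp_sum (nseq n l) = l *+ n.
Proof. by elim: n => [|n IH] /=; rewrite /lamp_sum ?big_nil // big_cons mulrS -IH. Qed.

Lemma lamp_mul2n (l : lamp) n : l *+ n.*2 = 0.
Proof. by rewrite -mul2n mulrnA mulr2n lampDD mul0rn. Qed.

Lemma ffun_addbb (v : {ffun 'I_4 -> bool}) : v + v = 0.
Proof. by apply/ffunP => i; rewrite !ffunE; case: (v i). Qed.

Section Local.
Variables (F : zmodType) (u : F).
Notation E := {ffun 'I_4 -> F}.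

(** On a single fibre a lamp acts here through all three parts at once; a switch made at one site
    has at most one nonzero part ([mask]). *)
Definition lstep (s : E * bool) (l : lamp) : E * bool :=
  stA l.1.1 (stB u l.1.2 (stC l.2 s)).
Definition lact (w : seq lamp) (s : E * bool) : E * bool := foldl lstep s w.

Lemma lact_cat w w' s : lact (w ++ w') s = lact w' (lact w s).
Proof. exact: foldl_cat. Qed.

Lemma lact0 n s : lact (nseq n 0) s = s.
Proof. by elim: n => [|n IH] //=; rewrite /lstep stC0 stB0 stA0. Qed.

Lemma lact_trivial w s : (forall x y : F, x = y) -> lamp_sum w = 0 -> lact w s = s.
Proof.
move=> triv t0.
have gen w0 s0 : lact w0 s0 = (s0.1, s0.2 + (lamp_sum w0).2).
  elim: w0 s0 => [|l w0 IH] [e b] /=; first by rewrite /lamp_sum big_nil addr0.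
  rewrite IH lamp_sum_cons /=; congr (_, _); first by apply/ffunP => i; exact: triv.
  rewrite addrA; congr (_ + _ + _).
  by rewrite (_ : e == 0) ?andbT //; apply/eqP/ffunP => i; exact: triv.
by rewrite gen t0 addr0; case: s.
Qed.

Lemma reflA_aff v w (y : F) n :
  reflA v (reflA w y + u *~ n) = reflA (v + w) y + u *~ (if v then - n else n).
Proof. by case: v => //=; rewrite opprD mulrNz; case: w => //=; rewrite opprK. Qed.

Lemma reflB_aff v w (y : F) n :
  reflB u v (reflA w y + u *~ n) = reflA (v + w) y + u *~ (if v then 1 - n else n).
Proof.
case: v => //=; rewrite opprD mulrzBr mulr1z.
by rewrite addrCA; case: w => //=; rewrite opprK.
Qed.

Lemma lact_base w (i : 'I_4) : exists q : int, forall s,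
  (lact w s).1 i = reflA ((lamp_sum w).1.1 i + (lamp_sum w).1.2 i) (s.1 i) +
    u *~ (q * 2 + ((lamp_sum w).1.2 i : nat)%:Z).
Proof.
elim/last_ind: w => [|w l [q IH]].
  by exists 0 => s; rewrite /lamp_sum big_nil !ffunE /= mulr0z addr0.
rewrite -cats1 lamp_sum_cat {2 4 6}/lamp_sum big_seq1 /= !ffunE.
set a := (lamp_sum w).1.1 i in IH *; set b := (lamp_sum w).1.2 i in IH *.
exists (let m := if l.1.2 i then (if b then - q else - q) else q in
        if l.1.1 i then (if l.1.2 i + b then - m - 1 else - m) else m) => s.
rewrite lact_cat /= !ffunE IH reflB_aff reflA_aff; congr (reflA _ _ + _ *~ _).
  by case: (l.1.1 i); case: (l.1.2 i); case: a {IH}; case: b.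
by case: (l.1.1 i); case: (l.1.2 i); case: b {IH} => /=; lia.
Qed.

Lemma lact_snd w e b : (lact w (e, b)).1 = (lact w (e, false)).1 /\
  (lact w (e, b)).2 = b + (lact w (e, false)).2.
Proof.
elim/last_ind: w => [|w l [h1 h2]]; first by rewrite /= addr0.
by rewrite -cats1 !lact_cat /= h1 h2 addrA.
Qed.

End Local.

(** * Short words on a finite torus *)

Section Finite.
Variables (F : finZmodType) (u : F) (M : nat).
Hypotheses (M0 : (0 < M)%N) (Mu : u *+ M = 0) (Meven : ~~ odd M).
Hypothesis gen : forall x : F, exists m : 'I_M, x = u *+ m.
Hypothesis uniq_gen : order_ge u M.
Notation E := {ffun 'I_4 -> F}.

(** Each [c] letter flips the bit over exactly one point and the reflections permute the points, so
    the parity of the flips is that of the [c] letters. *)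
Lemma sum_flip w : \sum_(e : E) (lact u w (e, false)).2 = (lamp_sum w).2.
Proof.
elim: w => [|l w IH] /=.
  by rewrite /lamp_sum big_nil big1.
have ss s : lact u w s = ((lact u w (s.1, false)).1, s.2 + (lact u w (s.1, false)).2).
  by have [h1 h2] := lact_snd u w s.1 s.2; rewrite -h1 -h2 -!surjective_pairing.
under eq_bigr => e _ do rewrite ss /=.
rewrite big_split /= lamp_sum_cons /= -IH; congr (_ + _).
  rewrite (bigD1 (0 : E)) //= eqxx andbT big1 ?addr0 ?add0r // => e /negbTE ->.
  by rewrite andbF addr0.
rewrite [RHS](reindex_inj (h := fun e => actA l.1.1 (actB u l.1.2 e))) //= => e e' h.
have := congr1 (actB u l.1.2) (congr1 (actA l.1.1) h).
by rewrite !actAD !ffun_addbb !actA0 !actBD !ffun_addbb !actB0.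
Qed.

(** The two reflections in coordinate [i] compose to the translation by [- u]. *)
Definition turn (i : 'I_4) : lamp := ([ffun i' => i' == i], [ffun i' => i' == i], false).
Definition shift (i : 'I_4) (t : nat) (e : E) : E :=
  [ffun i' => if i' == i then e i' - u *+ t else e i'].

Lemma shiftD i t t' e : shift i t (shift i t' e) = shift i (t' + t) e.
Proof.
apply/ffunP => i'; rewrite !ffunE; case: eqP => // _.
by rewrite mulrnDr opprD addrA.
Qed.

Lemma shift0 i e : shift i 0 e = e.
Proof. by apply/ffunP => i'; rewrite !ffunE mulr0n subr0; case: eqP. Qed.

Lemma shiftM i e : shift i M e = e.
Proof. by apply/ffunP => i'; rewrite !ffunE Mu subr0; case: eqP. Qed.

Lemma lstep_turn i e b : lstep u (e, b) (turn i) = (shift i 1 e, b).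
Proof.
rewrite /lstep /stA /stB /stC /= addr0; congr (_, _).
by apply/ffunP => i'; rewrite !ffunE; case: eqP => //= _; rewrite mulr1n opprB.
Qed.

Lemma lact_turns i t e b : lact u (nseq t (turn i)) (e, b) = (shift i t e, b).
Proof.
elim: t e => [|t IH] e /=; first by rewrite shift0.
by rewrite lstep_turn IH shiftD add1n.
Qed.

(** The turns come in even numbers so that the lamp sum vanishes, as is needed for the word to be
    invisible at the other scales. *)
Lemma translation_word (t : 'I_4 -> nat) : exists w, [/\
  forall e b, lact u w (e, b) = ([ffun i => e i - u *+ (t i).*2], b),
  lamp_sum w = 0 & (size w = \sum_i (t i).*2)%N].
Proof.
pose wr (r : seq 'I_4) := flatten [seq nseq (t i).*2 (turn i) | i <- r].
exists (wr (enum 'I_4)); split.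
- move=> e b.
  have gen_r r : uniq r -> forall e b, lact u (wr r) (e, b) =
      ([ffun i => if i \in r then e i - u *+ (t i).*2 else e i], b).
    elim: r => [|i r IH] /=.
      by move=> _ e0 b0; congr (_, _); apply/ffunP => i; rewrite ffunE.
    move=> /andP[ir ur] e0 b0; rewrite /wr /= lact_cat lact_turns IH //; congr (_, _).
    apply/ffunP => i'; rewrite !ffunE inE; have [->|_] //= := eqVneq i' i.
    by rewrite (negbTE ir).
  rewrite gen_r ?enum_uniq //; congr (_, _); apply/ffunP => i.
  by rewrite !ffunE mem_enum.
- rewrite /wr; elim: (enum _) => [|i r IH] /=; first by rewrite /lamp_sum big_nil.
  by rewrite lamp_sum_cat IH lamp_sum_nseq lamp_mul2n addr0.
- rewrite /wr size_flatten /shape -map_comp sumnE big_map big_enum /=.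
  by apply: eq_bigr => i _; rewrite /= size_nseq.
Qed.

Fixpoint tour_size (c : nat) : nat := if c is c'.+1 then (M * (tour_size c').+1)%N else 1.

Lemma gen_mod (x : F) : exists2 m : 'I_M, x = u *+ m & forall m' : 'I_M, (x == u *+ m') = (m' == m).
Proof.
have [m ->] := gen x; exists m => // m'; apply/eqP/eqP => [|->] //.
wlog le : m m' / (m <= m')%N.
  move=> W; case: (leqP m m') => [|/ltnW] le e; first exact: W.
  by apply/esym/W.
move=> e; apply/val_inj/eqP; rewrite /= eqn_leq le andbT leqNgt; apply/negP => lt.
have /negP[] : u *+ (m' - m) != 0 by apply: uniq_gen; have := ltn_ord m'; lia.
by rewrite mulrnBr // e subrr.
Qed.

(* An odometer: the fibre is a torus, and winding around it coordinate by
   coordinate brings each of its points to the origin exactly once. *)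
Lemma flip_word (r : seq 'I_4) (phi : E -> bool) : uniq r ->
  (forall e, phi e -> forall i, i \notin r -> e i = 0) ->
  exists w, [/\ forall e b, lact u w (e, b) = (e, b + phi e),
    lamp_sum w = (0, 0, \sum_e phi e) & (size w <= tour_size (size r))%N].
Proof.
elim: r phi => [|i r IH] phi /=.
  move=> _ hphi; exists [:: (0, 0, phi 0)].
  have phiE e : phi e = phi 0 && (e == 0).
    have [->|ne] := eqVneq e 0; first by rewrite andbT.
    rewrite andbF; apply/negP => pe; case/eqP: ne; apply/ffunP => i.
    by rewrite ffunE; apply: hphi.
  split=> // [e b|].
    by rewrite /= /lstep stA0 stB0 /stC /= -phiE.
  rewrite /lamp_sum big_seq1; congr (_, _, _).
  rewrite (bigD1 (0 : E)) //= big1 ?addr0 // => e /negbTE ne.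
  by rewrite phiE ne andbF.
move=> /andP[ir ur] hphi.
(* Slices of [phi] along coordinate [i]: [pm m] is the part with [i]-th coordinate [u *+ m], seen
   after [m] turns have brought that coordinate to 0. *)
pose back m (e : E) : E := [ffun i' => if i' == i then e i' + u *+ m else e i'].
pose pm m (e : E) := phi (back m e) && (e i == 0).
have hm m : exists w, [/\ forall e b, lact u w (e, b) = (e, b + pm m e),
    lamp_sum w = (0, 0, \sum_(e : E) pm m e) & (size w <= tour_size (size r))%N].
  apply: IH => // e /andP[pe /eqP ei] i' i'r.
  have [->//|ne] := eqVneq i' i.
  have := hphi _ pe i'; rewrite inE negb_or ne i'r => /(_ isT).
  by rewrite ffunE (negbTE ne).
have [W hW] := choice hm.
pose T n := flatten [seq W m ++ [:: turn i] | m <- iota 0 n].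
have backK m e : back m (shift i m e) = e.
  by apply/ffunP => i'; rewrite !ffunE; case: eqP => // _; rewrite subrK.
have hT n : [/\ forall e b, lact u (T n) (e, b) = (shift i n e, b + \sum_(m < n) (phi e && (e i == u *+ m))),
    lamp_sum (T n) = turn i *+ n + (0, 0, \sum_(m < n) \sum_(e : E) pm m e) &
    (size (T n) <= n * (tour_size (size r)).+1)%N].
  elim: n => [|n [h1 h2 h3]].
    split=> [e b||] //=; first by rewrite shift0 big_ord0 addr0.
    by rewrite big_ord0 mulr0n add0r /lamp_sum big_nil.
  have TS : T n.+1 = T n ++ (W n ++ [:: turn i]).
    by rewrite /T -addn1 iotaD map_cat flatten_cat /= cats0.
  have [w1 w2 w3] := hW n.
  rewrite TS; split=> [e b||].
  - rewrite lact_cat h1 lact_cat w1 [lact u [:: _] _]/= lstep_turn shiftD addn1.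
    rewrite big_ord_recr /= addrA; congr (_, _ + _).
    by rewrite /pm backK !ffunE eqxx subr_eq0.
  - rewrite !lamp_sum_cat h2 w2 /lamp_sum big_seq1 big_ord_recr /= mulrSr.
    rewrite [_ + turn i]addrC addrACA; congr (_ + _).
    by congr (_, _, _); rewrite addr0.
  - by rewrite !size_cat /= mulSn addnC; lia.
have [h1 h2 h3] := hT M.
exists (T M); split=> [e b||//].
- rewrite h1 shiftM; congr (_, _ + _).
  have [m em hmm] := gen_mod (e i).
  rewrite (bigD1 m) //= hmm eqxx andbT big1 ?addr0 // => m' /negbTE ne.
  by rewrite hmm ne andbF.
(* [M] turns come back to the start, and their lamp sum vanishes because [M] is even. *)
- rewrite h2 -[M in _ *+ M](odd_double_half M) (negbTE Meven) add0n lamp_mul2n add0r.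
  congr (_, _, _); rewrite exchange_big /=.
  rewrite exchange_big /=.
  transitivity (\sum_(m < M) \sum_e (phi e && (e i == u *+ m))).
    apply: eq_bigr => m _.
    rewrite [RHS](reindex_inj (h := back m)) /=.
      apply: eq_bigr => e _; rewrite /pm ffunE eqxx.
      by rewrite -[_ == u *+ m]subr_eq0 addrK.
    move=> e e' /ffunP h; apply/ffunP => i'; move: (h i'); rewrite !ffunE.
    by case: eqP => // _ /addIr.
  rewrite exchange_big /=; apply: eq_bigr => e _.
  have [m em hmm] := gen_mod (e i).
  rewrite (bigD1 m) //= hmm eqxx andbT big1 ?addr0 // => m' /negbTE ne.
  by rewrite hmm ne andbF.
Qed.

Definition fibre_cost : nat := 8 * M + tour_size 4.

(** Zero sum leaves no net reflection, an even translation and an even number of flips ([lact_base],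
    [sum_flip]), so the action is an even translation followed by a pattern of flips, which a single
    tour realises. *)
Lemma short_word w : lamp_sum w = 0 ->
  exists w', [/\ forall s, lact u w' s = lact u w s, lamp_sum w' = 0 & (size w' <= fibre_cost)%N].
Proof.
move=> t0.
have [q hq] := choice (lact_base u w).
have {}hq s i : (lact u w s).1 i = s.1 i + u *~ (q i * 2).
  by rewrite hq t0 /= !ffunE addr0 /= addr0.
(* Since [u *+ M = 0], the translation by [2 (q i)] multiples of [u] is the one by [- 2 (t i)], with
   [t i] the residue of [- q i]. *)
pose t i := `|(- q i %% M)%Z|%N.
have tM i : (t i < M)%N.
  by rewrite /t; have := @ltz_pmod (- q i) M; have := @modz_ge0 (- q i) M; lia.
have ht i : u *~ (q i * 2) = - (u *+ (t i).*2).
  have e : - q i = (- q i %/ M)%Z * M%:Z + (t i)%:Z.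
    by rewrite {1}(divz_eq (- q i) M) /t; have := @modz_ge0 (- q i) M; lia.
  have -> : q i * 2 = - ((M%:Z * ((- q i %/ M)%Z * 2)) + (t i).*2%:Z) by lia.
  by rewrite mulrNz mulrzDr mulrzA -pmulrn Mu mul0rz add0r.
have [w1 [a1 a2 a3]] := translation_word t.
pose psi e := (lact u w ([ffun i => e i + u *+ (t i).*2], false)).2.
have [w2 [b1 b2 b3]] := @flip_word (enum 'I_4) psi (enum_uniq _) ltac:(by move=> e _ i; rewrite mem_enum).
exists (w1 ++ w2); split.
- move=> [e b]; rewrite lact_cat a1 b1 [RHS]surjective_pairing; congr (_, _).
    by apply/ffunP => i; rewrite ffunE hq ht.
  rewrite (lact_snd u w e b).2 /psi; congr (_ + (lact u w (_, _)).2).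
  by apply/ffunP => i; rewrite !ffunE subrK.
- rewrite lamp_sum_cat a2 b2 add0r; congr (_, _, _).
  transitivity (\sum_e (lact u w (e, false)).2); last by rewrite sum_flip t0.
  rewrite [RHS](reindex_inj (h := fun e : E => [ffun i => e i + u *+ (t i).*2])) //=.
  move=> e e' /ffunP h; apply/ffunP => i; move: (h i); rewrite !ffunE.
  exact: addIr.
- rewrite size_cat a3 /fibre_cost leq_add //; last by rewrite -(size_enum_ord 4).
  have -> : (8 * M = \sum_(i < 4) 2 * M)%N by rewrite sum_nat_const card_ord; lia.
  by apply: leq_sum => i _; have := tM i; lia.
Qed.

End Finite.

(** * Repairing one scale *)

Lemma net_nil i : net [::] i = 0.
Proof. by rewrite /net big_nil. Qed.

Section LocalHist.
Variables (P : fibres) (j : nat).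
Notation E := {ffun 'I_4 -> P j}.
Notation u := (funit P j).
Notation k := (gap j).

Definition mask (r : int) (l : lamp) : lamp :=
  (if r == 0 then l.1.1 else 0, if r == k then l.1.2 else 0,
   if r == k *+ 2 then l.2 else 0).

Lemma lstep_mask r l s : lstep u s (mask r l) = stlamp u k r l s.
Proof.
have k0 := gap_gt0 j; rewrite /lstep /mask /stlamp /=.
move: (gap j) k0 => q q0.
have e1 : (0 == q) = false by apply/eqP; lia.
have e2 : (0 == q *+ 2) = false by apply/eqP; lia.
have e3 : (q == q *+ 2) = false by apply/eqP; lia.
case: eqVneq => [->|_]; first by rewrite e1 e2 stB0 stC0.
case: eqVneq => [->|_]; first by rewrite e3 stA0 stC0.
by case: eqVneq => _; rewrite stA0 stB0 ?stC0.
Qed.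

Definition localw (z : int) (H : seq (int * lamp)) : seq lamp :=
  [seq mask (z - h.1) h.2 | h <- H].

Lemma hact_localw z H (s : E * bool) : hact z H s = lact u (localw z H) s.
Proof. by elim: H s => [|h H IH] s //=; rewrite lstep_mask IH. Qed.

(** Hence a history with zero net lamp at every site gives a word of zero sum on every fibre, to
    which [short_words] applies. *)
Lemma lamp_sum_localw z H :
  lamp_sum (localw z H) = ((net H z).1.1, (net H (z - k)).1.2, (net H (z - k *+ 2)).2).
Proof.
elim: H => [|[i l] H IH]; first by rewrite /lamp_sum !net_nil big_nil.
rewrite /= lamp_sum_cons IH /net !big_cons /mask /= -!/(net H _).
have -> : (z - i == 0) = (i == z) by lia.
have -> : (z - i == k) = (i == z - k) by lia.
have -> : (z - i == k *+ 2) = (i == z - k *+ 2) by lia.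
by congr (_, _, _) => /=; case: ifP => _; rewrite ?add0r.
Qed.

Lemma lact_constant r (w : seq lamp) (s : E * bool) :
  (forall l, l \in w -> l = mask r l) -> lamp_sum w = 0 -> lact u w s = s.
Proof.
have gen w0 s0 : (forall l, l \in w0 -> l = mask r l) -> lact u w0 s0 = stlamp u k r (lamp_sum w0) s0.
  elim: w0 s0 => [|l w0 IH] s0 hw /=; first by rewrite /lamp_sum big_nil stlamp0.
  rewrite IH => [|l' hl']; last by apply: hw; rewrite inE hl' orbT.
  rewrite {1}(hw l) ?inE ?eqxx // lstep_mask stlampD lamp_sum_cons addrC //.
by move=> hw t0; rewrite gen // t0 stlamp0.
Qed.

Definition inw (p : int) (n : nat) (i : int) : bool := p <= i < p + n%:Z.

Lemma hact_sweep L n p z (s : E * bool) :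
  hact z (hist (sweep L n p) p) s =
  lstep u s (if inw p n z then (L z).1.1 else 0,
             if inw p n (z - k) then (L (z - k)).1.2 else 0,
             if inw p n (z - k *+ 2) then (L (z - k *+ 2)).2 else 0).
Proof.
have k0 := gap_gt0 j.
elim: n p s => [|n IH] p s.
  have no i : inw p 0 i = false by rewrite /inw; lia.
  by rewrite !no /= /lstep stC0 stB0 stA0.
rewrite [sweep _ _ _]/= [hist _ _]/= [hact _ _ _]/= IH -lstep_mask /mask.
move: (gap j) k0 {IH} => q q0.
have st i : inw p n.+1 i = (i == p) || inw (p + 1) n i by rewrite /inw; lia.
have out i : i <= p -> inw (p + 1) n i = false by rewrite /inw; lia.
rewrite !st.
have -> : (z - p == 0) = (z == p) by lia.
have -> : (z - p == q) = (z - q == p) by lia.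
have -> : (z - p == q *+ 2) = (z - q *+ 2 == p) by lia.
have [e|n0] := eqVneq z p.
  have e1 : (z - q == p) = false by apply/eqP; lia.
  have e2 : (z - q *+ 2 == p) = false by apply/eqP; lia.
  rewrite e1 e2 /= (out z) ?(out (z - q)) ?(out (z - q *+ 2)); [|lia|lia|lia].
  by rewrite e /lstep /= !(stB0, stC0, stA0).
have [e|n1] := eqVneq (z - q) p.
  have e2 : (z - q *+ 2 == p) = false by apply/eqP; lia.
  rewrite e2 /= (out (z - q)) ?(out (z - q *+ 2)); [|lia|lia].
  by rewrite e /lstep /= !(stB0, stC0, stA0).
have [e|n2] := eqVneq (z - q *+ 2) p.
  rewrite /= (out (z - q *+ 2)); last lia.
  by rewrite e /lstep /= !(stB0, stC0, stA0).
by rewrite /= /lstep /= !(stB0, stC0, stA0).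
Qed.

End LocalHist.

(** * Simultaneous tours over blocks of fibres *)

Section Block.
Variables (P : fibres) (s : nat).
Notation h := (width s).
Notation k := (gap s).

Lemma gapE : k = 4 * h%:Z.
Proof. by rewrite /gap PoszM. Qed.

Lemma gap_sep j : j != s -> h%:Z <= `|gap j - k|.
Proof.
rewrite neq_ltn => /orP[lt|lt].
  have e : width s = (8 ^ (s - j).-1 * 8 * width j)%N.
    by rewrite /width -expnSr -expnD; congr expn; lia.
  have p : (0 < 8 ^ (s - j).-1)%N by rewrite expn_gt0.
  by rewrite /gap e; move: (width_gt0 j) p; move: (8 ^ _)%N (width j) => x y; nia.
have e : width j = (8 ^ (j - s).-1 * 8 * width s)%N.
  by rewrite /width -expnSr -expnD; congr expn; lia.
have p : (0 < 8 ^ (j - s).-1)%N by rewrite expn_gt0.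
by rewrite /gap e; move: (width_gt0 s) p; move: (8 ^ _)%N (width s) => x y; nia.
Qed.

(* The lamps of a trip along which each fibre [0 <= z < h] receives the
   configuration [c z], whose three parts are written at [z], [z - k], [z - 2k]. *)
Definition trip_lamps (c : int -> lamp) (i : int) : lamp :=
  (if inw 0 h i then (c i).1.1 else 0, if inw 0 h (i + k) then (c (i + k)).1.2 else 0,
   if inw 0 h (i + k *+ 2) then (c (i + k *+ 2)).2 else 0).

(** From [- 2 k = - 8 h] the sweep covers [[-8 h, h)], which contains the sites of all three parts
    for the [h] fibres of the block; moving back by [h] then ends at the start. *)
Definition trip_len : nat := (9 * h)%N.
Definition trip (c : int -> lamp) : seq letter :=
  move_word (- (k *+ 2)) ++ sweep (trip_lamps c) trip_len (- (k *+ 2)) ++ move_word (- h%:Z).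

Lemma pos_trip c p : pos (trip c) p = p.
Proof.
rewrite /trip !pos_cat !pos_move_word [p + _]addrC pos_shift pos_sweep /trip_len gapE.
by move: (width s) => n; lia.
Qed.

Lemma size_trip c : (size (trip c) <= 27 * h)%N.
Proof. rewrite !size_cat !size_move_word size_sweep /trip_len gapE; move: (width s) => n; lia. Qed.

(** What a fibre of scale [j] receives from a trip designed for scale [s]: the [b] and [c] parts
    arrive displaced by the difference of the gaps and by its double. *)
Definition sees (j : nat) (c : int -> lamp) (z : int) : lamp :=
  (if inw 0 h z then (c z).1.1 else 0,
   if inw 0 h (z - gap j + k) then (c (z - gap j + k)).1.2 else 0,
   if inw 0 h (z - gap j *+ 2 + k *+ 2) then (c (z - gap j *+ 2 + k *+ 2)).2 else 0).

Lemma hact_trip j c z (st : {ffun 'I_4 -> P j} * bool) :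
  hact z (hist (trip c) 0) st = lstep (funit P j) st (sees j c z).
Proof.
rewrite /trip hist_cat hist_move_word pos_move_word add0r hist_cat hist_move_word cats0 /= hact_sweep.
have h0 := width_gt0 s.
congr (lstep _ _ (_, _, _)); rewrite /trip_lamps /trip_len /inw gapE /=;
  move: (width s) h0 (gap j) => n n0 q; case: ifP => c1; case: ifP => c2 //; lia.
Qed.

Definition block (cs : seq (int -> lamp)) : seq letter := flatten (map trip cs).

Lemma pos_block cs p : pos (block cs) p = p.
Proof. by elim: cs => [|c cs IH] //=; rewrite pos_cat pos_trip. Qed.

Lemma size_block cs : (size (block cs) <= 27 * h * size cs)%N.
Proof.
elim: cs => [|c cs IH] //=; rewrite size_cat mulnS leq_add //; exact: size_trip.
Qed.

Lemma hact_block j cs z (st : {ffun 'I_4 -> P j} * bool) :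
  hact z (hist (block cs) 0) st = lact (funit P j) [seq sees j c z | c <- cs] st.
Proof.
elim: cs st => [|c cs IH] st //=.
by rewrite hist_cat pos_trip hact_cat hact_trip IH.
Qed.

Lemma block_own cs z (st : {ffun 'I_4 -> P s} * bool) :
  hact z (hist (block cs) 0) st =
  if inw 0 h z then lact (funit P s) [seq c z | c <- cs] st else st.
Proof.
rewrite hact_block; case: ifPn => hz.
  congr (lact _ _ _); apply: eq_map => c; rewrite /sees !subrK hz.
  by case: (c z) => [[]].
rewrite (_ : map _ _ = nseq (size cs) 0) ?lact0 //.
elim: cs => //= c cs ->; congr cons.
by rewrite /sees !subrK (negbTE hz).
Qed.

Lemma inw_excl (a b z : int) (n : nat) : n%:Z <= `|a - b| ->
  [/\ inw 0 n z -> inw 0 n (z - a + b) = false,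
    inw 0 n z -> inw 0 n (z - a *+ 2 + b *+ 2) = false &
    inw 0 n (z - a + b) -> inw 0 n (z - a *+ 2 + b *+ 2) = false].
Proof. by rewrite /inw; split; lia. Qed.

(** Since the gaps differ by at least [h], at most one of the three displaced windows contains the
    fibre; it receives letters of one kind only, which commute and sum to zero. *)
Lemma block_other j cs z (st : {ffun 'I_4 -> P j} * bool) : j != s ->
  (forall x, inw 0 h x -> lamp_sum [seq c x | c <- cs] = 0) ->
  hact z (hist (block cs) 0) st = st.
Proof.
move=> /gap_sep js ht; rewrite hact_block; have h0 := width_gt0 s; have kj := gap_gt0 j.
have totE : lamp_sum [seq sees j c z | c <- cs] =
   (if inw 0 h z then (lamp_sum [seq c z | c <- cs]).1.1 else 0,
   if inw 0 h (z - gap j + k) then (lamp_sum [seq c (z - gap j + k) | c <- cs]).1.2 else 0,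
   if inw 0 h (z - gap j *+ 2 + k *+ 2) then
     (lamp_sum [seq c (z - gap j *+ 2 + k *+ 2) | c <- cs]).2 else 0).
  elim: cs {ht} => [|c cs IH] /=.
    by rewrite /lamp_sum !big_nil; do 3 case: ifP.
  rewrite !lamp_sum_cons IH /sees; by congr (_, _, _) => /=; case: ifP => _; rewrite ?addr0.
have t0 : lamp_sum [seq sees j c z | c <- cs] = 0.
  by rewrite totE; congr (_, _, _); case: ifP => // hz; rewrite ht.
have [x1 x2 x3] := inw_excl z js.
case: (boolP (inw 0 h z)) => h1.
  apply: (lact_constant (r := 0)) => // l /mapP[c _ ->].
  by rewrite /mask /sees h1 (x1 h1) (x2 h1) eqxx /= !if_same.
case: (boolP (inw 0 h (z - gap j + k))) => h2.
  apply: (lact_constant (r := gap j)) => // l /mapP[c _ ->].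
  by rewrite /mask /sees (negbTE h1) h2 (x3 h2) eqxx /= !if_same.
apply: (lact_constant (r := gap j *+ 2)) => // l /mapP[c _ ->].
by rewrite /mask /sees (negbTE h1) (negbTE h2) eqxx /= !if_same.
Qed.

End Block.

Definition short_words (F : zmodType) (u : F) (D : nat) : Prop :=
  forall w, lamp_sum w = 0 -> exists w', [/\ forall st, lact u w' st = lact u w st,
    lamp_sum w' = 0 & (size w' <= D)%N].

Section Repair.
Variables (P : fibres) (s : nat) (D : nat).
Hypothesis short : short_words (funit P s) D.
Variables (H : seq (int * lamp)) (rho : nat).
Hypotheses (net0 : net H =1 fun=> 0) (Hrho : sites_in (- rho%:Z) rho%:Z H).
Notation h := (width s).

Lemma fibre_words : exists W : int -> seq lamp, forall z, [/\
  forall st, lact (funit P s) (W z) st = hact z H st, lamp_sum (W z) = 0 & size (W z) = D].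
Proof.
suff hz z : exists w, [/\
  forall st, lact (funit P s) w st = hact z H st, lamp_sum w = 0 & size w = D].
  by have [W hW] := choice hz; exists W.
have [|w [e1 e2 e3]] := short (w := localw s z H).
  by rewrite lamp_sum_localw !net0.
(* Padding by zero lamps to the common length [D] lets neighbouring fibres be served by the same
   trips. *)
exists (w ++ nseq (D - size w) 0); split.
- by move=> st; rewrite lact_cat lact0 e1 hact_localw.
- by rewrite lamp_sum_cat e2 lamp_sum_nseq mul0rn addr0.
- by rewrite size_cat size_nseq subnKC.
Qed.

Section Chain.
Variable W : int -> seq lamp.
Hypothesis hW : forall z, [/\
  forall st, lact (funit P s) (W z) st = hact z H st, lamp_sum (W z) = 0 & size (W z) = D].

(** Transposition: the [r]-th trip carries the [r]-th letter of every word [W (q + x)] of the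
    block. *)
Definition configs (q : int) : seq (int -> lamp) :=
  [seq (fun x : int => nth 0 (W (q + x)) r) | r <- iota 0 D].

Lemma configsE q x : [seq c x | c <- configs q] = W (q + x).
Proof.
by rewrite /configs -map_comp; have [_ _ <-] := hW (q + x); rewrite -[RHS](mkseq_nth 0).
Qed.

Fixpoint chain (n : nat) (q : int) : seq letter :=
  if n is n'.+1 then block s (configs q) ++ move_word h%:Z ++ chain n' (q + h%:Z) else [::].

Lemma pos_chain n q p : pos (chain n q) p = p + n%:Z * h%:Z.
Proof.
elim: n q p => [|n IH] q p /=; first by rewrite mul0r addr0.
by rewrite !pos_cat pos_block pos_move_word IH intS mulrDl mul1r addrA.
Qed.

Lemma hist_chainS n q :
  hist (chain n.+1 q) q = [seq (x.1 + q, x.2) | x <- hist (block s (configs q)) 0] ++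
    hist (chain n (q + h%:Z)) (q + h%:Z).
Proof.
rewrite /= !hist_cat pos_block hist_move_word pos_move_word /=.
by have := hist_shift (block s (configs q)) 0 q; rewrite add0r => ->.
Qed.

Lemma chain_own n q z (st : {ffun 'I_4 -> P s} * bool) :
  hact z (hist (chain n q) q) st = if q <= z < q + n%:Z * h%:Z then hact z H st else st.
Proof.
have h0 := width_gt0 s.
elim: n q st => [|n IH] q st.
  by rewrite mul0r addr0 ifF //; lia.
rewrite hist_chainS hact_cat hact_shift block_own configsE IH.
rewrite [q + (z - q)]addrC subrK intS mulrDl mul1r addrA.
move: (width s) h0 => m m0; rewrite /inw.
have [c1|c1] := boolP (0 <= z - q < 0 + m%:Z).
  rewrite ifF ?ifT; [by have [-> _ _] := hW z| |]; nia.
by congr (if _ then _ else _); nia.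
Qed.

Lemma chain_other j n q z (st : {ffun 'I_4 -> P j} * bool) : j != s ->
  hact z (hist (chain n q) q) st = st.
Proof.
move=> js; elim: n q st => [|n IH] q st //.
rewrite hist_chainS hact_cat hact_shift block_other // => x _.
by rewrite configsE; have [] := hW (q + x).
Qed.

Lemma size_chain n q : (size (chain n q) <= n * (27 * h * D + h))%N.
Proof.
elim: n q => [|n IH] q //=.
rewrite !size_cat size_move_word mulSn addnA leq_add // leq_add //.
by apply: leq_trans (size_block _ _) _; rewrite size_map size_iota.
Qed.

End Chain.

Lemma repair_scale : exists w, [/\ pos w 0 = 0,
  forall z (st : {ffun 'I_4 -> P s} * bool), hact z (hist w 0) st = hact z H st,
  forall j z (st : {ffun 'I_4 -> P j} * bool), j != s -> hact z (hist w 0) st = st &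
  (size w <= 300 * D * (rho + h))%N].
Proof.
have [W hW] := fibre_words; have h0 := width_gt0 s.
(* With [D = 0] the bound leaves no room for the walk along the fibres, but then every word is
   empty. *)
case: (posnP D) => D0.
  exists [::]; split=> // z st.
  by have [<- _] := hW z; rewrite D0 => /size0nil ->.
(* A site acts on fibres up to [2 k = 8 h] to its right, so the [n] blocks of width [h] that start
   at [- rho] must cover everything up to [rho + 8 h]. *)
pose n := ((2 * rho + 8 * h) %/ h).+1.
pose q := - rho%:Z.
have n1 : (2 * rho + 8 * h < n * h)%N by rewrite /n ltn_ceil.
have n2 : (n * h <= 2 * rho + 9 * h)%N.
  by rewrite /n mulSn; have := leq_trunc_div (2 * rho + 8 * h) h; lia.
clearbody n.
exists (move_word q ++ chain W n q ++ move_word (- (q + n%:Z * h%:Z))).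
have E : hist (move_word q ++ chain W n q ++ move_word (- (q + n%:Z * h%:Z))) 0 = hist (chain W n q) q.
  by rewrite hist_cat hist_move_word pos_move_word add0r hist_cat hist_move_word cats0.
split.
- by rewrite !pos_cat !pos_move_word pos_chain add0r subrr.
- move=> z st; rewrite E chain_own //; case: ifPn => // hz.
  rewrite hact_untouched // => x xin; apply/negP.
  have := allP Hrho _ xin; rewrite /touches gapE.
  move: hz n1 {E n2}; rewrite /q -PoszM; move: (n * h)%N => t.
  move: (width s) h0 => m m0; case: x {xin} => i l /=.
  by rewrite negb_and -!ltNge => /orP[h1|h1] h2 /andP[h3 h4] /or3P[] /eqP e; lia.
- by move=> j z st js; rewrite E chain_other.
- rewrite !size_cat !size_move_word /q.
  have := size_chain W n q; rewrite /q; move: (size _) => t ht.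
  have : (n * (27 * h * D + h) <= (2 * rho + 9 * h) * (27 * D + 1))%N.
    rewrite (_ : 27 * h * D + h = h * (27 * D + 1))%N ?mulnA ?leq_mul2r ?n2 ?orbT //; ring.
  have : (`|- (- rho%:Z + n%:Z * h%:Z)| <= rho + 9 * h)%N by lia.
  move: (`|_|%N) => y hy h3.
  have : ((2 * rho + 9 * h) * (27 * D + 1) <= (2 * rho + 9 * h) * (28 * D))%N.
    by rewrite leq_mul2l; apply/orP; right; lia.
  have : (rho + (rho + 9 * h) <= (2 * rho + 9 * h) * D)%N by nia.
  have : ((2 * rho + 9 * h) * D * 29 <= 300 * D * (rho + h))%N by nia.
  by nia.
Qed.

End Repair.

Lemma repair P (S : nat) (D : nat -> nat) H rho :
  (forall s, (s < S)%N -> short_words (funit P s) (D s)) ->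
  net H =1 (fun=> 0) -> sites_in (- rho%:Z) rho%:Z H ->
  exists w, [/\ pos w 0 = 0,
    forall j z (st : {ffun 'I_4 -> P j} * bool),
      hact z (hist w 0) st = if (j < S)%N then hact z H st else st &
    (size w <= \sum_(s < S) 300 * D s * (rho + width s))%N].
Proof.
move=> hD n0 hr; elim: S hD => [|S IH] hD.
  by exists [::]; split=> //; rewrite big_ord0.
have [|w [e1 e2 e3]] := IH; first by move=> s hs; apply: hD; lia.
have [w' [f1 f2 f3 f4]] := repair_scale (hD S (leqnn _)) n0 hr.
exists (w ++ w'); split.
- by rewrite pos_cat e1.
- move=> j z st; rewrite hist_cat e1 hact_cat e2.
  have [e|ne] := eqVneq j S; first by subst j; rewrite ltnn f2 ltnSn.
  by rewrite f3 // ltnS [in RHS]leq_eqVlt (negbTE ne).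
- by rewrite size_cat big_ord_recr /= leq_add.
Qed.

(** * Length and entropy of the walk *)

Lemma hact_rev (P : fibres) j z (H : seq (int * lamp)) (st : {ffun 'I_4 -> P j} * bool) :
  hact z H (hact z (rev H) st) = st.
Proof.
elim: H st => [|x H IH] st //=.
rewrite rev_cons -cats1 hact_cat /= stlampD lampDD stlamp0; exact: IH.
Qed.

Lemma net_rev H i : net (rev H) i = net H i.
Proof. by rewrite /net; apply: perm_big; rewrite perm_rev. Qed.

Lemma width_mono j J : (j <= J)%N -> (width j <= width J)%N.
Proof. by move=> jJ; rewrite /width leq_pexp2l. Qed.

(** The coarse word is corrected by a prefix: the history of [w] followed by the reversed history of
    the coarse word has zero net, and a repair word realising it on the scales below [J] is the
    missing factor. The range is measured with a separate step [m], later of order [sqrt n]. *)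
Lemma length_bound (P : fibres) J (D : nat -> nat) m (s : seq incr) : (0 < m)%N ->
  (forall j, (j < J)%N -> short_words (funit P j) (D j)) ->
  (word_length (@gens P) (walk_prod (@igen P) s) <=
    10 * width J * (moves (width J) (words s) 0).+1 +
    \sum_(j < J) 300 * D j * (m * (moves m (words s) 0).+1 + width J + width j))%N.
Proof.
move=> m0 hD; rewrite walk_prod_igen -/(words s); set w := words s.
pose r := (m * (moves m w 0).+1)%N; have h0 := width_gt0 J.
have hw : within (- r%:Z) r%:Z w 0.
  have := @moves_within m w 0 0 m0; rewrite subrr normr0 ltz_nat => /(_ m0).
  by rewrite sub0r add0r -PoszM.
have c0 : - r%:Z <= 0 <= r%:Z by lia.
have c2 : `|pos [::] 0 - 0| < (width J)%:Z by rewrite /= subrr normr0 ltz_nat.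
have [w' [e1 e2 e3 e4 e5]] := @coarse P (width J) (- r%:Z) r%:Z w [::] 0 h0 c0 isT c2 hw.
rewrite subr0 /= in e5.
pose H := hist w 0 ++ rev (hist w' 0).
have [||v [f1 f2 f3]] := @repair P J D H (r + width J) hD.
- by move=> i; rewrite net_cat net_rev e2 lampDD.
- rewrite /H sites_in_cat /sites_in all_rev; apply/andP; split.
    by apply: sites_in_sub (within_sites hw); lia.
  by apply: sites_in_sub e4; lia.
have -> : ev P w = ev P (v ++ w').
  apply: ev_hist => [|j z st]; first by rewrite pos_cat f1 e1.
  rewrite hist_cat f1 hact_cat f2; case: ltnP => jJ.
    by rewrite /H hact_cat hact_rev.
  rewrite e3 //; have := width_mono jJ; rewrite /gap; move: (width j) (width J) h0 => a b; lia.
apply: leq_trans (word_length_le _ _) _; rewrite size_cat addnC leq_add //.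
Qed.

Section Bounds.
Variable R : realType.

(** With [m] the integer part of [sqrt n], the radius bound has mean at most [5 sqrt n]; together
    with [2 * width J <= 2 sqrt n] this is [7 sqrt n], whence [2100 = 300 * 7]. *)
Lemma upper_bound (P : fibres) J (D : nat -> nat) n : (width J ^ 2 <= n)%N ->
  (forall j, (j < J)%N -> short_words (funit P j) (D j)) ->
  Ex n (fun s => (word_length (@gens P) (walk_prod (@igen P) s))%:R) <=
  10 * (n%:R / (width J)%:R + Num.sqrt n%:R) +
  2100 * Num.sqrt n%:R * (\sum_(j < J) D j)%:R :> R.
Proof.
move=> hJ hD; have h0 := width_gt0 J.
have n0 : (0 < n)%N by apply: leq_trans hJ; rewrite expn_gt0 h0.
have [m [m1 m2]] : exists m, (m ^ 2 <= n)%N /\ (n < m.+1 ^ 2)%N.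
  have ex : exists m, (m ^ 2 <= n)%N by exists 0%N.
  have ub m : (m ^ 2 <= n)%N -> (m <= n)%N by nia.
  case: (ex_maxnP ex ub) => m h1 h2; exists m; split=> //.
  by rewrite ltnNge; apply/negP => /h2; rewrite ltnn.
have m0 : (0 < m)%N by rewrite lt0n; apply: contraTneq m2 => ->; rewrite -leqNgt.
set q := Num.sqrt n%:R : R.
have q2 : q ^+ 2 = n%:R by rewrite sqr_sqrtr.
have q0 : 0 <= q by rewrite sqrtr_ge0.
have leq_sq a : (a ^ 2 <= n)%N -> a%:R <= q.
  move=> ha; rewrite -(ler_pXn2r (n := 2)) ?nnegrE ?ler0n //.
  by rewrite q2 -natrX ler_nat.
have hq : (width J)%:R <= q by exact: leq_sq.
have mq : m%:R <= q by exact: leq_sq.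
have nm : n%:R / m%:R <= 4 * q.
  have mp : (0 : R) < m%:R by rewrite ltr0n.
  rewrite ler_pdivrMr //; apply: (@le_trans _ _ ((m.+1 ^ 2)%:R)).
    by rewrite ler_nat ltnW.
  apply: (@le_trans _ _ (4 * m%:R * m%:R)); last first.
    by rewrite ler_wpM2r ?ler_wpM2l // ltW.
  by rewrite -!natrM ler_nat; nia.
apply: (@le_trans _ _ (Ex n (fun s => 10 * ((width J)%:R * (moves (width J) (words s) 0).+1%:R) +
   300 * (\sum_(j < J) D j)%:R * (m%:R * (moves m (words s) 0).+1%:R + 2 * (width J)%:R)))).
  apply: le_Ex => s _; rewrite -2!natrM -!natrM -!natrD -!natrM -natrD ler_nat.
  apply: leq_trans (length_bound s m0 hD) _; apply: leq_add; first by rewrite mulnA.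
  rewrite big_distrr big_distrl /=; apply: leq_sum => j _; rewrite leq_mul2l; apply/orP; right.
  by have := width_mono (ltnW (ltn_ord j)); lia.
rewrite ExD !ExZ ExD ExZ Ex_const ?incr_gt0 //.
have e1 := moves_scaled R n h0; have e2 := moves_scaled R n m0.
have S0 : 0 <= (\sum_(j < J) D j)%:R :> R by rewrite ler0n.
apply: lerD.
  by rewrite ler_wpM2l //; apply: le_trans e1 _; rewrite lerD2l.
have -> : 2100 * q * (\sum_(j < J) D j)%:R = 300 * (\sum_(j < J) D j)%:R * (7 * q).
  by move: ((\sum_(j < J) D j)%:R) => x; ring.
apply: ler_wpM2l; first by rewrite mulr_ge0.
by move: e2 nm mq hq; move: (_ * Ex _ _) (n%:R / m%:R) => a b; lra.
Qed.

Lemma lower_bound (P : fibres) j M n : (0 < M)%N -> order_ge (funit P j) M ->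
  ln 2 * n%:R <= (32 * (gap j)%:~R + 8 * (Num.sqrt n%:R / M%:R ^+ 4)) *
    walk_entropy (law R (@igen P)) n.
Proof.
move=> M0 hu; have g := green_bound R n M0 hu.
have e := @entropy_lower R P j n; have r := @renewal R P j n.
have rr0 : 0 <= Ex n (fun zs => (@fresh P j zs)%:R) :> R.
  by apply: Ex_ge0 => [|zs _]; rewrite ?rest_gt0 ?ler0n.
have l2 : 0 <= ln 2 :> R by rewrite ln_ge0 // ler1n.
have G0 : 0 <= 32 * (gap j)%:~R + 8 * (Num.sqrt n%:R / M%:R ^+ 4) :> R.
  rewrite addr_ge0 ?mulr_ge0 ?ler0z ?(ltW (gap_gt0 j)) ?sqrtr_ge0 ?invr_ge0 ?exprn_ge0 ?ler0n //.
apply: le_trans (ler_wpM2l G0 e); rewrite mulrCA ler_wpM2l //.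
by apply: le_trans r _; rewrite ler_wpM2r.
Qed.

(** At least one time is fresh, so the walk is at 1 with probability at most 1/2. The bound will
    absorb the additive [ln 2] of [gibbs_upper]. *)
Lemma length_lower (P : fibres) n : (0 < n)%N ->
  2^-1 <= Ex n (fun s => (word_length (@gens P) (walk_prod (@igen P) s))%:R) :> R.
Proof.
move=> n0.
apply: (@le_trans _ _ (1 + -1 * Ex n (fun s => (walk_prod (@igen P) s == 1%g)%:R))).
  have : Ex n (fun s => (walk_prod (@igen P) s == 1%g)%:R) <= 2^-1 :> R.
    rewrite -conv_powerE ?incr_gt0 //; apply: le_trans (prob_le R 0 n _) _.
    rewrite -[leRHS](Ex_const n _ rest_gt0); apply: le_Ex => zs hz.
    rewrite lef_pV2 ?posrE ?exprn_gt0 // -{1}[2]expr1 ler_eXn2l ?ltr1n //.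
    by apply: fresh_gt0; rewrite hz.
  by move: (Ex _ _) => x; lra.
rewrite -{1}(Ex_const n 1 incr_gt0) -ExZ -ExD; apply: le_Ex => s _.
have [e|ne] := eqVneq (walk_prod (@igen P) s) 1%g; first by rewrite mulr1 subrr ler0n.
rewrite mulr0 addr0 ler1n lt0n; apply: contra_neq ne => l0.
have [w e hw] := word_lengthP (walk_prod (@igen P) s).
by rewrite e; move: hw; rewrite l0 => /size0nil ->.
Qed.

End Bounds.

(** * Choice of the scales *)

(* [M = 0] encodes an infinite fibre. *)
Definition cyclic_fibre (M : nat) : zmodType := if M is m.+1 then 'I_m.+1 : zmodType else int.
Definition cyclic_gen (M : nat) : cyclic_fibre M :=
  match M return cyclic_fibre M with 0 => 1%:Z | m.+1 => inZp 1 end.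

Lemma inZp_muln m n : (inZp 1 : 'I_m.+1) *+ n = inZp n.
Proof.
elim: n => [|n IH]; first by apply/val_inj.
by rewrite mulrS IH; apply/val_inj; rewrite /= modnDm add1n.
Qed.

Lemma cyclic_order M : (0 < M)%N -> order_ge (cyclic_gen M) M.
Proof.
case: M => // m _ n hn; rewrite inZp_muln; apply/eqP => /(congr1 val) /=.
by rewrite modn_small; lia.
Qed.

Lemma int_order M : order_ge (cyclic_gen 0) M.
Proof. by move=> n hn; rewrite /= natz; lia. Qed.

Lemma cyclic_short M : (0 < M)%N -> ~~ odd M -> short_words (cyclic_gen M) (fibre_cost M).
Proof.
case: M => // m _ eM w t0.
apply: (@short_word 'I_m.+1 (inZp 1) m.+1) => // [|x|].
- by rewrite inZp_muln; apply/val_inj; rewrite /= modnn.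
- by exists x; rewrite inZp_muln valZpK.
- exact: (@cyclic_order m.+1).
Qed.

Lemma trivial_short : short_words (cyclic_gen 1) 0.
Proof.
move=> w t0; exists [::]; split=> //; last by rewrite /lamp_sum big_nil.
by move=> st; apply/esym; apply: lact_trivial => // x y; rewrite [x]ord1 [y]ord1.
Qed.

Lemma fibre_cost_le M : (0 < M)%N -> (fibre_cost M <= 13 * M ^ 4)%N.
Proof. by move=> M0; rewrite /fibre_cost /tour_size /=; nia. Qed.

(** * Moduli read off from the growth function *)

Section Selection.
Variables (R : realType) (rho : R -> R).
Hypothesis rho1 : rho 1 = 1.
Hypothesis rho_ge1 : forall x, 1 <= x -> 1 <= rho x.
Hypothesis rho_sqrt : forall x y, 1 <= x -> x <= y ->
  rho x / Num.sqrt x <= rho y / Num.sqrt y.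
Hypothesis rho_lin : forall x y, 1 <= x -> x <= y -> x / rho x <= y / rho y.

Let T (x : R) := x / rho x.
Let g (x : R) := rho x / Num.sqrt x.
Let p4 (a : nat) : R := 4 ^+ a.

Let p4_ge1 a : 1 <= p4 a.
Proof. by rewrite /p4 exprn_ege1 // ler1n. Qed.

Let sqrt_gt0 x : 1 <= x -> 0 < Num.sqrt x :> R.
Proof. by move=> x1; rewrite sqrtr_gt0; apply: lt_le_trans x1. Qed.

Let g1 : g 1 = 1.
Proof. by rewrite /g rho1 sqrtr1 divr1. Qed.

Let T1 : T 1 = 1.
Proof. by rewrite /T rho1 divr1. Qed.

Let g_ge1 x : 1 <= x -> 1 <= g x.
Proof. by move=> x1; rewrite -g1; exact: rho_sqrt. Qed.

Let T_ge1 x : 1 <= x -> 1 <= T x.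
Proof. by move=> x1; rewrite -T1; exact: rho_lin. Qed.

(** Sampling at powers of 4 loses at most a factor 2: [rho] at most quadruples because [x / rho x]
    is monotone, and the square root doubles. *)
Let g_double a : g (p4 a.+1) <= 2 * g (p4 a).
Proof.
have le4 : p4 a <= p4 a.+1 by rewrite /p4 exprS ler_peMl ?ler1n // exprn_ge0.
have := rho_lin (p4_ge1 a) le4.
have r0 := rho_ge1 (p4_ge1 a); have r1 := rho_ge1 (p4_ge1 a.+1).
have s0 := sqrt_gt0 (p4_ge1 a).
rewrite /g.
have -> : Num.sqrt (p4 a.+1) = 2 * Num.sqrt (p4 a).
  rewrite /p4 exprS sqrtrM // (_ : 4 = 2 ^+ 2) ?sqrtr_sqr ?ger0_norm //.
  by rewrite -natrX.
have p0 : 0 < p4 a by apply: lt_le_trans (p4_ge1 a).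
have e4 : p4 a.+1 = 4 * p4 a by rewrite /p4 exprS.
rewrite e4 in r1 *.
rewrite ler_pdivrMr ?(lt_le_trans ltr01) // mulrAC ler_pdivlMr ?(lt_le_trans ltr01) //.
rewrite [4 * p4 a]mulrC -mulrA ler_pM2l // => h.
have -> : 2 * (rho (p4 a) / Num.sqrt (p4 a)) = 4 * rho (p4 a) / (2 * Num.sqrt (p4 a)).
  by field; apply: lt0r_neq0.
by rewrite ler_wpM2r // invr_ge0 mulr_ge0 // ltW.
Qed.

Let p4_unbounded x : exists a, x <= p4 a.
Proof.
have [n hn] : exists n : nat, x <= n%:R.
  by exists (Num.truncn `|x|).+1; apply: le_trans (ler_norm x) (ltW (truncnS_gt _)).
exists n; apply: le_trans hn _; rewrite /p4 -natrX ler_nat.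
by apply: ltnW; apply: ltn_expl.
Qed.

(** [4 ^ a] is the first sampling point at which [x / rho x] reaches [8 ^ s.+1], and [16 ^ r] is the
    value of [rho x / sqrt x] there up to a factor 16, so a modulus [2 ^ r] has a fourth power of
    the right size. [None] means that the level is never reached. *)
Definition scale_spec (s : nat) (o : option nat) : Prop :=
  match o with
  | Some r => exists a, [/\ 8 ^+ s.+1 <= T (p4 a),
      forall a', 8 ^+ s.+1 <= T (p4 a') -> (a <= a')%N & 16 ^+ r <= g (p4 a) < 16 ^+ r.+1]
  | None => forall a, T (p4 a) < 8 ^+ s.+1
  end.

Lemma scale_exists s : exists o, scale_spec s o.
Proof.
have [[a0 h0]|no] := pselect (exists a, 8 ^+ s.+1 <= T (p4 a)); last first.
  exists None => a; rewrite ltNge; apply/negP => h; apply: no; by exists a.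
have ex : exists a, `[< 8 ^+ s.+1 <= T (p4 a) >] by exists a0; apply/asboolP.
case: (ex_minnP ex) => a /asboolP ha hmin.
have exr : exists r : nat, 16 ^+ r <= g (p4 a) by exists 0%N; rewrite expr0 g_ge1.
have ub r : `[< 16 ^+ r <= g (p4 a) >] -> (r <= Num.truncn (g (p4 a)))%N.
  move=> /asboolP hr; rewrite truncn_ge_nat ?(le_trans ler01) ?g_ge1 //.
  apply: le_trans hr; rewrite -natrX ler_nat; apply: ltnW; exact: ltn_expl.
have exr' : exists r : nat, `[< 16 ^+ r <= g (p4 a) >].
  by have [r hr] := exr; exists r; apply/asboolP.
case: (ex_maxnP exr' ub) => r /asboolP hr hmax.
exists (Some r), a; split=> //; first by move=> a' h; apply: hmin; apply/asboolP.
rewrite hr ltNge; apply/negP => /asboolP /hmax; by rewrite ltnn.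
Qed.

Lemma scale_mono s r r' : scale_spec s (Some r) -> scale_spec s.+1 (Some r') -> (r <= r')%N.
Proof.
move=> [a [a1 a2 /andP[a3 _]]] [b [b1 b2 /andP[_ b3]]].
have ab : (a <= b)%N.
  by apply: a2; apply: le_trans b1; rewrite ler_eXn2l // ltr1n.
have gab : g (p4 a) <= g (p4 b).
  by apply: rho_sqrt => //; rewrite /p4 ler_eXn2l // ltr1n.
have : 16 ^+ r < 16 ^+ r'.+1 :> R by apply: le_lt_trans a3 (le_lt_trans gab b3).
by rewrite ltr_eXn2l ?ltr1n // ltnS.
Qed.

(** By minimality of [a] the preceding sampling point is at most [x], and [g] at most doubles from
    there. *)
Lemma scale_Some s o x : scale_spec s o -> 1 <= x -> 8 ^+ s.+1 <= T x ->
  exists2 r, o = Some r & 16 ^+ r <= 2 * g x.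
Proof.
case: o => [r|] h x1 hx; last first.
  have [a xa] := p4_unbounded x.
  by have := le_trans hx (rho_lin x1 xa); rewrite leNgt h.
exists r => //; have [a [a1 a2 /andP[a3 _]]] := h.
apply: (le_trans a3); case: a a1 a2 a3 => [|a] a1 a2 a3.
  rewrite /p4 expr0 g1; have := g_ge1 x1; lra.
apply: (le_trans (g_double a)); rewrite ler_pM2l //.
apply: rho_sqrt => //; rewrite leNgt; apply/negP => xa.
have : 8 ^+ s.+1 <= T (p4 a) by apply: le_trans hx (rho_lin x1 (ltW xa)).
by move=> /a2; rewrite ltnn.
Qed.

Lemma scale_below s r x : scale_spec s (Some r) -> 1 <= x -> T x < 8 ^+ s.+1 -> g x <= 16 ^+ r.+1.
Proof.
move=> [a [a1 _ /andP[_ a3]]] x1 hx; apply: le_trans (ltW a3).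
apply: rho_sqrt => //; rewrite leNgt; apply/negP => ax.
by have := lt_le_trans hx a1; rewrite ltNge rho_lin // ltW.
Qed.

Lemma scale_of x : 1 <= x -> exists j : nat, 8 ^+ j <= T x < 8 ^+ j.+1.
Proof.
move=> x1; have ex : exists j : nat, `[< 8 ^+ j <= T x >].
  by exists 0%N; apply/asboolP; rewrite expr0 T_ge1.
have ub j : `[< 8 ^+ j <= T x >] -> (j <= Num.truncn (T x))%N.
  move=> /asboolP hr; rewrite truncn_ge_nat ?(le_trans ler01) ?T_ge1 //.
  apply: le_trans hr; rewrite -natrX ler_nat; apply: ltnW; exact: ltn_expl.
case: (ex_maxnP ex ub) => j /asboolP hj hmax; exists j.
rewrite hj ltNge; apply/negP => /asboolP /hmax; by rewrite ltnn.
Qed.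

Variable ro : nat -> option nat.
Hypothesis roP : forall s, scale_spec s (ro s).

(** Among consecutive scales with the same [r] only the first keeps its torus, which makes the sum
    of the costs geometric. A level never reached gets the infinite fibre. *)
Definition modulus (s : nat) : nat :=
  match ro s with
  | None => 0%N
  | Some r => if (s != 0%N) && (ro s.-1 == Some r) then 1%N else (2 ^ r)%N
  end.

Definition cost (s : nat) : nat := if modulus s == 1%N then 0%N else fibre_cost (modulus s).

Definition growth_fibres : fibres := @Fibres (fun s => cyclic_fibre (modulus s)) (fun s => cyclic_gen (modulus s)).

Lemma cost_short s : ro s -> short_words (funit growth_fibres s) (cost s).
Proof.
rewrite /= /cost; have : ro s -> modulus s = 1%N \/ (0 < modulus s)%N /\ ~~ odd (modulus s).
  rewrite /modulus; case: (ro s) => // r _; case: ifP => _; first by left.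
  by case: r => [|r]; [left|right; rewrite expn_gt0 oddX].
move=> h /h; move: (modulus s) => M [->|[M0 eM]]; first exact: trivial_short.
by rewrite ifF; [exact: cyclic_short|case: M M0 eM => [|[|]]].
Qed.

(** Nonzero costs have strictly increasing [r] and are at most [13 * 16 ^ r], so the last bound
    dominates up to a factor 2. *)
Lemma cost_sum J r : (forall s, (s <= J)%N -> ro s) -> ro J = Some r ->
  (\sum_(s < J.+1) cost s <= 26 * 16 ^ r)%N.
Proof.
have cost_le s r0 : ro s = Some r0 -> (cost s <= 13 * 16 ^ r0)%N.
  move=> e; have M0 : (0 < 2 ^ r0)%N by rewrite expn_gt0.
  rewrite /cost; have [->|->] : modulus s = 1%N \/ modulus s = (2 ^ r0)%N.
  - by rewrite /modulus e; case: ifP => _; [left|right].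
  - by rewrite eqxx.
  case: ifP => // _; apply: leq_trans (fibre_cost_le M0) _.
  by rewrite -expnM [(r0 * 4)%N]mulnC expnM leqnn.
elim: J r => [|J IH] r hs e.
  by rewrite big_ord1; apply: leq_trans (cost_le _ _ e) _; rewrite leq_mul2r orbT.
have [r' e'] : exists r', ro J = Some r'.
  by have := hs J (leqnSn J); case: (ro J) => // r' _; exists r'.
have le := IH r' (fun s h => hs s (leqW h)) e'.
rewrite big_ord_recr /=.
have mono : (r' <= r)%N by apply: (scale_mono (s := J)); rewrite -?e -?e'.
have [er|ne] := eqVneq r' r.
  by rewrite -er; rewrite /cost /modulus e /= e' er eqxx /= addn0 -er.
have lt : (r'.+1 <= r)%N by rewrite ltn_neqAle ne.
have H : (16 * 16 ^ r' <= 16 ^ r)%N by rewrite -expnS leq_pexp2l.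
apply: leq_trans (leq_add le (cost_le _ _ e)) _; move: (16 ^ _)%N (16 ^ _)%N H => y z; lia.
Qed.

Lemma modulus_upper j x : 1 <= x -> 8 ^+ j <= T x ->
  (forall s, (s < j)%N -> short_words (funit growth_fibres s) (cost s)) /\
  (\sum_(s < j) cost s)%:R <= 52 * g x.
Proof.
move=> x1 hj.
have hro s : (s < j)%N -> ro s.
  move=> sj; have [|r -> //] := scale_Some (roP s) x1.
  by apply: le_trans hj; rewrite ler_eXn2l // ltr1n.
split=> [s /hro|]; first exact: cost_short.
case: j hj hro => [|j] hj hro.
  by rewrite big_ord0 mulr_ge0 // (le_trans ler01) // g_ge1.
have [r er hr] := scale_Some (roP j) x1 hj.
have := cost_sum hro er; rewrite -(ler_nat R) natrM natrX => h.
by apply: le_trans h _; move: hr; lra.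
Qed.

(** The torus to use is that of the first scale [i] sharing the value [r] of [j], where the modulus
    has not been made trivial; [i <= j] keeps its gap no larger. On an infinite fibre any [M] is
    allowed, and one exceeding [g x] is taken. *)
Lemma modulus_lower j x : 1 <= x -> T x < 8 ^+ j.+1 ->
  exists i M, [/\ (i <= j)%N, (0 < M)%N, order_ge (funit growth_fibres i) M & g x <= 16 * M%:R ^+ 4].
Proof.
move=> x1 hj; case e : (ro j) => [r|]; last first.
  exists j, (Num.truncn (g x)).+1; split=> //.
    by rewrite /= /modulus e; exact: int_order.
  have h := ltW (truncnS_gt (g x)); move: (Num.truncn _).+1 (ltn0Sn (Num.truncn (g x))) h => M M0 h.
  apply: (le_trans h); rewrite -natrX -natrM ler_nat.
  by apply: leq_trans (leq_pmull _ _); rewrite // -{1}[M]expn1 leq_pexp2l.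
have ex : exists i, ro i == ro j by exists j.
case: (ex_minnP ex) => i /eqP ei hmin.
exists i, (2 ^ r)%N; split.
- exact: hmin.
- by rewrite expn_gt0.
- have mi : modulus i = (2 ^ r)%N.
    rewrite /modulus ei e; case: ifP => // /andP[i0 /eqP h].
    by have := hmin i.-1; rewrite h e eqxx => /(_ isT); lia.
  by rewrite /= mi; apply: cyclic_order; rewrite expn_gt0.
- have := scale_below (s := j) (r := r); rewrite -e => /(_ _ (roP j) x1 hj).
  by move=> h; apply: (le_trans h); rewrite exprS ler_pM2l // -!natrX -expnM mulnC expnM.
Qed.

End Selection.

(** * Comparison with the growth function and conclusion *)

Lemma letter_gt0 : (0 < #|{: letter}|)%N.
Proof. by apply/card_gt0P; exists (inl true). Qed.

Section Growth.
Variables (R : realType) (rho : R -> R).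
Hypothesis rho_ge1 : forall x, 1 <= x -> 1 <= rho x.
Hypothesis rho1 : rho 1 = 1.
Hypothesis rho_sqrt : forall x y, 1 <= x -> x <= y ->
  rho x / Num.sqrt x <= rho y / Num.sqrt y.
Hypothesis rho_lin : forall x y, 1 <= x -> x <= y -> x / rho x <= y / rho y.
Variable ro : nat -> option nat.
Hypothesis roP : forall s, scale_spec rho s (ro s).
Notation P := (growth_fibres ro).
Notation len n := (Ex n (fun s => (word_length (@gens P) (walk_prod (@igen P) s))%:R) : R).
Notation ent n := (walk_entropy (law R (@igen P)) n).

Lemma growth n : (0 < n)%N ->
  len n <= (400 * 300) * rho n%:R /\ ln 2 * rho n%:R <= 256 * ent n.
Proof.
move=> n0; set x := n%:R : R; have x1 : 1 <= x by rewrite ler1n.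
have x0 : 0 < x by apply: lt_le_trans x1.
set q := Num.sqrt x; have q0 : 0 < q by rewrite sqrtr_gt0.
have q2 : q * q = x by rewrite -expr2 sqr_sqrtr // ltW.
have r0 : 0 < rho x by apply: lt_le_trans (rho_ge1 x1).
have [j /andP[hj1 hj2]] := scale_of rho1 rho_lin x1.
have g1 : 1 <= rho x / q by have := rho_sqrt (lexx 1) x1; rewrite rho1 sqrtr1 divr1.
have rq : q <= rho x by move: g1; rewrite ler_pdivlMr // mul1r.
have hjE : (width j)%:R = 8 ^+ j :> R by rewrite /width natrX.
have p8 : 0 < 8 ^+ j :> R by rewrite exprn_gt0.
have hq : 8 ^+ j <= q.
  by apply: le_trans hj1 _; rewrite ler_pdivrMr // -{1}q2 ler_pM2l.
have hJ : (width j ^ 2 <= n)%N.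
  by rewrite -(ler_nat R) natrX hjE -/x -q2 expr2; apply: ler_pM; rewrite ?(ltW p8).
split.
  have [hs hc] := modulus_upper rho1 rho_ge1 rho_sqrt rho_lin roP x1 hj1.
  apply: le_trans (upper_bound R hJ hs) _; rewrite hjE -/x -/q.
  have h1 : x / 8 ^+ j <= 8 * rho x.
    by move: hj2; rewrite ltr_pdivrMr // exprS ler_pdivrMr // mulrAC => /ltW.
  have h2 : q * (\sum_(s < j) cost ro s)%:R <= 52 * rho x.
    have -> : 52 * rho x = q * (52 * (rho x / q)) by field; apply: lt0r_neq0.
    by rewrite ler_pM2l.
  (* The total is [10 * (8 + 1) + 2100 * 52 = 109290], below [400 * 300]. *)
  rewrite -[2100 * q * _]mulrA; move: h1 h2 rq (ltW r0).
  move: (x / 8 ^+ j) (q * _%:R) (rho x) => a b d; clear -q; lra.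
have [i [M [ij M0 ho hM]]] := modulus_lower rho_sqrt rho_lin roP x1 hj2.
have := lower_bound R n M0 ho; rewrite -/x -/q => hl.
have M40 : 0 < M%:R ^+ 4 :> R by rewrite exprn_gt0 // ltr0n.
have hk : (gap i)%:~R <= 4 * (x / rho x) :> R.
  have : (gap i)%:~R <= 4 * 8 ^+ j :> R.
    by rewrite -hjE /gap -natrM -pmulrn ler_nat leq_mul2l width_mono.
  by move: hj1; lra.
have hm : q / M%:R ^+ 4 <= 16 * (x / rho x).
  rewrite ler_pdivrMr // mulrA mulrAC ler_pdivlMr //.
  move: hM; rewrite -/q ler_pdivrMr // => hM.
  have -> : 16 * x * M%:R ^+ 4 = q * (16 * M%:R ^+ 4 * q) by rewrite -{1}q2; ring.
  by rewrite ler_pM2l.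
have E0 : 0 <= ent n.
  apply: le_trans (@entropy_lower R P 0 n); rewrite mulr_ge0 ?ln_ge0 ?ler1n //.
  by apply: Ex_ge0 => [|zs _]; rewrite ?rest_gt0 ?ler0n.
(* [256 = 32 * 4 + 8 * 16], from [hk] and [hm]. *)
have : ln 2 * x <= (256 * (x / rho x)) * ent n.
  apply: le_trans hl _; rewrite ler_wpM2r //; move: hk hm.
  by move: (gap i)%:~R (q / _) (x / _) => a b d; lra.
have -> : 256 * (x / rho x) * ent n = x * (256 * ent n / rho x).
  by field; apply: lt0r_neq0.
by rewrite mulrC ler_pM2l // ler_pdivlMr.
Qed.

End Growth.

Theorem theorem3p8 (R : realType) :
  exists c C : R, [/\ 0 < c, 0 < C &
    forall rho : R -> R,
      (forall x, 1 <= x -> 1 <= rho x) ->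
      rho 1 = 1 ->
      (forall x y, 1 <= x -> x <= y ->
         rho x / Num.sqrt x <= rho y / Num.sqrt y) ->
      (forall x y, 1 <= x -> x <= y -> x / rho x <= y / rho y) ->
      exists (Delta : groupType) (S : set Delta) (q : Delta -> R),
        [/\ is_finite_generating_set S,
            is_finite_prob q,
            is_symmetric q,
            step_solvable Delta 4 &
            forall n : nat, (1 <= n)%N ->
              (c * rho n%:R <= expected_length S q n <= C * rho n%:R) /\
              (c * rho n%:R <= walk_entropy q n <= C * rho n%:R)]].
Proof.
pose A : R := ln (2 * #|{: letter}|)%:R.
have l2 : 0 < ln 2 :> R by rewrite ln_gt0 // ltr1n.
have A0 : 0 <= A by rewrite ln_ge0 // ler1n muln_gt0 letter_gt0.
have B0 : 0 < A + 2 * ln 2 + 1 by lra.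
(* Entropy is at most [A + 2 ln 2] times length, because length is at least 1/2; dividing the
   entropy constant by this factor gives the length bound. The added 1 makes the divisor at least 1,
   so that [c] serves entropy too. *)
pose c : R := ln 2 / 256 / (A + 2 * ln 2 + 1).
pose C : R := A * (400 * 300) + ln 2 + (400 * 300).
have c0 : 0 < c by rewrite !divr_gt0.
exists c, C; split=> //; first by rewrite /C; lra.
move=> rho rho_ge1 rho1 rho_sqrt rho_lin.
have [ro roP] := choice (scale_exists rho1 rho_sqrt).
exists (delta (growth_fibres ro)), (@gens (growth_fibres ro)), (law R (@igen (growth_fibres ro))).
split.
- exact: gens_finite.
- exact: law_finite_prob incr_gt0.
- exact: igen_symmetric.
- exact: delta_solvable.
move=> n n1.
have [h1 h2] := growth rho_ge1 rho1 rho_sqrt rho_lin roP n1.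
have h3 := length_lower R (growth_fibres ro) n1.
have h4 := @gibbs_upper R _ _ (@igen (growth_fibres ro)) incr_gt0 (word_length (@gens (growth_fibres ro)))
   _ n letter_gt0 (@length_count (growth_fibres ro)).
have r1 : 1 <= rho n%:R by apply: rho_ge1; rewrite ler1n.
have -> : expected_length (@gens (growth_fibres ro)) (law R (@igen (growth_fibres ro))) n =
  Ex n (fun s => (word_length (@gens (growth_fibres ro)) (walk_prod (@igen (growth_fibres ro)) s))%:R).
  exact: (@iid_expectationE R _ _ (@igen (growth_fibres ro)) n (fun g => (word_length (@gens (growth_fibres ro)) g)%:R)).
have cE : c * (A + 2 * ln 2 + 1) = ln 2 / 256 by rewrite /c divfK // gt_eqF.
rewrite -/A in h4.
move: h1 h2 h3 h4; move: (Ex _ _) (walk_entropy _ _) (rho _) r1 => E Hn r r1 h1 h2 h3 h4.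
have AE : A * E <= A * (400 * 300 * r) by rewrite ler_wpM2l.
have Ar : 0 <= A * r by rewrite mulr_ge0 //; lra.
have lr : ln 2 <= ln 2 * r by rewrite ler_peMr // ltW.
have lE : ln 2 <= 2 * ln 2 * E by move: (ler_wpM2l (ltW l2) h3); lra.
have Bc : (A + 2 * ln 2 + 1) * (c * r) = ln 2 * r / 256 by rewrite mulrA [_ * c]mulrC cE mulrAC.
have cr : 0 <= c * r by rewrite mulr_ge0 ?(ltW c0) //; lra.
have cr_le : c * r <= (A + 2 * ln 2 + 1) * (c * r) by rewrite ler_peMl //; lra.
split; apply/andP; split.
- by rewrite -(ler_pM2l B0) Bc; lra.
- by rewrite /C; lra.
- by lra.
- by rewrite /C; lra.
Qed.
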